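(* Let $\gamma_n=c_\gamma n^{-\alpha}$ with $c_\gamma>0$ and $\alpha\in(1/2,1)$. Suppose the following hypotheses hold. (i) For every $h\in H$, $g(x,\cdot)$ is Fréchet-differentiable at $h$ for $P_X$-almost every $x\in\mathcal X$; $G$ is differentiable; and $m\in H$ satisfies $\nabla G(m)=0$. (ii) $G$ is twice continuously differentiable, and for every $A>0$ there is $C_A>0$ such that $\|\Gamma_h\|_{op}\le C_A$ for all $h\in\mathcal B(m,A)$. (iii) At least one of the following holds: (iii.a) there is $\epsilon>0$ such that for every $h\in\mathcal B(m,\epsilon)$ there is an orthonormal basis of $H$ composed of eigenvectors of $\Gamma_h$; the infimum $\lambda_{\min}$ of the eigenvalues of $\Gamma_m$ is positive; and for every $h\in\mathcal B(m,\epsilon)$, every eigenvalue $\lambda_h$ of $\Gamma_h$ satisfies $\lambda_h\ge\lambda_{\min}/2>0$; (iii.b) there is an orthonormal basis of $H$ composed of eigenvectors of $\Gamma_m$, the infimum $\lambda_{\min}$ of the eigenvalues of $\Gamma_m$ is positive, and there are constants $c,c'>0$ such that for all $A>0$ and all $h\in\mathcal B(m,A)$, $\langle\nabla G(h),h-m\rangle\ge\min\{c,c'/A\}\,\|h-m\|^2$. (iv) There are $\epsilon',C_{\epsilon'}>0$ such that $\|\nabla G(h)-\Gamma_m(h-m)\|\le C_{\epsilon'}\|h-m\|^2$ for all $h\in\mathcal B(m,\epsilon')$. (v) There are a measurable function $f:\mathcal X\times H\to\mathbb R_+$ and a constant $C>0$ such that for $P_X$-almost every $x\in\mathcal X$ and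 all $h\in H$, $\|\nabla_h g(x,h)\|\le f(x,h)+C\|h-m\|$. (vi) There is $L_1>0$ such that either $\mathbb E[f(X,h)^2]\le L_1$ for all $h\in H$, or $\mathbb E[\|\nabla_h g(X,h)\|^2]\le L_1(1+\|h-m\|^2)$ for all $h\in H$. (vii) There are $\eta>\frac1\alpha-1$ and $L_{1+\eta}>0$ such that $\mathbb E[f(X,h)^{2(1+\eta)}]\le L_{1+\eta}$ for all $h\in H$. Then, for all $\delta>0$, as $n\to\infty$, $$\|Z_n-m\|^2=O\left(\frac{\ln n}{n^\alpha}\right)\ \text{ a.s.},\qquad \|\overline Z_n-m\|^2=o\left(\frac{(\ln n)^{1+\delta}}{n}\right)\ \text{ a.s.}$$
   Context: $H$ is a separable real Hilbert space with inner product $\langle\cdot,\cdot\rangle$ and norm $\|\cdot\|$; $\|\cdot\|_{op}$ is the operator (spectral) norm; $\mathcal B(m,r)=\{h\in H:\|h-m\|\le r\}$. $X$ is a random variable with law $P_X$ taking values in a measurable space $\mathcal X$, $g:\mathcal X\times H\to\mathbb R$, and $G(h):=\mathbb E[g(X,h)]$ is a well-defined real-valued function on $H$ which is assumed to be convex. $\nabla_h g(x,h)\in H$ denotes the gradient of $g(x,\cdot)$ at $h$ (viewed as a measurable function of $(x,h)$), and $\nabla G(h)=\mathbb E[\nabla_h g(X,h)]$ for all $h\in H$. $\Gamma_h$ denotes the Hessian of $G$ at $h$ (a bounded self-adjoint operator on $H$). Algorithms: $X_1,X_2,\dots$ are independent random variables with the same law as $X$; $\mathcal F_n=\sigma(X_1,\dots,X_n)$;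 $Z_1$ is an $\mathcal F_1$-measurable bounded $H$-valued random variable; for $n\ge1$, $Z_{n+1}=Z_n-\gamma_n\nabla_h g(X_{n+1},Z_n)$; and $\overline Z_n=\frac1n\sum_{k=1}^n Z_k$ (equivalently $\overline Z_1=Z_1$, $\overline Z_{n+1}=\overline Z_n+\frac1{n+1}(Z_{n+1}-\overline Z_n)$). *)

(* Defs.v *)
From HB Require Import structures.
Set Warnings "-notation-overridden,-notation-incompatible-prefix".
From mathcomp Require Import all_boot all_order all_algebra sesquilinear.
From mathcomp Require Import all_classical all_reals all_analysis.
Set Implicit Arguments.
Unset Strict Implicit.
Unset Printing Implicit Defensive.
Import Order.TTheory GRing.Theory Num.Theory.
Import numFieldNormedType.Exports.
Local Open Scope classical_set_scope.
Local Open Scope ring_scope.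

Section Hilbert.
Context {R : realType}.

Definition separable (T : topologicalType) : Prop :=
  exists D : set T, countable D /\ dense D.

(* A Hilbert space is a complete normed module whose norm comes from ip.
   Since {dot H for idfun} is bilinear, symmetric and positive definite,
   nothing else is needed. *)
Definition norm_from_inner (H : completeNormedModType R)
    (ip : {dot H for idfun}) : Prop :=
  forall u : H, `|u| ^+ 2 = ip u u.

Definition borel (H : topologicalType) : Type :=
  g_sigma_algebraType (@open H).

Definition linear_span (H : lmodType R) (B : set H) : set H :=
  [set v | exists (n : nat) (a : 'I_n -> R) (e : 'I_n -> H),
    (forall i, B (e i)) /\ v = \sum_(i < n) a i *: e i].

Definition orthonormal_basis (H : completeNormedModType R)
    (ip : {dot H for idfun}) (B : set H) : Prop :=
  (forall u v, B u -> B v -> ip u v = (u == v)%:R) /\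
  dense (linear_span B).

Definition eigenvalues (H : lmodType R) (A : H -> H) : set R :=
  [set l | exists2 v : H, v != 0 & A v = l *: v].

(* The members of an orthonormal basis are nonzero, so v below is an
   eigenvector. *)
Definition has_eigenbasis (H : completeNormedModType R)
    (ip : {dot H for idfun}) (A : H -> H) : Prop :=
  exists2 B : set H, orthonormal_basis ip B &
    forall v, B v -> exists l : R, A v = l *: v.

(* Only meaningful for bounded linear A: the real sup of an unbounded set
   is 0 by convention. *)
Definition opnorm (H : normedModType R) (A : H -> H) : R :=
  sup [set `|A u| | u in [set u : H | `|u| <= 1]].

Definition is_gradient (H : completeNormedModType R)
    (ip : {dot H for idfun}) (F : H -> R) (h v : H) : Prop :=
  differentiable (F : H -> R^o) h /\
  forall u, 'd (F : H -> R^o) h u = ip v u.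

(* The second derivative of F, identified with an operator on H through the
   inner product, is the derivative of the gradient gradF of F. *)
Definition is_hessian (H : completeNormedModType R) (gradF : H -> H) (h : H)
    (A : {linear H -> H}) : Prop :=
  differentiable gradF h /\ 'd gradF h = A :> (H -> H).

End Hilbert.

Section Probability.
Context {R : realType} d {Omega : measurableType d} (P : probability Omega R).

(* e is the Hilbert-space-valued expectation of Y: Y is Borel, its norm is
   integrable, and e is determined by <e, v> = E<Y, v> for all v. *)
Definition is_expectation (H : completeNormedModType R)
    (ip : {dot H for idfun}) (Y : Omega -> H) (e : H) : Prop :=
  [/\ measurable_fun [set: Omega] (Y : Omega -> borel H),
      P.-integrable [set: Omega] (fun w => (`|Y w|)%:E) &
      forall v : H, ('E_P[fun w => (ip (Y w) v)%R] = (ip e v)%:E)%E].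

(* Mutual independence of the family (Xs i) for i in D. *)
Definition independent_family dX (S : measurableType dX) (I : eqType)
    (D : set I) (Xs : I -> {RV P >-> S}) : Prop :=
  forall s : seq I, uniq s -> (forall i, i \in s -> D i) ->
  forall B : I -> set S, (forall i, i \in s -> measurable (B i)) ->
    (P (\bigcap_(i in [set` s]) (Xs i @^-1` B i)) =
     \prod_(i <- s) P (Xs i @^-1` B i))%E.

(* The values on nonmeasurable sets carry no meaning, hence the restriction. *)
Definition same_law dX (S : measurableType dX) (X Y : {RV P >-> S}) : Prop :=
  forall B : set S, measurable B -> distribution P X B = distribution P Y B.

(* sigma(X_1, ..., X_n); the variable Xs 0 is not used. *)
Definition natural_filtration dX (S : measurableType dX)
    (Xs : nat -> {RV P >-> S}) (n : nat) : set (set Omega) :=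
  <<s \bigcup_(k in [set k | 1 <= k <= n]%N)
        g_sigma_algebra_preimage (Xs k) >>.

Definition measurable_wrt (H : topologicalType) (F : set (set Omega))
    (Y : Omega -> H) : Prop :=
  forall B : set H, <<s (@open H) >> B -> F (Y @^-1` B).

End Probability.

(* (Z_1 + ... + Z_n) / n *)
Definition averaged {R : realType} (Omega : Type) (H : lmodType R)
    (Z : nat -> Omega -> H) (n : nat) (w : Omega) : H :=
  (n%:R : R)^-1 *: \sum_(1 <= k < n.+1) Z k w.

(* Main.v *)
(* The error T_n = Z_n - m is controlled by scalar Lyapunov functions only.
   Conditional expectations given the past are computed by freezing: X_(n+1) is
   independent of F_n, so the law of the pair (past, X_(n+1)) is a product and
   Tonelli applies.
   - E |T_n|^2 stays bounded, and the descent inequality makes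
     sum gamma_n E min(|T_n|^2, 1) finite; since sum gamma_n diverges,
     E min(|T_n|^2, 1) is small infinitely often, and a maximal inequality for
     this almost-supermartingale gives T_n -> 0 a.s.
   - Suppose |T_n| <= n^(-th/2) eventually, and that the gradients are
     eventually at most K n^s for some s with 1/(2(1+eta)) < s < alpha/2
     (Markov and Borel-Cantelli).  With beta = alpha - s + th/2, the exponential
     moment of kappa n^beta |T_n|^2, restricted to the event where these bounds
     have held so far, is bounded; hence |T_n|^2 = O(ln n / n^beta).  Iterating
     from th = 0 up to th = 2s reaches beta = alpha.
   - Summing Gamma_m T_k = (T_k - T_(k+1)) / gamma_k - zeta_k - delta_k, where
     zeta_k is the martingale increment and delta_k the Taylor remainder, all
     terms except sum zeta_k are O(sqrt n) by the first rate, and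
     |sum zeta_k|^2 / (n (ln n)^(1+delta)) -> 0 by the maximal inequality. *)
Require Import Defs.
Set Warnings "-notation-overridden,-notation-incompatible-prefix".
From HB Require Import structures.
From mathcomp Require Import all_boot all_order all_algebra sesquilinear.
From mathcomp Require Import all_classical all_reals all_analysis.
From mathcomp Require Import measurable_realfun.
From mathcomp Require Import ring lra zify.
Set Implicit Arguments.
Unset Strict Implicit.
Unset Printing Implicit Defensive.
Import Order.TTheory GRing.Theory Num.Theory.
Import numFieldNormedType.Exports.
Local Open Scope classical_set_scope.
Local Open Scope ring_scope.

(** Far from [m], convexity bounds [ip (gradG h) (h - m)] below only by a constant, not by a
    multiple of [|h - m|^2]; hence the descent in [min(|T_n|^2, 1)]. For the rate, the obstacle is
    that gradients are unbounded: an exponential moment of [lam |T_n|^2] is controlled in one step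
    only if [lam * gamma * K * |T_n|] stays bounded, [K] being the current bound on the gradients.
    With [gamma ~ n^(-alpha)], [K ~ n^s] and [|T_n| ~ n^(-th/2)] this forces
    [lam ~ n^(alpha - s + th/2)], which is where beta comes from, and a better [th] allows a larger
    [lam]. The window for [s] is nonempty because [eta > 1/alpha - 1] means
    [1/(2(1+eta)) < alpha/2]. Its lower end gives summability in Borel-Cantelli, its upper end gives
    [beta - th >= alpha - 2s > 0] in each round. Summable errors are always supplied as
    [r n - r n.+1] with [r >= 0]: adding [r n] then turns an almost-supermartingale into a
    supermartingale, and summability becomes telescoping. *)

Section InnerProduct.
Context {R : realType} {H : completeNormedModType R} (ip : {dot H for idfun}).
Hypothesis Hnorm : norm_from_inner ip.

Lemma ipC u v : ip u v = ip v u.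
Proof. by rewrite hermitian_subproof expr0 mul1r. Qed.

Lemma ipDl u v w : ip (u + v) w = ip u w + ip v w.
Proof. exact: linearDl. Qed.

Lemma ipBl u v w : ip (u - v) w = ip u w - ip v w.
Proof. exact: linearBl. Qed.

Lemma ipZl a u w : ip (a *: u) w = a * ip u w.
Proof. exact: linearZl_LR. Qed.

Lemma ipDr u v w : ip w (u + v) = ip w u + ip w v.
Proof. by rewrite !(ipC w) ipDl. Qed.

Lemma ipBr u v w : ip w (u - v) = ip w u - ip w v.
Proof. by rewrite !(ipC w) ipBl. Qed.

Lemma ipZr a u w : ip w (a *: u) = a * ip w u.
Proof. by rewrite !(ipC w) ipZl. Qed.

Lemma ip0l u : ip 0 u = 0.
Proof. exact: linear0l. Qed.

Lemma ip_suml I (r : seq I) (E : I -> H) w :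
  ip (\sum_(i <- r) E i) w = \sum_(i <- r) ip (E i) w.
Proof. exact: linear_sumlz. Qed.

Lemma ip_sumr I (r : seq I) (E : I -> H) w :
  ip w (\sum_(i <- r) E i) = \sum_(i <- r) ip w (E i).
Proof. by rewrite ipC ip_suml; apply: eq_bigr => i _; rewrite ipC. Qed.

Lemma sqr_normD u v : `|u + v| ^+ 2 = `|u| ^+ 2 + 2 * ip u v + `|v| ^+ 2.
Proof. rewrite !Hnorm ipDl !ipDr (ipC v u); ring. Qed.

Lemma sqr_normDZ t u v :
  `|u + t *: v| ^+ 2 = `|u| ^+ 2 + 2 * t * ip u v + t ^+ 2 * `|v| ^+ 2.
Proof.
by rewrite sqr_normD ipZr mulrA normrZ exprMn real_normK// num_real.
Qed.

(** Cauchy-Schwarz: the square of the norm of [|v| u - |u| v] expands to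
    [2 |u| |v| (|u| |v| - ip u v)], which is therefore nonnegative. *)
Lemma ip_le_norm u v : ip u v <= `|u| * `|v|.
Proof.
have [->|u0] := eqVneq u 0; first by rewrite ip0l normr0 mul0r.
have [->|v0] := eqVneq v 0; first by rewrite ipC ip0l normr0 mulr0.
have hu : 0 < `|u| by rewrite normr_gt0.
have hv : 0 < `|v| by rewrite normr_gt0.
have := sqr_ge0 `| `|v| *: u + (- `|u|) *: v |.
rewrite sqr_normDZ ipZl normrZ normr_id.
move=> hs; have {}hs : 0 <= (`|u| * `|v|) * (2 * (`|u| * `|v| - ip u v)).
  by apply: le_trans hs _; rewrite le_eqVlt; apply/orP; left; apply/eqP; ring.
by rewrite pmulr_rge0 ?mulr_gt0// in hs; lra.
Qed.

Lemma abs_ip_le u v : `|ip u v| <= `|u| * `|v|.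
Proof.
rewrite ler_norml ip_le_norm andbT.
have := ip_le_norm ((-1) *: u) v.
by rewrite ipZl scaleN1r normrN; lra.
Qed.

Lemma ip_continuousl v : continuous (fun u => ip u v : R^o).
Proof.
move=> u; apply/cvgrPdist_le => e e0 /=.
have v1 : 0 < `|v| + 1 by rewrite ltr_wpDl.
near=> w.
rewrite -ipBl (le_trans (abs_ip_le _ _))//.
apply: (@le_trans _ _ (`|u - w| * (`|v| + 1))).
  by rewrite ler_wpM2l// lerDl.
rewrite -ler_pdivlMr//.
by near: w; apply: cvgr_dist_le; [exact: cvg_id|rewrite divr_gt0].
Unshelve. all: by end_near. Qed.

End InnerProduct.

(** * Quadratic form of an operator with an orthonormal eigenbasis *)

Section Spectrum.
Context {R : realType} {H : completeNormedModType R} (ip : {dot H for idfun}).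
Hypothesis Hnorm : norm_from_inner ip.

(** On finite combinations of eigenvectors both sides are weighted sums of squared coefficients,
    compared term by term. The difference [q] is continuous and the span is dense, so the inequality
    extends to all of [H]. *)
Lemma eigenbasis_coercive (A : {linear H -> H}) (l : R) :
  continuous A -> has_eigenbasis ip A ->
  (forall a, eigenvalues A a -> l <= a) ->
  forall u, l * `|u| ^+ 2 <= ip (A u) u.
Proof.
move=> Ac [B [Bon Bd] BA] hl.
pose q u := ip (A u) u - l * `|u| ^+ 2.
have qc : continuous (q : H -> R^o).
  move=> u; apply: cvgB; last first.
    apply: cvgMr; rewrite expr2; under eq_fun do rewrite expr2.
    by apply: cvgM; exact: norm_continuous.
  apply/cvgrPdist_le => e e0 /=.
  have [k k0 Ak] := linear_lipschitz Ac.
  (* For [|u - w| <= 1] one has [|w| <= |u| + 1], so varying one slot of the form at a time costs at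
     most [k (|u| + (|u| + 1)) |u - w|], where [k] is a Lipschitz constant of [A]. *)
  have hK : 0 < k * (2 * `|u| + 1) by rewrite mulr_gt0// ltr_wpDl// mulr_ge0.
  near=> w.
  have hw : `|u - w| <= 1.
    by near: w; apply: cvgr_dist_le; [exact: cvg_id|].
  have hw2 : `|u - w| <= e / (k * (2 * `|u| + 1)).
    by near: w; apply: cvgr_dist_le; [exact: cvg_id|rewrite divr_gt0].
  have -> : ip (A u) u - ip (A w) w = ip (A (u - w)) u + ip (A w) (u - w).
    by rewrite linearB/= ipBl ipBr; ring.
  apply: (le_trans (ler_normD _ _)).
  have h1 := abs_ip_le Hnorm (A (u - w)) u.
  have h2 := abs_ip_le Hnorm (A w) (u - w).
  have h3 : `|A (u - w)| * `|u| <= k * `|u - w| * `|u| by rewrite ler_wpM2r.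
  have h4 : `|A w| * `|u - w| <= k * `|w| * `|u - w| by rewrite ler_wpM2r.
  have h5 : `|w| <= `|u| + 1.
    rewrite -[w](subrK u) addrC (le_trans (ler_normD _ _))// lerD2l.
    by rewrite distrC.
  have h6 : k * `|w| * `|u - w| <= k * (`|u| + 1) * `|u - w|.
    by rewrite ler_wpM2r// ler_wpM2l// ltW.
  move: hw2; rewrite ler_pdivlMr// => hw2.
  apply: (@le_trans _ _ (`|u - w| * (k * (2 * `|u| + 1)))); last by [].
  rewrite (_ : `|u - w| * (k * (2 * `|u| + 1)) =
    k * `|u - w| * `|u| + k * (`|u| + 1) * `|u - w|); last by ring.
  lra.
have qspan v : linear_span B v -> 0 <= q v.
  move=> [n [a [e [Be ->]]]].
  (* The vectors [e i] may repeat; coefficients are regrouped over distinct vectors so that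
     orthonormality applies. *)
  pose es := undup [seq e i | i : 'I_n].
  pose c w := \sum_(i < n | e i == w) a i.
  have -> : \sum_(i < n) a i *: e i = \sum_(w <- es) c w *: w.
    rewrite (eq_bigr (fun w => \sum_(i < n | e i == w) a i *: e i)); last first.
      move=> w _; rewrite /c scaler_suml; apply: eq_bigr => i /eqP <- //.
    rewrite (exchange_big_dep xpredT)//=; apply: eq_bigr => i _.
    rewrite big_mkcond/= (bigD1_seq (e i))/= ?undup_uniq//; last first.
      by rewrite mem_undup map_f// mem_enum.
    rewrite eqxx big1 ?addr0// => w /negPf we.
    by rewrite eq_sym we.
  have esB w : w \in es -> B w.
    by rewrite mem_undup => /mapP[i _ ->]; exact: Be.
  have esu : uniq es by exact: undup_uniq.
  pose L w := if pselect (exists l0 : R, A w = l0 *: w) is left h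
    then projT1 (cid h) else 0.
  have LE w : w \in es -> A w = L w *: w.
    move=> /esB Bw; rewrite /L; case: pselect => [h|]; last by have := BA _ Bw.
    by case: cid.
  (* [L w] is a true eigenvalue: [w] is nonzero because [ip w w = 1]. *)
  have lL w : w \in es -> l <= L w.
    move=> wes; apply: hl; exists w; last exact: LE.
    apply/eqP => w0; have := Bon _ _ (esB _ wes) (esB _ wes).
    by rewrite w0 ip0l eqxx => /esym/eqP; rewrite oner_eq0.
  have dbl (x y : H -> R) : ip (\sum_(w <- es) x w *: w) (\sum_(w <- es) y w *: w)
      = \sum_(w <- es) x w * y w.
    rewrite ip_suml; apply: eq_big_seq => w wes.
    rewrite ipZl ip_sumr (bigD1_seq w)//= ipZr.
    rewrite (Bon _ _ (esB _ wes) (esB _ wes)) eqxx mulr1.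
    rewrite big_seq_cond big1 ?addr0// => w' /andP[w'es w'w].
    by rewrite ipZr (Bon _ _ (esB _ wes) (esB _ w'es)) eq_sym (negPf w'w) mulr0.
  rewrite /q Hnorm dbl.
  have -> : A (\sum_(w <- es) c w *: w) = \sum_(w <- es) (c w * L w) *: w.
    rewrite linear_sum/=; apply: eq_big_seq => w wes.
    by rewrite linearZ/= LE// scalerA.
  rewrite dbl subr_ge0 mulr_sumr big_seq [leRHS]big_seq.
  apply: ler_sum => w wes.
  rewrite [c w * L w]mulrC -[leRHS]mulrA ler_wpM2r ?lL//.
  by rewrite -expr2 sqr_ge0.
(* If [q u < 0], the nonempty open set where [q] is negative would meet the dense span, where [q] is
   nonnegative. *)
move=> u; rewrite -subr_ge0 -/(q u) leNgt; apply/negP => qu.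
have [] := Bd (q @^-1` [set x | x < 0]).
- by exists u.
- by apply: open_comp; [move=> ? _; exact: qc|exact: open_lt].
- by move=> v [/= + /qspan]; lra.
Unshelve. all: by end_near. Qed.
End Spectrum.

(** * Convexity and the gradient along a segment *)

Section Gradient.
Context {R : realType} {H : completeNormedModType R} (ip : {dot H for idfun}).
Hypothesis Hnorm : norm_from_inner ip.

(** Convexity bounds the difference quotient in direction [h' - h] by [G h' - G h] for every step in
    []0, 1]], and the quotient tends to [ip v (h' - h)]. *)
Lemma convex_gradient_le (G : H -> R) h h' v :
  convex_function [set: convex_lmodType H] G -> is_gradient ip G h v ->
  G h + ip v (h' - h) <= G h'.
Proof.
move=> Gcvx [dG dGE].
rewrite -lerBrDl leNgt; apply/negP => hlt.
pose b := ip v (h' - h).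
have bE : 'D_(h' - h) (G : H -> R^o) h = b by rewrite deriveE// dGE.
have /cvgrPdist_lt/(_ (b - (G h' - G h))) : (t^-1 *: ((G (h + t *: (h' - h)) : R^o) - G h)) @[t --> 0^'] --> (b : R^o).
  rewrite -bE; have := @diff_derivable _ _ _ (G : H -> R^o) h (h' - h) dG.
  rewrite /derivable /derive /= => cv.
  apply: cvg_trans cv; apply: near_eq_cvg; near=> t.
  by rewrite (addrC h).
rewrite subr_gt0 => /(_ hlt) [d /= d0 Hd].
pose t := Num.min (d / 2) 1.
have t0 : 0 < t by rewrite lt_min ltr01 divr_gt0.
have t1 : t <= 1 by rewrite ge_min lexx orbT.
have td : t < d by rewrite gt_min; apply/orP; left; lra.
have := Hd t; rewrite /= sub0r normrN gtr0_norm// => /(_ td).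
rewrite lt0r_neq0// => /(_ isT).
pose tt : {i01 R} := Itv01 (ltW t0) t1.
have := Gcvx tt h' h; rewrite !in_setT => /(_ isT isT).
rewrite /conv/= => hc.
have e1 : t *: h' + (1 - t) *: h = h + t *: (h' - h).
  by rewrite scalerBl scale1r scalerBr addrCA addrA.
have {hc} : G (h + t *: (h' - h)) - G h <= t * (G h' - G h).
  rewrite -e1; have : G (t *: h' + (1 - t) *: h) <= t * G h' + (1 - t) * G h by [].
  by move=> ?; lra.
move=> hc hn.
have : b - t^-1 * (G (h + t *: (h' - h)) - G h) < b - (G h' - G h).
  by apply: le_lt_trans hn; exact: ler_norm.
rewrite ltrD2l ltrN2 -[ltRHS]mulrC.
by rewrite ltr_pdivlMr// mulrC ltNge hc.
Unshelve. all: by end_near. Qed.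

Lemma convex_gradient_monotone (G : H -> R) (gradG : H -> H) h h' :
  convex_function [set: convex_lmodType H] G ->
  (forall h, is_gradient ip G h (gradG h)) ->
  0 <= ip (gradG h - gradG h') (h - h').
Proof.
move=> Gcvx Ggrad.
have := convex_gradient_le h' Gcvx (Ggrad h).
have := convex_gradient_le h Gcvx (Ggrad h').
by rewrite !ipBl !ipBr; lra.
Qed.

(** Mean value theorem for [phi t = ip (gradG (m + t (h - m))) (h - m)] on [[0, 1]]: [phi 0 = 0],
    and the derivative is the Hessian form at a point of the segment, which stays in the ball. *)
Lemma segment_coercive (gradG : H -> H) (Gamma : H -> {linear H -> H}) m e l h :
  (forall h, is_hessian gradG h (Gamma h)) -> gradG m = 0 ->
  (forall h u, `|h - m| <= e -> l * `|u| ^+ 2 <= ip (Gamma h u) u) ->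
  `|h - m| <= e -> l * `|h - m| ^+ 2 <= ip (gradG h) (h - m).
Proof.
move=> hess gm hl hme.
pose T := h - m.
pose line (t : R) : H := m + t *: T.
pose phi (t : R) := ip (gradG (line t)) T.
have dphi (t : R) : is_derive t 1 phi (ip (Gamma (line t) T) T).
  have [dg dgE] := hess (line t).
  have cv : s^-1 *: (gradG (s *: T + line t) - gradG (line t)) @[s --> 0^']
      --> Gamma (line t) T.
    by rewrite -dgE -deriveE//; exact: (diff_derivable (v := T) dg).
  have cv2 : s^-1 *: ((phi \o shift t) (s *: 1) - phi t) @[s --> 0^']
      --> (ip (Gamma (line t) T) T : R^o).
    have : (ip^~ T \o (fun s => s^-1 *: (gradG (s *: T + line t) - gradG (line t)))) s
        @[s --> 0^'] --> (ip (Gamma (line t) T) T : R^o).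
      exact: (@cvg_comp _ _ _ _ (ip^~ T) _ _ _ cv (@ip_continuousl _ _ _ Hnorm T _)).
    apply: cvg_trans; apply: near_eq_cvg; near=> s.
    rewrite /= /phi /shift /line ipZl ipBl [s *: 1]mulr1.
    by rewrite scalerDl addrCA.
  by apply: DeriveDef; [apply/cvg_ex; exists (ip (Gamma (line t) T) T)|exact: cvg_lim].
have [c + ] := MVT ltr01 (fun x _ => dphi x) (derivable_within_continuous
  (fun x _ => @ex_derive _ _ _ _ _ _ _ (dphi x))).
rewrite in_itv/= => /andP[c0 c1].
rewrite /phi /line scale0r addr0 gm ip0l subr0 scale1r subr0 mulr1 addrC subrK.
move=> ->; apply: hl; rewrite addrC addKr normrZ gtr0_norm//.
by apply: le_trans hme; rewrite ler_piMl// ltW.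
Unshelve. all: by end_near. Qed.

End Gradient.

(** * One global lower bound from either form of hypothesis (iii) *)

Section Coercivity.
Context {R : realType} {H : completeNormedModType R} (ip : {dot H for idfun}).
Hypothesis Hnorm : norm_from_inner ip.
Context {gradG : H -> H} {Gamma : H -> {linear H -> H}}.
Hypothesis hess : forall h, is_hessian gradG h (Gamma h).

Lemma hessian_continuous h : continuous (Gamma h).
Proof. by have [dg <-] := hess h; move=> x; exact: diff_continuous. Qed.

(** [inf] is 0 by convention when there is no genuine infimum, so its positivity guarantees that it
    is a lower bound. *)
Lemma eigenvalue_ge_inf (A : H -> H) a :
  0 < inf (eigenvalues A) -> eigenvalues A a -> inf (eigenvalues A) <= a.
Proof.
move=> i0 Aa; apply: ge_inf => //.
have [[]//|/inf_out ie] := pselect (has_inf (eigenvalues A)).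
by move: i0; rewrite ie ltxx.
Qed.

(** Coercivity and Cauchy-Schwarz. This is what later recovers the size of a sum of errors from that
    of its image under [Gamma m]. *)
Lemma hessian_bounded_below m :
  has_eigenbasis ip (Gamma m) -> 0 < inf (eigenvalues (Gamma m)) ->
  forall u, inf (eigenvalues (Gamma m)) * `|u| <= `|Gamma m u|.
Proof.
move=> eb i0 u.
have [->|u0] := eqVneq u 0; first by rewrite normr0 mulr0.
have hu : 0 < `|u| by rewrite normr_gt0.
have := eigenbasis_coercive Hnorm (hessian_continuous (h := m)) eb
  (fun a => eigenvalue_ge_inf i0) u.
move=> /le_trans/(_ (ip_le_norm Hnorm _ _)).
by rewrite expr2 mulrA ler_pM2r.
Qed.

(** Outside the ball of radius [r = min(e, 1)], [h] is compared with the point [h'] of the segment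
    from [m] at distance [r]: the gradient is monotone along the segment, so the bound at [h']
    carries over to [h] as a constant. *)
Lemma coercive_global (G : H -> R) m l e :
  convex_function [set: convex_lmodType H] G ->
  (forall h, is_gradient ip G h (gradG h)) -> gradG m = 0 ->
  0 < l -> 0 < e ->
  (forall h, `|h - m| <= e -> l * `|h - m| ^+ 2 <= ip (gradG h) (h - m)) ->
  forall h, l * Num.min e 1 ^+ 2 * Num.min (`|h - m| ^+ 2) 1
    <= ip (gradG h) (h - m).
Proof.
move=> Gcvx Ggrad gm l0 e0 hloc h.
set r := Num.min e 1.
have r0 : 0 < r by rewrite lt_min e0 ltr01.
have r1 : r <= 1 by rewrite ge_min lexx orbT.
have re : r <= e by rewrite ge_min lexx.
have r21 : r ^+ 2 <= 1 by rewrite expr_le1// ltW.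
have [hr|hr] := leP `|h - m| r.
  apply: le_trans (hloc _ (le_trans hr re)).
  rewrite -mulrA ler_pM2l//.
  apply: (@le_trans _ _ (1 * Num.min (`|h - m| ^+ 2) 1)).
    by rewrite ler_wpM2r// le_min sqr_ge0 ler01.
  by rewrite mul1r ge_min lexx.
have hn0 : 0 < `|h - m| by apply: lt_trans hr.
pose s := r / `|h - m|.
have s0 : 0 < s by rewrite divr_gt0.
have s1 : s < 1 by rewrite ltr_pdivrMr// mul1r.
pose h' := m + s *: (h - m).
have h'm : h' - m = s *: (h - m) by rewrite /h' addrC addKr.
have nh' : `|h' - m| = r by rewrite h'm normrZ gtr0_norm// divfK// gt_eqF.
have := hloc h'; rewrite nh' => /(_ re); rewrite h'm (ipZr ip) => h1.
have := convex_gradient_monotone h h' Gcvx Ggrad.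
have -> : h - h' = (1 - s) *: (h - m).
  by rewrite /h' opprD addrA scalerBl scale1r.
rewrite (ipZr ip) pmulr_rge0 ?subr_gt0// ipBl subr_ge0 => h2.
apply: le_trans h2.
apply: (@le_trans _ _ (l * r ^+ 2)).
  by rewrite ler_piMr// ?ge_min ?lexx ?orbT// mulr_ge0// ?ltW// exprn_gt0.
apply: le_trans h1 _.
have [i0|i0] := leP 0 (ip (gradG h') (h - m)).
  by rewrite ler_piMl// ltW.
exfalso.
have := hloc h'; rewrite nh' => /(_ re); rewrite h'm (ipZr ip).
have : s * ip (gradG h') (h - m) < 0 by rewrite pmulr_rlt0.
have : 0 < l * r ^+ 2 by rewrite mulr_gt0// exprn_gt0.
by lra.
Qed.

(** Everything after this point uses only the constant [l]: its first property drives the descent,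
    its second the averaged sequence. *)
Lemma strong_convexity_coercive (G : H -> R) m :
  convex_function [set: convex_lmodType H] G ->
  (forall h, is_gradient ip G h (gradG h)) -> gradG m = 0 ->
  (exists2 eps : R, 0 < eps &
     [/\ forall h, `|h - m| <= eps -> has_eigenbasis ip (Gamma h),
         0 < inf (eigenvalues (Gamma m)) &
         forall h, `|h - m| <= eps ->
           forall l, eigenvalues (Gamma h) l ->
             inf (eigenvalues (Gamma m)) / 2 <= l])
  \/
  [/\ has_eigenbasis ip (Gamma m),
      0 < inf (eigenvalues (Gamma m)) &
      exists c c' : R, [/\ 0 < c, 0 < c' &
        forall (A : R) (h : H), 0 < A -> `|h - m| <= A ->
          Num.min c (c' / A) * `|h - m| ^+ 2 <= ip (gradG h) (h - m)]] ->
  exists2 l : R, 0 < l &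
    (forall h, l * Num.min (`|h - m| ^+ 2) 1 <= ip (gradG h) (h - m)) /\
    (forall u, l * `|u| <= `|Gamma m u|).
Proof.
move=> Gcvx Ggrad gm hsc.
suff [[l l0 hl] [i0 eb]] : (exists2 l : R, 0 < l &
    forall h, l * Num.min (`|h - m| ^+ 2) 1 <= ip (gradG h) (h - m)) /\
    0 < inf (eigenvalues (Gamma m)) /\ has_eigenbasis ip (Gamma m).
  have hb := hessian_bounded_below eb i0.
  exists (Num.min l (inf (eigenvalues (Gamma m)))); first by rewrite lt_min l0.
  split=> [h|u].
    apply: le_trans (hl h); apply: ler_wpM2r; last by rewrite ge_min lexx.
    by rewrite le_min sqr_ge0 ler01.
  by apply: le_trans (hb u); rewrite ler_wpM2r// ge_min lexx orbT.
case: hsc => [[e e0 [eb i0 hi]]|[eb i0 [c [c' [c0 c'0 hc]]]]]; last first.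
  split=> //; exists (Num.min c c'); first by rewrite lt_min c0.
  move=> h.
  have [->|hm] := eqVneq h m.
    by rewrite subrr normr0 expr0n/= ipC ip0l [X in _ * X]min_l ?ler01// mulr0.
  have n0 : 0 < `|h - m| by rewrite normr_gt0 subr_eq0.
  have m0 : 0 <= Num.min c c' by rewrite le_min !ltW.
  (* Under (iii.b) the radius is taken to be 1 inside the unit ball and [|h - m|] outside, where
     [(c' / A) A^2 = c' A >= c']. *)
  have [h1|h1] := leP `|h - m| 1.
    apply: le_trans (hc 1 h ltr01 h1).
    by rewrite divr1 ler_wpM2l// ge_min lexx.
  apply: le_trans (hc _ h n0 (lexx _)).
  apply: (@le_trans _ _ (Num.min c c')).
    by rewrite ler_piMr// ge_min lexx orbT.
  rewrite minr_pMl ?sqr_ge0//. rewrite le_min; apply/andP; split.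
    rewrite ge_min; apply/orP; left.
    by rewrite ler_peMr ?ltW// exprn_egt1.
  rewrite ge_min; apply/orP; right.
  by rewrite expr2 mulrA divfK ?gt_eqF// ler_peMr// ltW.
split; last by split=> //; apply: eb; rewrite subrr normr0 ltW.
set l := inf (eigenvalues (Gamma m)) / 2 in hi *.
have l0 : 0 < l by rewrite divr_gt0.
exists (l * Num.min e 1 ^+ 2).
  by rewrite mulr_gt0// exprn_gt0// lt_min e0 ltr01.
apply: (coercive_global Gcvx Ggrad gm l0 e0) => h he.
apply: (segment_coercive Hnorm hess gm _ he) => h' u h'e.
apply: eigenbasis_coercive => //; [exact: hessian_continuous|exact: eb|].
exact: hi.
Qed.

End Coercivity.

(** * Borel measurability of vector operations in a separable space *)

Section BorelSeparable.
Context {R : realType} {H : completeNormedModType R}.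
Hypothesis Hsep : separable H.

Lemma separable_dense_seq :
  exists s : nat -> H, forall x (e : R), 0 < e -> exists i, `|s i - x| < e.
Proof.
have [D [/countable_injP[f finj] Dd]] := Hsep.
pose s i := if pselect (exists2 x, D x & f x = i) is left h
  then projT1 (cid2 h) else 0 : H.
exists s => x e e0.
have [] := Dd (ball x e); [by exists x; exact: ballxx| exact: ball_open|].
move=> y [xy Dy]; exists (f y); rewrite /s; case: pselect => [h|]; last first.
  by case; exists y.
case: cid2 => z Dz /= /finj -> //; rewrite ?inE//.
by move: xy; rewrite -ball_normE/= distrC.
Qed.

Lemma open_ball_measurable (x : H) (e : R) :
  measurable ([set y | `|x - y| < e] : set (borel H)).
Proof.
by apply: sub_sigma_algebra; have := ball_open x e; rewrite -ball_normE.
Qed.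

(* In a separable space an open subset of the square is a countable union of
   products of balls, so it belongs to the product sigma-algebra. *)
Lemma open_prod_measurable (W : set (H * H)) :
  open W -> measurable (W : set (borel H * borel H)).
Proof.
move=> oW; have [s sd] := separable_dense_seq.
pose r (k : nat) : R := k.+1%:R^-1.
pose box (i : nat * nat * nat) : set (H * H) :=
  [set y | `|s i.1.1 - y| < r i.2] `*` [set y | `|s i.1.2 - y| < r i.2].
(* Boxes not contained in [W] are replaced by the empty set, so the union runs over all triples of
   indices. *)
pose F i := if pselect (box i `<=` W) then box i else set0.
have -> : W = \bigcup_i F i.
  apply/seteqP; split=> [[x y] Wxy|x [i _]]; last first.
    by rewrite /F; case: pselect => // h /h.
  have [/= e e0 He] : nbhs_ball (x, y) W by apply/nbhs_ballP; exact: open_nbhs_nbhs.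
  have [k hk] : exists k, r k < e / 2.
    have [k _ hk] := near_infty_natSinv_lt (PosNum (divr_gt0 e0 (@ltr0Sn R 1))).
    by exists k; exact: hk (leqnn k).
  have rk0 : 0 < r k by rewrite invr_gt0.
  have [i hi] := sd x _ rk0.
  have [j hj] := sd y _ rk0.
  exists (i, j, k) => //; rewrite /F; case: pselect => [hsub|]; first by split.
  case=> z [/= ha hb]; apply: He; split; rewrite -ball_normE/=.
    rewrite -(subrK (s i) x) -addrA (le_lt_trans (ler_normD _ _))// distrC; lra.
  rewrite -(subrK (s j) y) -addrA (le_lt_trans (ler_normD _ _))// distrC; lra.
apply: countable_bigcupT_measurable => // i.
rewrite /F; case: pselect => h /=; last exact: measurable0.
by apply: measurableX; exact: open_ball_measurable.
Qed.

Context {d} {T : measurableType d}.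

(** Measurability of a pair refers to the product sigma-algebra while continuity of [F] concerns
    open sets of [H * H]; [open_prod_measurable] reconciles the two. The generator [G] is free so
    that [F] may be vector-valued or real-valued. *)
Lemma measurable_borel_comp {d'} {T' : measurableType d'} (F : H * H -> T')
    (G : set (set T')) (u v : T -> borel H) :
  measurable = <<s G >> -> (forall A, G A -> open (F @^-1` A)) ->
  measurable_fun setT u -> measurable_fun setT v ->
  measurable_fun setT (fun w => F (u w, v w)).
Proof.
move=> GE oF mu mv; apply: (measurability G) => // _ [A GA <-].
have := measurable_fun_pair mu mv measurableT.
by move=> /(_ _ (open_prod_measurable (oF _ GA))).
Qed.

Lemma measurable_borelD (u v : T -> borel H) :
  measurable_fun setT u -> measurable_fun setT v ->
  measurable_fun setT (fun w => (u w : H) + (v w : H) : borel H).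
Proof.
apply: (measurable_borel_comp (F := fun p => (p.1 + p.2 : borel H))
  (G := @open H)) => // A oA.
by apply: open_comp oA => p _; exact: add_continuous.
Qed.

Lemma measurable_borel_continuous (F : H -> H) (u : T -> borel H) :
  continuous F -> measurable_fun setT u ->
  measurable_fun setT (fun w => F (u w) : borel H).
Proof.
move=> Fc mu; apply: (measurable_borel_comp (F := fun p => (F p.1 : borel H))
  (G := @open H) (v := u)) => // A oA.
apply: open_comp oA => p _; apply: continuous_comp; last exact: Fc.
exact: cvg_fst.
Qed.

Lemma measurable_borelZ (k : R) (u : T -> borel H) :
  measurable_fun setT u ->
  measurable_fun setT (fun w => k *: (u w : H) : borel H).
Proof. by apply: measurable_borel_continuous; exact: scaler_continuous. Qed.

Lemma measurable_borelB (u v : T -> borel H) :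
  measurable_fun setT u -> measurable_fun setT v ->
  measurable_fun setT (fun w => (u w : H) - (v w : H) : borel H).
Proof.
move=> mu mv; apply: measurable_borelD => //.
by apply: measurable_borel_continuous mv; exact: opp_continuous.
Qed.

Lemma measurable_norm (u : T -> borel H) :
  measurable_fun setT u -> measurable_fun setT (fun w => `|u w : H|).
Proof.
move=> mu.
apply: (measurable_borel_comp (F := fun p => (`|p.1| : R))
  (G := @RGenOpens.G R) (v := u)) => //.
  exact: RGenOpens.measurableE.
move=> A [x [y ->]]; apply: open_comp; last exact: interval_open.
move=> p _.
by apply: (@continuous_comp _ _ R^o); [exact: cvg_fst|exact: norm_continuous].
Qed.

End BorelSeparable.

(** The probabilities are bounded by a telescoping difference of a nonnegative sequence, so their
    sum is at most [r n0]. *)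
Lemma borel_cantelli_ae {R : realType} {d} {T : measurableType d}
    (P : probability T R) (A : nat -> set T) (r : nat -> R) n0 :
  (forall n, (n0 <= n)%N -> measurable (A n)) -> (forall n, 0 <= r n) ->
  (forall n, (n0 <= n)%N -> (P (A n) <= (r n - r n.+1)%:E)%E) ->
  {ae P, forall w, \forall n \near \oo, ~ A n w}.
Proof.
move=> mA r0 hA.
pose B n := if (n0 <= n)%N then A n else set0.
have mB n : measurable (B n) by rewrite /B; case: ifP => // /mA.
have hB : (\sum_(0 <= n <oo) P (B n) < +oo)%E.
  apply: (@le_lt_trans _ _ (r n0)%:E); last exact: ltry.
  apply: lime_le; first by apply: is_cvg_nneseries.
  apply: nearW => n.
  (* Keeping the remaining budget [r] on the left makes the partial sums provable by induction;
     [maxn] covers the indices before [n0], where [B] is empty. *)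
  suff : (\sum_(0 <= i < n) P (B i) + (r (maxn n n0))%:E <= (r n0)%:E)%E.
    by apply: le_trans; rewrite leeDl// lee_fin.
  elim: n => [|n IH]; first by rewrite big_geq// max0n add0e.
  rewrite big_nat_recr//=; apply: le_trans IH; rewrite -addeA; apply: leeD2l.
  rewrite /B; case: leqP => h; last first.
    by rewrite measure0 add0e !(maxn_idPr _)// ltnW.
  rewrite !(maxn_idPl _)//; last exact: leqW.
  apply: (@le_trans _ _ ((r n - r n.+1)%:E + (r n.+1)%:E)%E).
    by apply: leeD2r; exact: hA.
  by rewrite -EFinD subrK.
have h0 := lim_sup_set_cvg0 mB hB.
exists (lim_sup_set B); split => //.
  by apply: bigcap_measurableType => n _; apply: bigcup_measurable => k _.
move=> w /= hw n _; apply: contrapT => hn; apply: hw.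
exists (maxn n n0) => // k /= hk Ak; apply: hn.
exists k; first by rewrite /= (leq_trans _ hk)// leq_maxl.
by rewrite /B (leq_trans _ hk)// leq_maxr.
Qed.

(** * Telescoping bounds and limits for powers and logarithms *)

Section Powers.
Context {R : realType}.
Implicit Types x y p : R.

Lemma powR_expR x p : 0 < x -> x `^ p = expR (p * ln x).
Proof. by move=> x0; rewrite /powR gt_eqF. Qed.

Lemma ln_le_subr1 x : 0 < x -> ln x <= x - 1.
Proof.
move=> x0; rewrite -ler_expR lnK ?posrE//.
by apply: le_trans (expR_ge1Dx _); rewrite addrC subrK.
Qed.

(** Replaces comparison with an integral: after factoring out [y^(-p)], the inequalities
    [exp z >= 1 + z] and [ln z <= z - 1] are applied with [z] built from [x / y]. *)
Lemma powRN_decrement x y p : 0 < x -> x <= y -> 0 <= p ->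
  p * (y - x) * y `^ (- (p + 1)) <= x `^ (- p) - y `^ (- p).
Proof.
move=> x0 xy p0; have y0 : 0 < y by apply: lt_le_trans xy.
have -> : y `^ (- (p + 1)) = y `^ (- p) * y^-1.
  by rewrite opprD powRD ?powR_inv1 ?(ltW y0)//; apply/implyP => _; rewrite gt_eqF.
have -> : x `^ (- p) = y `^ (- p) * (x / y) `^ (- p).
  by rewrite -powRM ?divr_ge0 ?ltW// mulrC divfK// gt_eqF.
rewrite -[X in _ <= _ - X]mulr1 -mulrBr mulrCA; apply: ler_wpM2l; first exact: powR_ge0.
rewrite powR_expR ?divr_gt0//.
apply: (@le_trans _ _ (1 + (- p * ln (x / y)) - 1)); last by rewrite lerB// expR_ge1Dx.
rewrite addrAC subrr add0r mulNr -mulrN -mulrA; apply: ler_wpM2l => //.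
rewrite mulrBl divff ?gt_eqF// -opprB lerN2.
by apply: ln_le_subr1; rewrite divr_gt0.
Qed.

(** In [C = 2^p / (p - 1)], the denominator comes from [powRN_decrement] at exponent [p - 1], and
    [2^p] pays for replacing [n + 1] by [n], as [n + 1 <= 2 n]. *)
Lemma powRN_telescope p : 1 < p -> exists2 C : R, 0 < C &
  forall n, (0 < n)%N -> n%:R `^ (- p) <=
    C * (n%:R `^ (- (p - 1))) - C * (n.+1%:R `^ (- (p - 1))).
Proof.
move=> p1; have q0 : 0 < p - 1 by rewrite subr_gt0.
exists (2 `^ p / (p - 1)); first by rewrite divr_gt0// powR_gt0.
move=> n n0; rewrite -mulrBr.
have n0' : 0 < n%:R :> R by rewrite ltr0n.
have := @powRN_decrement n%:R n.+1%:R (p - 1) n0' _ (ltW q0).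
rewrite ler_nat leqnSn => /(_ isT); rewrite subrK -natr1 addrAC subrr add0r mulr1.
rewrite natr1 -ler_pdivlMl// => h.
apply: (@le_trans _ _ (2 `^ p * n.+1%:R `^ (- p))); last first.
  by rewrite -mulrA ler_pM2l ?powR_gt0.
rewrite !powRN ler_pdivlMr ?powR_gt0// mulrC ler_pdivrMr ?powR_gt0// -powRM//.
apply: ge0_ler_powR; rewrite ?nnegrE//; first lra.
by rewrite -natrM ler_nat; lia.
Qed.

(** The decrement bound at [ln n] and [ln (n + 1)], whose difference is at least [1 / (n + 1)];
    [n > 1] keeps [ln n] positive. *)
Lemma ln_powRN_telescope p n : 0 < p -> (1 < n)%N ->
  n.+1%:R^-1 * ln n.+1%:R `^ (- (1 + p)) <=
  p^-1 * ln n%:R `^ (- p) - p^-1 * ln n.+1%:R `^ (- p) :> R.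
Proof.
move=> p0 n1; rewrite -mulrBr ler_pdivlMl//.
have n0' : 0 < n%:R :> R by rewrite ltr0n ltnW.
have l0 : 0 < ln (n%:R : R) by rewrite ln_gt0// ltr1n.
have ll : ln (n%:R : R) <= ln n.+1%:R by rewrite ler_ln ?posrE// ler_nat.
apply: le_trans (powRN_decrement l0 ll (ltW p0)).
rewrite (addrC 1) mulrA ler_wpM2r ?powR_ge0// ler_wpM2l ?(ltW p0)//.
have h : 0 < (n%:R / n.+1%:R : R) by rewrite divr_gt0.
have := ln_le_subr1 h; rewrite ln_div ?posrE//.
have -> : n%:R / n.+1%:R - 1 = - n.+1%:R^-1 :> R.
  by rewrite -[X in _ - X](@divff _ n.+1%:R) ?pnatr_eq0// -mulrBl -natr1 opprD addrA subrr sub0r mulN1r.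
by move=> h'; rewrite -lerN2 opprB.
Qed.

Lemma cvg_powRN p : 0 < p -> n%:R `^ (- p) @[n --> \oo] --> (0 : R).
Proof.
move=> p0; apply/cvgrPdist_lt => e e0; near=> n.
have n0 : 0 < n%:R :> R by rewrite ltr0n; near: n; exact: nbhs_infty_gt.
rewrite sub0r normrN ger0_norm ?powR_ge0//.
have he : expR (- ln e / p) < n%:R by near: n; exact: nbhs_infty_gtr.
rewrite powR_expR// -[ltRHS]lnK ?posrE// ltr_expR.
have : - ln e / p < ln n%:R by rewrite -ltr_expR lnK ?posrE.
rewrite ltr_pdivrMr// mulrC => h; rewrite mulNr; lra.
Unshelve. all: by end_near. Qed.

(** Half of the exponent absorbs the logarithm, since [ln n <= (2 / p) n^(p/2)]. *)
Lemma cvg_ln_powRN p : 0 < p -> ln n%:R * n%:R `^ (- p) @[n --> \oo] --> (0 : R).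
Proof.
move=> p0; have p20 : 0 < p / 2 by rewrite divr_gt0.
have h : 2 / p * n%:R `^ (- (p / 2)) @[n --> \oo] --> (0 : R).
  by rewrite -[X in _ --> X](mulr0 (2 / p)); apply: cvgMr; exact: cvg_powRN.
apply: (squeeze_cvgr _ (cvg_cst 0) h); near=> n.
have n1 : (1 < n)%N by near: n; exact: nbhs_infty_gt.
have n0 : 0 < n%:R :> R by rewrite ltr0n ltnW.
rewrite mulr_ge0 ?powR_ge0 ?ln_ge0 ?ler1n ?(ltnW n1)//=.
have -> : - p = p / 2 * (- 1) + - (p / 2) by field.
rewrite powRD; last by apply/implyP => _; rewrite gt_eqF.
rewrite mulrA; apply: ler_wpM2r; first exact: powR_ge0.
rewrite mulrN1 powRN ler_pdivrMr ?powR_gt0//.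
have := ln_le_subr1 (powR_gt0 (p / 2) n0).
rewrite ln_powR => hl.
rewrite -(ler_pM2l p20) mulrA.
have -> : p / 2 * (2 / p) = 1 by field; rewrite gt_eqF.
by rewrite mul1r; apply: le_trans hl _; rewrite gerBl.
Unshelve. all: by end_near. Qed.

Lemma cvg_ln_pow0 p : 0 < p -> ln n%:R `^ (- p) @[n --> \oo] --> (0 : R).
Proof.
move=> p0; apply/cvgrPdist_lt => e e0; near=> n.
have he : expR (expR (- ln e / p)) < n%:R by near: n; exact: nbhs_infty_gtr.
have n0 : 0 < n%:R :> R by apply: lt_trans he; exact: expR_gt0.
have hl : expR (- ln e / p) < ln n%:R by rewrite -ltr_expR (lnK n0).
have l0 : 0 < ln (n%:R : R) by apply: lt_trans hl; exact: expR_gt0.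
rewrite sub0r normrN ger0_norm ?powR_ge0//.
rewrite powR_expR// -[ltRHS]lnK ?posrE// ltr_expR.
have : - ln e / p < ln (ln n%:R) by rewrite -ltr_expR (lnK l0).
rewrite ltr_pdivrMr// mulrC => h; rewrite mulNr; lra.
Unshelve. all: by end_near. Qed.

End Powers.

(** * Independence of the past and the next sample; freezing the past *)

Section Freezing.
Context {R : realType} {d} {Omega : measurableType d} {P : probability Omega R}.
Context {dX} {S : measurableType dX} {X : {RV P >-> S}}
  {Xs : nat -> {RV P >-> S}}.
Hypothesis Xs_indep : independent_family [set n | (1 <= n)%N] Xs.
Hypothesis Xs_law : forall n, (1 <= n)%N -> same_law (Xs n) X.

Definition past n : set (set Omega) :=
  \bigcup_(k in [set k | 1 <= k <= n]%N) g_sigma_algebra_preimage (Xs k).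

(** [Omega] with [sigma(X_1, ..., X_n)] as its measurable structure: being adapted becomes plain
    measurability on this type. *)
Definition pastType n := g_sigma_algebraType (past n).

Lemma past_measurable n A :
  natural_filtration Xs n A -> measurable A.
Proof.
apply: smallest_sub; first exact: sigma_algebra_measurable.
move=> _ [k _ [B mB <-]]; rewrite setTI -[_ @^-1` _]setTI.
exact: measurable_funP.
Qed.

Lemma past_subset n p A : (n <= p)%N ->
  natural_filtration Xs n A -> natural_filtration Xs p A.
Proof.
move=> np; apply: sub_sigma_algebra2; apply: bigcup_subset => k /= /andP[-> kn].
exact: leq_trans np.
Qed.

Lemma past_variable n k B : (1 <= k <= n)%N -> measurable B ->
  natural_filtration Xs n (Xs k @^-1` B).
Proof.
move=> kn mB; apply: sub_sigma_algebra; exists k => //.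
by exists B => //; rewrite setTI.
Qed.

(** A pi-system generating the past, on which the independence hypothesis speaks directly. *)
Let cylinder n : set (set Omega) :=
  [set A | exists2 C : nat -> set S, (forall i, measurable (C i)) &
    A = \bigcap_(i in [set` iota 1 n]) (Xs i @^-1` C i)].

Let cylinder_measurable n : cylinder n `<=` measurable.
Proof.
move=> _ [C mC ->]; apply: bigcap_measurableType => i _.
by rewrite -[_ @^-1` _]setTI; exact: measurable_funP.
Qed.

Let past_cylinder n A :
  natural_filtration Xs n A -> <<s cylinder n >> A.
Proof.
apply: smallest_sub; first exact: smallest_sigma_algebra.
move=> _ [k /= kn [B mB <-]]; rewrite setTI; apply: sub_sigma_algebra.
exists (fun i => if i == k then B else setT).
  by move=> i; case: ifP.
apply/seteqP; split=> [w Bw i _ /=|w]; first by case: eqP => // ->.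
by move=> /(_ k); rewrite /= eqxx; apply; rewrite mem_iota add1n ltnS.
Qed.

(** With [E] the event on [X_(n+1)], the measures [A -> P (A & E)] and [A -> P A * P E] agree on the
    cylinders, hence on the sigma-algebra they generate. *)
Lemma past_indep n A B : natural_filtration Xs n A -> measurable B ->
  (P (A `&` Xs n.+1 @^-1` B) = P A * P (Xs n.+1 @^-1` B))%E.
Proof.
move=> FA mB.
have mE : measurable (Xs n.+1 @^-1` B).
  by rewrite -[_ @^-1` _]setTI; exact: measurable_funP.
pose r : {nonneg R} := NngNum (fine_ge0 (measure_ge0 P (Xs n.+1 @^-1` B))).
have rE C : (mscale r P C = P C * P (Xs n.+1 @^-1` B))%E.
  by rewrite muleC; congr (_ * _)%E; apply: fineK; exact: fin_num_measure.
rewrite -rE.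
apply: (@g_sigma_algebra_measure_unique _ _ _ (cylinder n)
  (@cylinder_measurable n) (fun=> setT) _ _ (mrestr P mE) (mscale r P)).
- move=> _; exists (fun=> setT) => //.
  by apply/seteqP; split.
- by rewrite bigcup_const//; exists 0%N.
- move=> _ _ [C mC ->] [C' mC' ->]; exists (fun i => C i `&` C' i).
    by move=> i; exact: measurableI.
  by rewrite -bigcapI.
- move=> _ [C mC ->]; apply: etrans (esym (rE _)); rewrite /= /mrestr.
  rewrite (Xs_indep (iota_uniq 1 n))//; last first.
    by move=> i; rewrite mem_iota/= => /andP[].
  (* Independence over [1, ..., n + 1], with [B] placed at index [n + 1], is divided into the first
     [n] factors and the last one. *)
  have := Xs_indep (iota_uniq 1 n.+1) _
    (B := fun i => if i == n.+1 then B else C i).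
  have -> : iota 1 n.+1 = iota 1 n ++ [:: n.+1] by rewrite -[n.+1 in LHS]addn1 iotaD add1n.
  rewrite big_cat big_seq1/= eqxx => hP.
  rewrite [X in _ = (X * _)%E](_ : _ = \prod_(i <- iota 1 n) P (Xs i @^-1` (if i == n.+1 then B else C i)))%E; last first.
    apply: eq_big_seq => i iin; case: eqP => // ie; move: iin.
    by rewrite ie mem_iota add1n ltnn andbF.
  rewrite -hP.
  + congr (P _); apply/seteqP; split=> [w [h1 h2] i /=|w h].
      rewrite mem_cat inE => /orP[iin|/eqP->]; last by rewrite eqxx.
      case: eqP => [->//|_]; exact: h1.
    split=> [i /= iin|]; last first.
      by have := h n.+1; rewrite /= eqxx mem_cat inE eqxx orbT; apply.
    have := h i; rewrite /= mem_cat iin => /(_ isT).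
    case: eqP => // ie; move: iin; rewrite ie mem_iota.
    by rewrite add1n ltnn andbF.
  + move=> i; rewrite mem_cat mem_iota inE => /orP[/andP[]//|/eqP->//].
  + by move=> i _; case: ifP.
- by move=> _; rewrite /mrestr/= (le_lt_trans (probability_le1 _ _)) ?ltry//; exact: measurableI.
- exact: past_cylinder.
Qed.

(** The whole past is itself a random variable, the identity from [Omega] to [pastType Xs n]. Its
    joint law with [X_(n+1)] is a product by [past_indep], so Tonelli integrates the fresh sample
    first, and [X] may stand for it. *)
Lemma ge0_integral_freezing n (phi : pastType n * S -> \bar R) :
  measurable_fun setT phi -> (forall p, (0 <= phi p)%E) ->
  (\int[P]_w phi (w, Xs n.+1 w) = \int[P]_w \int[P]_v phi (w, X v))%E.
Proof.
move=> mphi phi0.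
have mj : measurable_fun setT (id : Omega -> pastType n).
  by move=> _ A FA; rewrite setTI; exact: past_measurable FA.
pose j : {RV P >-> pastType n} := HB.pack (id : Omega -> pastType n)
  (isMeasurableFun.Build _ _ _ _ _ mj).
have mh : measurable_fun setT (fun w => (w, Xs n.+1 w) : pastType n * S).
  by apply: measurable_fun_pair => //; exact: measurable_funP.
pose h : {RV P >-> (pastType n * S)%type} :=
  HB.pack (fun w => (w, Xs n.+1 w) : pastType n * S)
  (isMeasurableFun.Build _ _ _ _ _ mh).
have mjX : measurable_fun setT (X : Omega -> S) by exact: measurable_funP.
transitivity (\int[distribution P h]_p phi p)%E.
  by rewrite (ge0_integral_pushforward mh)// preimage_setT.
transitivity (\int[distribution P j \x distribution P X]_p phi p)%E.
  apply/esym; apply: (@eq_measure_integral _ _ _ setT (distribution P h)) => A mA _.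
  apply: product_measure_unique => // C B mC mB.
  transitivity (P (C `&` Xs n.+1 @^-1` B)) => //.
  by rewrite past_indep//; congr (_ * _)%E; exact: Xs_law.
rewrite fubini_tonelli1//.
rewrite (ge0_integral_pushforward mj)//.
- rewrite preimage_setT; apply: eq_integral => w _.
  rewrite /fubini_F/= (ge0_integral_pushforward mjX)//.
  exact: measurableT_comp mphi (measurable_fun_pair (measurable_cst _) (@measurable_id _ _ _)).
- exact: measurable_fun_fubini_tonelli_F.
- by move=> w _; apply: integral_ge0.
Qed.

End Freezing.
Arguments past {R d Omega P dX S} Xs n.
Arguments pastType {R d Omega P dX S} Xs n.

Lemma measurable_le_set {R : realType} {d} {T : measurableType d} (f g : T -> R) :
  measurable_fun setT f -> measurable_fun setT g ->
  measurable [set w | f w <= g w].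
Proof.
by move=> mf mg; rewrite -[X in measurable X]setTI; exact: measurable_fun_le.
Qed.

Lemma measurable_lt_set {R : realType} {d} {T : measurableType d} (f g : T -> R) :
  measurable_fun setT f -> measurable_fun setT g ->
  measurable [set w | f w < g w].
Proof.
move=> mf mg; have := measurableC (measurable_le_set mg mf).
congr (measurable _); apply/seteqP; split=> w /=; first by move/negP; rewrite -ltNge.
by rewrite ltNge => /negP.
Qed.

(** * Maximal inequality and almost sure convergence for almost-supermartingales *)

Section AdaptedProcesses.
Context {R : realType} {d} {Omega : measurableType d} {P : probability Omega R}.
Context {dX} {S : measurableType dX} {Xs : nat -> {RV P >-> S}}.
Local Notation pastType n := (pastType Xs n).

Lemma pastType_measurable_fun n d' (T : measurableType d') (u : Omega -> T) :
  measurable_fun setT (u : pastType n -> T) -> measurable_fun setT u.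
Proof.
by move=> mu _ A mA; apply: past_measurable (mu measurableT _ mA).
Qed.

Lemma pastType_widen n p d' (T : measurableType d') (u : Omega -> T) :
  (n <= p)%N -> measurable_fun setT (u : pastType n -> T) ->
  measurable_fun setT (u : pastType p -> T).
Proof.
by move=> np mu _ A mA; exact: (past_subset np (mu measurableT _ mA)).
Qed.

(** Failure of convergence means that for some [j] the level [1 / (j + 1)] is reached at arbitrarily
    late times, a countable union of events. Tail events decrease in [n], so one good [n] for each
    [e] is enough. *)
Lemma ae_cvg0 (U : nat -> Omega -> R) n0 :
  (forall n, (n0 <= n)%N -> measurable_fun setT (U n)) ->
  (forall n w, 0 <= U n w) ->
  (forall l e : R, 0 < l -> 0 < e -> exists2 n, (n0 <= n)%N &
    (P (\bigcup_(k in [set k | n <= k]%N) [set w | (l <= U k w)%R]) <= e%:E)%E) ->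
  {ae P, forall w, U n w @[n --> \oo] --> (0 : R)}.
Proof.
move=> mU U0 hU.
pose B j n := \bigcup_(k in [set k | n <= k]%N) [set w | j.+1%:R^-1 <= U k w].
have mB j n : (n0 <= n)%N -> measurable (B j n).
  move=> n0n; apply: bigcup_measurable => k /= nk.
  apply: measurable_le_set => //; apply: mU.
  exact: leq_trans nk.
have hn j : P.-negligible (\bigcap_(n in [set n | n0 <= n]%N) B j n).
  have mC : measurable (\bigcap_(n in [set n | n0 <= n]%N) B j n).
    by apply: bigcap_measurableType => k /= /mB.
  exists (\bigcap_(n in [set n | n0 <= n]%N) B j n); split => //.
  apply/eqP; rewrite eq_le measure_ge0 andbT.
  apply/lee_addgt0Pr => e e0; rewrite add0e.
  have [|n n0n hPn] := hU j.+1%:R^-1 e _ e0; first by rewrite invr_gt0.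
  apply: le_trans hPn; apply: le_measure; rewrite ?inE; [exact: mC|exact: mB|].
  by move=> w /(_ n n0n).
apply: negligibleS (negligible_bigcup hn) => w /= hw.
apply: contrapT => hnw; apply: hw; apply/cvgrPdist_lt => e e0.
have [j _ hj] := near_infty_natSinv_lt (PosNum e0).
have : ~ (\bigcap_(n in [set n | n0 <= n]%N) B j n) w.
  by move=> h; apply: hnw; exists j.
move=> /existsNP[n /not_implyP[n0n /= hBn]].
exists n => // k /= nk; rewrite sub0r normrN ger0_norm//.
apply: lt_trans (hj j (leqnn j)) => /=; rewrite ltNge; apply/negP => hk.
by apply: hBn; exists k.
Qed.

Section Maximal.
Context (U : nat -> Omega -> R) (r : nat -> R) (n0 : nat).
Hypothesis mU : forall n, (n0 <= n)%N ->
  measurable_fun setT (U n : pastType n -> R).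
Hypothesis U0 : forall n w, 0 <= U n w.
Hypothesis r0 : forall n, 0 <= r n.
Hypothesis step : forall n, (n0 <= n)%N ->
  forall B, natural_filtration Xs n B ->
  (\int[P]_(w in B) (U n.+1 w)%:E
    <= \int[P]_(w in B) (U n w)%:E + (r n - r n.+1)%:E)%E.

Let mU' n : (n0 <= n)%N -> measurable_fun setT (U n).
Proof. by move=> /mU; exact: pastType_measurable_fun. Qed.

(** The event that [U] has stayed under [l] at the [k] times [n, ..., n + k - 1]. *)
Let below l n := fix below k : set Omega := if k is k'.+1 then
  below k' `&` [set w | U (n + k')%N w < l] else setT.

Let below_past l n k : (n0 <= n)%N -> natural_filtration Xs (n + k) (below l n k).
Proof.
move=> n0n; elim: k => [|k IH]; first exact: (@measurableT _ (pastType _)).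
apply: (@measurableI _ (pastType _)).
  by apply: past_subset IH; rewrite leq_add2l.
apply: (@past_subset _ _ _ _ _ _ _ (n + k)%N); first by rewrite leq_add2l.
apply: (@measurable_lt_set _ _ (pastType _) (U (n + k)%N) (cst l)) => //.
by apply: mU; rewrite (leq_trans n0n)// leq_addr.
Qed.

Let below_measurable l n k : (n0 <= n)%N -> measurable (below l n k).
Proof. by move=> h; apply: past_measurable (@below_past l n k h). Qed.

(** Optional stopping by induction: the left side is the mean of the process stopped on reaching
    [l], with the stopped part counted as [l], plus the budget [r]. It does not increase with
    [k]. *)
Let below_step l n k : (n0 <= n)%N -> 0 < l ->
  (l%:E * P (~` below l n k) + \int[P]_(w in below l n k) (U (n + k)%N w)%:E
    + (r (n + k))%:E <= \int[P]_w (U n w)%:E + (r n)%:E)%E.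
Proof.
move=> n0n l0; elim: k => [|k IH].
  by rewrite addn0 /= setCT measure0 mule0 add0e.
apply: le_trans IH.
have n0nk : (n0 <= n + k)%N by rewrite (leq_trans n0n)// leq_addr.
set A := below l n k.
set D := [set w | U (n + k)%N w < l].
have mA : measurable A by exact: below_measurable.
have mD : measurable D.
  by apply: measurable_lt_set => //; exact: mU'.
have -> : below l n k.+1 = A `&` D by [].
have AE : A = (A `&` D) `|` (A `&` ~` D) by rewrite -setIUr setUv setIT.
have cAE : ~` (A `&` D) = ~` A `|` (A `&` ~` D).
  by rewrite setCI; apply/seteqP; split=> w; rewrite /=; have := pselect (A w); tauto.
have fU j : (n0 <= j)%N -> forall B, measurable_fun B (fun w => (U j w)%:E).
  by move=> jn B; apply: measurable_funTS; apply/measurable_EFinP; exact: mU'.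
have mAD : measurable (A `&` D) by exact: measurableI.
have mAD' : measurable (A `&` ~` D).
  by apply: measurableI => //; exact: measurableC.
have hU : (\int[P]_(w in A) (U (n + k)%N w)%:E =
    \int[P]_(w in A `&` D) (U (n + k)%N w)%:E +
    \int[P]_(w in A `&` ~` D) (U (n + k)%N w)%:E)%E.
  rewrite [in LHS]AE ge0_integral_setU//.
  - exact: fU.
  - by move=> w _; rewrite lee_fin.
  - by apply/disj_setPS => w [[_ Dw] [_]].
have hP : (P (~` (A `&` D)) = P (~` A) + P (A `&` ~` D))%E.
  rewrite cAE measureU//; first exact: measurableC.
  by apply/seteqP; split=> w // [nA []].
have hl : (l%:E * P (A `&` ~` D) <= \int[P]_(w in A `&` ~` D) (U (n + k)%N w)%:E)%E.
  rewrite -integral_cst//; apply: ge0_le_integral => //.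
  - by move=> w _; rewrite lee_fin ltW.
  - exact: fU.
  - by move=> w [_ /=]; rewrite /D/= lee_fin => /negP; rewrite -leNgt.
have hs := step n0nk (B := A `&` D).
have {}hs : (\int[P]_(w in A `&` D) (U (n + k.+1)%N w)%:E
    <= \int[P]_(w in A `&` D) (U (n + k)%N w)%:E + (r (n + k)%N - r (n + k.+1)%N)%:E)%E.
  rewrite addnS; apply: hs.
  apply: (@measurableI _ (pastType _)); first exact: below_past.
  apply: (@measurable_lt_set _ _ (pastType _) (U (n + k)%N) (cst l)) => //.
  exact: mU.
rewrite hP hU ge0_muleDr//.
apply: (@le_trans _ _ (l%:E * P (~` A) + l%:E * P (A `&` ~` D) +
  (\int[P]_(w in A `&` D) (U (n + k)%N w)%:E + (r (n + k)%N - r (n + k.+1)%N)%:E) +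
  (r (n + k.+1))%:E)%E).
  by apply: leeD2r; apply: leeD2l.
have aux (p q I J : \bar R) (a b : R) : (q <= J ->
    p + q + (I + (a - b)%:E) + b%:E <= p + (I + J) + a%:E)%E.
  move=> qJ; rewrite -!addeA; apply: leeD2l; rewrite -EFinD subrK.
  by rewrite addeCA; apply: leeD2l; exact: leeD2r.
exact: aux.
Qed.

(** Reaching [l] at some time after [n] is the increasing union of the complements of [below l n k];
    the bound for fixed [k] passes to the limit. *)
Lemma maximal_inequality n l : (n0 <= n)%N -> 0 < l ->
  (l%:E * P (\bigcup_(k in [set k | n <= k]%N) [set w | (l <= U k w)%R])
    <= \int[P]_w (U n w)%:E + (r n)%:E)%E.
Proof.
move=> n0n l0.
have mC k : measurable (~` below l n k) by apply: measurableC; exact: below_measurable.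
have -> : \bigcup_(k in [set k | n <= k]%N) [set w | (l <= U k w)%R] =
    \bigcup_k (~` below l n k).
  apply/seteqP; split=> [w [k /= nk lk]|w [k _]].
    exists (k - n).+1 => //= -[_].
    by rewrite subnKC//= ltNge lk.
  elim: k => [|k IH]; first by rewrite /= => /(_ I).
  rewrite /= => /not_andP[/IH//|/negP]; rewrite -leNgt => hl.
  by exists (n + k)%N => //=; exact: leq_addr.
have nd : {homo (fun k => ~` below l n k) : i j / (i <= j)%N >-> (i <= j)%O}.
  apply/nondecreasing_seqP => k; apply/subsetPset; apply: subsetC.
  by move=> w [].
have mUC : measurable (\bigcup_k (~` below l n k)) by exact: bigcupT_measurable.
have := @nondecreasing_cvg_mu _ _ _ P _ mC mUC nd.
move=> /(@cvgeZl _ _ _ _ _ l%:E isT) hcv.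
rewrite -(cvg_lim _ hcv)//; apply: lime_le; first by apply/cvg_ex; eexists; exact: hcv.
apply: nearW => k /=.
apply: le_trans (below_step k n0n l0).
rewrite -[leLHS]adde0 -[leLHS]adde0 leeD ?lee_fin// leeD2l//.
by apply: integral_ge0 => w _; rewrite lee_fin.
Qed.

(** Smallness of the mean plus the budget at a single time controls all later times through the
    maximal inequality. *)
Lemma supermartingale_ae_cvg0 :
  (forall e : R, 0 < e -> exists2 n, (n0 <= n)%N &
     (\int[P]_w (U n w)%:E + (r n)%:E <= e%:E)%E) ->
  {ae P, forall w, U n w @[n --> \oo] --> (0 : R)}.
Proof.
move=> hU; apply: (ae_cvg0 (n0 := n0)) => // l e l0 e0.
have [n n0n hn] := hU (l * e) (mulr_gt0 l0 e0).
exists n => //.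
have := le_trans (maximal_inequality n0n l0) hn.
by rewrite EFinM lee_pmul2l// lte_fin.
Qed.

End Maximal.

End AdaptedProcesses.

Lemma measurable_bool_natr {R : realType} {d} {T : measurableType d}
    (b : T -> bool) :
  measurable_fun setT b -> measurable_fun setT (fun w => (b w)%:R : R).
Proof.
move=> mb; rewrite (_ : (fun w => _) = fun w => if b w then 1 else 0).
  exact: measurable_fun_ifT.
by apply/funext => w; case: (b w).
Qed.

(** * A substitute for conditional expectation *)

Section ConditionalBound.
Context {R : realType} {d} {Omega : measurableType d} {P : probability Omega R}.
Context {dX} {S : measurableType dX} {X : {RV P >-> S}}
  {Xs : nat -> {RV P >-> S}}.
Hypothesis Xs_indep : independent_family [set n | (1 <= n)%N] Xs.
Hypothesis Xs_law : forall n, (1 <= n)%N -> same_law (Xs n) X.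

(* Plays the role of E[psi(X_{n+1}) | F_n] <= k for an F_n-dependent psi. *)
Lemma conditional_bound n (B : set Omega) (psi : pastType Xs n * S -> R)
    (k : Omega -> R) :
  natural_filtration Xs n B -> measurable_fun setT psi ->
  (forall p, 0 <= psi p) -> measurable_fun setT k ->
  (forall w, B w -> (\int[P]_v (psi (w, X v))%:E <= (k w)%:E)%E) ->
  (\int[P]_(w in B) (psi (w, Xs n.+1 w))%:E <= \int[P]_(w in B) (k w)%:E)%E.
Proof.
move=> FB mpsi psi0 mk hk.
have mB := past_measurable FB.
(* Extending the integrand by zero off [B] puts [B] into the integrand, so freezing applies over the
   whole space and the bound [hk] is used only on [B]. *)
pose phi (p : pastType Xs n * S) : \bar R :=
  ((fun q => (psi q)%:E) \_ (B `*` setT)) p.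
have mphi : measurable_fun setT phi.
  apply/(measurable_restrict _ _ measurableT).
    exact: (@measurableX _ _ (pastType Xs n) S _ _ FB measurableT).
  by apply: measurable_funTS; exact/measurable_EFinP.
have phiE w x : phi (w, x) = if w \in B then (psi (w, x))%:E else 0%E.
  by rewrite /phi patchE in_setX in_setT andbT.
have phi0 p : (0 <= phi p)%E.
  by case: p => w x; rewrite phiE; case: ifP => // _; rewrite lee_fin.
have hfr := ge0_integral_freezing Xs_indep Xs_law mphi phi0.
rewrite integral_mkcond [leRHS]integral_mkcond.
rewrite (eq_integral (fun w => phi (w, Xs n.+1 w))); last first.
  by move=> w _; rewrite phiE patchE.
rewrite hfr.
have k0 w : B w -> (0 <= (k w)%:E)%E.
  by move=> Bw; apply: le_trans (hk w Bw); apply: integral_ge0 => v _; rewrite lee_fin.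
apply: ge0_le_integral => //.
- by move=> w _; apply: integral_ge0.
- have mX : measurable_fun setT (X : Omega -> S) by exact: measurable_funP.
  have : measurable_fun setT (fubini_F (distribution P X) phi).
    exact: measurable_fun_fubini_tonelli_F.
  move=> /(@pastType_measurable_fun _ _ _ _ _ _ Xs n).
  congr (measurable_fun _ _); apply/funext => w.
  rewrite /fubini_F (ge0_integral_pushforward mX)//.
  exact: measurableT_comp mphi (measurable_fun_pair (measurable_cst _) (@measurable_id _ _ _)).
- apply/(measurable_restrict _ mB measurableT).
  by apply: measurable_funTS; exact/measurable_EFinP.
- move=> w _; rewrite patchE; case: ifPn => wB.
    under eq_integral do rewrite phiE wB.
    by apply: hk; exact: set_mem.
  by under eq_integral do rewrite phiE (negPf wB); rewrite integral0.
Qed.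

End ConditionalBound.

(** * One-step estimates for a random vector with known mean and bounded second moment *)

Section OneStep.
Context {R : realType} {H : completeNormedModType R} (ip : {dot H for idfun}).
Hypothesis Hnorm : norm_from_inner ip.
Hypothesis Hsep : separable H.
Context {d} {Omega : measurableType d} {P : probability Omega R}.
Context {Y : Omega -> H} {e : H} {q : R}.
Hypothesis Ye : is_expectation P ip Y e.
Hypothesis Y2 : (\int[P]_w (`|Y w| ^+ 2)%:E <= q%:E)%E.

Let mY : measurable_fun setT (Y : Omega -> borel H).
Proof. by case: Ye. Qed.

Let mipY a : measurable_fun setT (fun w => ip (Y w) a).
Proof.
(* Polarization, because norms and sums are already known to be measurable. *)
have -> : (fun w => ip (Y w) a) =
    (fun w => 2^-1 * (`|Y w + a| ^+ 2 - `|Y w| ^+ 2 - `|a| ^+ 2)).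
  by apply/funext => w; rewrite (sqr_normD Hnorm); field.
apply: measurable_funM => //.
apply: measurable_funB => //; apply: measurable_funB.
  apply: measurable_funX; apply: (measurable_norm Hsep).
  by apply: (measurable_borelD Hsep) => //; exact: measurable_cst.
by apply: measurable_funX; exact: (measurable_norm Hsep).
Qed.

Let mY2 : measurable_fun setT (fun w => `|Y w| ^+ 2).
Proof. by apply: measurable_funX; exact: (measurable_norm Hsep). Qed.

(** The linear term is computed exactly from the weak definition of the mean, so the sign of [c1] is
    free; the second moment is only bounded above, hence [c2 >= 0]. *)
Lemma quadratic_expectation c0 c1 c2 a : 0 <= c2 ->
  (\int[P]_w (c0 + c1 * ip (Y w) a + c2 * `|Y w| ^+ 2)%:E
    <= (c0 + c1 * ip e a + c2 * q)%:E)%E.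
Proof.
move=> c20; have [_ iY eY] := Ye.
have i1 : P.-integrable setT (EFin \o (fun w => ip (Y w) a)).
  apply: (le_integrable _ _ _ (integrableZl _ `|a| iY)) => //.
    by apply/measurable_EFinP.
  move=> w _ /=; rewrite lee_fin mulrC normrM !normr_id.
  exact: abs_ip_le.
have i2 : P.-integrable setT (EFin \o (fun w => `|Y w| ^+ 2)).
  apply/integrableP; split; first exact/measurable_EFinP.
  apply: (@le_lt_trans _ _ q%:E); last exact: ltry.
  apply: le_trans Y2; rewrite le_eqVlt; apply/orP; left; apply/eqP.
  by apply: eq_integral => w _ /=; rewrite ger0_norm.
have i0 := finite_measure_integrable_cst P c0 measurableT.
have -> : (fun w => (c0 + c1 * ip (Y w) a + c2 * `|Y w| ^+ 2)%:E) =
   (fun w => (EFin \o cst c0) w + c1%:E * (EFin \o (fun w => ip (Y w) a)) w +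
     c2%:E * (EFin \o (fun w => `|Y w| ^+ 2)%R) w)%E.
  by apply/funext => w /=.
rewrite integralD//; last 2 first.
- by apply: integrableD => //; exact: integrableZl.
- exact: integrableZl.
rewrite integralD//; last exact: integrableZl.
rewrite !integralZl//.
have -> : (\int[P]_w (EFin \o cst c0) w = c0%:E)%E.
  apply: etrans (integral_cst P measurableT c0%:E) _.
  by rewrite [X in (_ * X)%E]probability_setT mule1.
have -> : (\int[P]_w (EFin \o (fun w => ip (Y w) a)) w = (ip e a)%:E)%E.
  by rewrite -eY unlock.
rewrite !EFinD !EFinM; apply: leeD2l.
by apply: lee_pmul => //; rewrite ?lee_fin//; apply: integral_ge0 => w _; rewrite lee_fin.
Qed.

(** From [exp y <= 1 / (1 - y)] one gets [exp y1 <= 1 + y1 + 2 y1^2] and [exp y2 <= 1 + 2 y2]; the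
    first bound is at most 2 here, which turns [2 y2] into [4 y2] in the product. *)
Lemma expR_le_quadratic (y1 y2 : R) : `|y1| <= 2^-1 -> 0 <= y2 <= 2^-1 ->
  expR (y1 + y2) <= 1 + y1 + 2 * y1 ^+ 2 + 4 * y2.
Proof.
move=> hy1 /andP[y20 hy2].
have {hy1} [h1 h2] : - 2^-1 <= y1 /\ y1 <= 2^-1 by apply/andP; rewrite -ler_norml.
have bound (y : R) : y < 1 -> expR y <= (1 - y)^-1.
  move=> y1'; rewrite -[expR y]invrK -expRN lef_pV2 ?posrE ?expR_gt0 ?subr_gt0//.
  by apply: le_trans (expR_ge1Dx _).
have b1 : expR y1 <= 1 + y1 + 2 * y1 ^+ 2.
  apply: le_trans (bound _ _) _; first by lra.
  rewrite -[leLHS]mul1r ler_pdivrMr ?subr_gt0; last by lra.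
  rewrite -subr_ge0 (_ : _ - 1 = y1 ^+ 2 * (1 - 2 * y1)); last by ring.
  by rewrite mulr_ge0 ?sqr_ge0//; lra.
have b2 : expR y2 <= 1 + 2 * y2.
  apply: le_trans (bound _ _) _; first by lra.
  rewrite -[leLHS]mul1r ler_pdivrMr ?subr_gt0; last by lra.
  rewrite -subr_ge0 (_ : _ - 1 = y2 * (1 - 2 * y2)); last by ring.
  by rewrite mulr_ge0//; lra.
rewrite expRD; apply: le_trans (ler_pM (expR_ge0 _) (expR_ge0 _) b1 b2) _.
have b3 : 2 * y1 ^+ 2 <= 2^-1.
  rewrite expr2; nra.
have : (1 + y1 + 2 * y1 ^+ 2) * (2 * y2) <= 2 * (2 * y2).
  by rewrite ler_wpM2r//; lra.
by lra.
Qed.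

(* The bound is linear in <Y, T> and |Y|^2 and holds without truncating the
   right-hand side, so no truncation bias arises. *)
Lemma exponential_expectation (lam g K : R) (T : H) : 0 <= lam -> 0 <= g ->
  0 <= K -> 2 * lam * g * K * `|T| <= 2^-1 -> lam * g ^+ 2 * K ^+ 2 <= 2^-1 ->
  (\int[P]_w (expR (lam * `|T - g *: Y w| ^+ 2) * (`|Y w| <= K)%R%:R)%:E
   <= (expR (lam * `|T| ^+ 2) * (1 - 2 * lam * g * ip e T
        + (8 * lam ^+ 2 * g ^+ 2 * `|T| ^+ 2 + 4 * lam * g ^+ 2) * q))%:E)%E.
Proof.
move=> l0 g0 K0 h1 h2.
set c2 := 8 * lam ^+ 2 * g ^+ 2 * `|T| ^+ 2 + 4 * lam * g ^+ 2.
have c20 : 0 <= c2 by rewrite addr_ge0// !mulr_ge0// ?sqr_ge0.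
set E := expR (lam * `|T| ^+ 2).
have E0 : 0 <= E by exact: expR_ge0.
have := @quadratic_expectation E (- (E * (2 * lam * g))) (E * c2) T (mulr_ge0 E0 c20).
rewrite [X in (_ <= X%:E)%E](_ : _ = E * (1 - 2 * lam * g * ip e T + c2 * q)); last by ring.
move=> hq; apply: (le_trans _ hq); apply: ge0_le_integral => //.
- apply/measurable_EFinP; apply: measurable_funM.
    apply: measurableT_comp; first exact: measurable_expR.
    apply: measurable_funM => //; apply: measurable_funX.
    apply: (measurable_norm Hsep); apply: (measurable_borelB Hsep) => //.
    exact: (measurable_borelZ Hsep).
  apply: measurable_bool_natr; apply: measurable_fun_ler => //.
  exact: (measurable_norm Hsep).
- apply/measurable_EFinP; apply: measurable_funD; last exact: measurable_funM.
  by apply: measurable_funD => //; apply: measurable_funM => //.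
move=> w _; rewrite lee_fin.
have sq := sqr_normDZ Hnorm (- g) T (Y w).
rewrite scaleNr ipC in sq; rewrite sq.
(* [y1] and [y2] are [lam] times the linear and quadratic terms of [|T - g Y|^2 - |T|^2]; where
   [|Y| <= K], the hypotheses keep both at most 1/2 in absolute value. *)
pose y1 := - 2 * lam * g * ip (Y w) T.
pose y2 := lam * g ^+ 2 * `|Y w| ^+ 2.
have -> : lam * (`|T| ^+ 2 + 2 * - g * ip (Y w) T + (- g) ^+ 2 * `|Y w| ^+ 2)
    = lam * `|T| ^+ 2 + (y1 + y2) by rewrite /y1 /y2; ring.
rewrite expRD -/E -mulrA.
apply: (@le_trans _ _ (E * (1 + y1 + c2 * `|Y w| ^+ 2))); last first.
  by rewrite le_eqVlt /y1; apply/orP; left; apply/eqP; ring.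
apply: ler_wpM2l => //.
have hip := abs_ip_le Hnorm (Y w) T.
have hy1 : 2 * y1 ^+ 2 <= 8 * lam ^+ 2 * g ^+ 2 * `|T| ^+ 2 * `|Y w| ^+ 2.
  have -> : 2 * y1 ^+ 2 = 8 * lam ^+ 2 * g ^+ 2 * `|ip (Y w) T| ^+ 2.
    by rewrite real_normK ?num_real// /y1; ring.
  rewrite -[leRHS]mulrA ler_wpM2l ?mulr_ge0 ?sqr_ge0//.
  by rewrite -exprMn mulrC ler_sqr ?nnegrE// ?mulr_ge0// mulrC.
have hc2 : 1 + y1 + 2 * y1 ^+ 2 + 4 * y2 <= 1 + y1 + c2 * `|Y w| ^+ 2.
  have -> : 1 + y1 + c2 * `|Y w| ^+ 2 = 1 + y1 +
    8 * lam ^+ 2 * g ^+ 2 * `|T| ^+ 2 * `|Y w| ^+ 2 + 4 * y2.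
    by rewrite /c2 /y2; ring.
  by rewrite lerD2r lerD2l.
apply: le_trans hc2.
have y20 : 0 <= y2 by rewrite !mulr_ge0// sqr_ge0.
case: (leP `|Y w| K) => hK; last first.
  (* Where [|Y| > K] the left side vanishes, and the bound stays valid because
     [1 + y1 + 2 y1^2 = 2 (y1 + 1/4)^2 + 7/8] is positive. *)
  rewrite mulr0; have := sqr_ge0 (y1 + 2^-1 * 2^-1 * 2^-1 * 2).
  by rewrite -subr_ge0 => hs; nra.
rewrite mulr1; apply: expR_le_quadratic.
  have -> : `|y1| = 2 * lam * g * `|ip (Y w) T|.
    by rewrite /y1 mulNr mulNr mulNr normrN normrM [`|2 * _ * _|]ger0_norm// !mulr_ge0.
  apply: le_trans h1; rewrite -(mulrA _ K); apply: ler_wpM2l.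
    by rewrite !mulr_ge0.
  by apply: le_trans hip _; rewrite ler_wpM2r.
rewrite y20/=; apply: le_trans h2; rewrite /y2.
apply: ler_wpM2l; first by rewrite mulr_ge0// sqr_ge0.
by rewrite ler_sqr ?nnegrE.
Qed.

End OneStep.

(** * Integrals of nonnegative real functions *)

Section RealIntegrals.
Context {R : realType} {d} {T : measurableType d} (P : probability T R).
Implicit Types u v : T -> R.

Lemma ge0_integralZ_real (B : set T) k u : measurable B -> 0 <= k ->
  measurable_fun setT u -> (forall w, 0 <= u w) ->
  (\int[P]_(w in B) (k * u w)%:E = k%:E * \int[P]_(w in B) (u w)%:E)%E.
Proof.
move=> mB k0 mu u0; under eq_integral do rewrite EFinM.
rewrite ge0_integralZl//; last by move=> w _; rewrite lee_fin.
by apply/measurable_EFinP; exact: measurable_funTS.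
Qed.

Lemma ge0_integralD_real (B : set T) u v : measurable B ->
  measurable_fun setT u -> (forall w, 0 <= u w) ->
  measurable_fun setT v -> (forall w, 0 <= v w) ->
  (\int[P]_(w in B) (u w + v w)%:E
   = \int[P]_(w in B) (u w)%:E + \int[P]_(w in B) (v w)%:E)%E.
Proof.
move=> mB mu u0 mv v0; under eq_integral do rewrite EFinD.
have mE (f : T -> R) : measurable_fun setT f -> measurable_fun B (EFin \o f).
  by move=> mf; apply/measurable_EFinP; exact: measurable_funTS.
by apply: ge0_integralD; [by []|move=> w _; rewrite /= lee_fin|exact: (mE u mu)|
  move=> w _; rewrite /= lee_fin|exact: (mE v mv)].
Qed.

Lemma ge0_le_integral_real (B : set T) u v : measurable B ->
  measurable_fun setT u -> (forall w, 0 <= u w) ->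
  measurable_fun setT v -> (forall w, B w -> u w <= v w) ->
  (\int[P]_(w in B) (u w)%:E <= \int[P]_(w in B) (v w)%:E)%E.
Proof.
move=> mB mu u0 mv uv.
have mE (f : T -> R) : measurable_fun setT f -> measurable_fun B (EFin \o f).
  by move=> mf; apply/measurable_EFinP; exact: measurable_funTS.
apply: ge0_le_integral; [by []| |exact: (mE u mu)|exact: (mE v mv)|].
  by move=> w _; rewrite lee_fin.
by move=> w Bw; rewrite lee_fin; exact: uv.
Qed.

Lemma integral_cst_real k : (\int[P]_w k%:E = k%:E)%E.
Proof.
apply: etrans (integral_cst P measurableT k%:E) _.
by rewrite [X in (_ * X)%E]probability_setT mule1.
Qed.

Lemma ge0_integral1D u : measurable_fun setT u -> (forall w, 0 <= u w) ->
  (\int[P]_w (1 + u w)%:E = 1 + \int[P]_w (u w)%:E)%E.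
Proof.
by move=> mu u0; rewrite (ge0_integralD_real (u := fun=> 1))// integral_cst_real.
Qed.

End RealIntegrals.

(** * The stochastic gradient recursion: moments and consistency *)

Section SGD.
Context {R : realType} {H : completeNormedModType R} {ip : {dot H for idfun}}.
Hypothesis Hnorm : norm_from_inner ip.
Hypothesis Hsep : separable H.
Context {d} {Omega : measurableType d} {P : probability Omega R}.
Context {dX} {S : measurableType dX} {X : {RV P >-> S}}
  {Xs : nat -> {RV P >-> S}}.
Hypothesis Xs_indep : independent_family [set n | (1 <= n)%N] Xs.
Hypothesis Xs_law : forall n, (1 <= n)%N -> same_law (Xs n) X.
Context {dg : S -> H -> H} {gradG : H -> H}.
Hypothesis dg_meas : measurable_fun [set: S * borel H]
  (fun p : S * borel H => (dg p.1 p.2 : borel H)).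
Hypothesis gradG_E : forall h,
  is_expectation P ip (fun w => dg (X w) h) (gradG h).
Context {g : nat -> R} {Z : nat -> Omega -> H}.
Hypothesis g0 : forall n, 0 <= g n.
Hypothesis Z1_meas : measurable_fun setT (Z 1%N : pastType Xs 1 -> borel H).
Hypothesis Z_rec : forall n, (1 <= n)%N -> forall w,
  Z n.+1 w = Z n w - g n *: dg (Xs n.+1 w) (Z n w).
Context {m : H} {L l : R}.
Hypothesis L0 : 0 < L.
Hypothesis l0 : 0 < l.
Hypothesis dg2 : forall h,
  (\int[P]_w (`|dg (X w) h| ^+ 2)%:E <= (L * (1 + `|h - m| ^+ 2))%:E)%E.
Hypothesis coercive : forall h,
  l * Num.min (`|h - m| ^+ 2) 1 <= ip (gradG h) (h - m).

Local Notation V n w := (`|Z n w - m| ^+ 2).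

Lemma Z_adapted n : (1 <= n)%N ->
  measurable_fun setT (Z n : pastType Xs n -> borel H).
Proof.
case: n => // n _; elim: n => [//|n IH].
have -> : Z n.+2 = (fun w => Z n.+1 w - g n.+1 *: dg (Xs n.+2 w) (Z n.+1 w)).
  by apply/funext => w; exact: Z_rec.
have IH' : measurable_fun setT (Z n.+1 : pastType Xs n.+2 -> borel H).
  exact: pastType_widen IH.
have mX : measurable_fun setT (Xs n.+2 : pastType Xs n.+2 -> S).
  move=> _ B mB; rewrite setTI.
  by apply: past_variable => //; rewrite ltnSn.
apply: (measurable_borelB Hsep) => //; apply: (measurable_borelZ Hsep).
exact: (measurableT_comp dg_meas (measurable_fun_pair mX IH')).
Qed.

Lemma V_adapted n : (1 <= n)%N ->
  measurable_fun setT (fun w : pastType Xs n => V n w).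
Proof.
move=> n1; apply: measurable_funX; apply: (measurable_norm Hsep).
by apply: (measurable_borelB Hsep) => //; exact: Z_adapted.
Qed.

Lemma V_measurable n : (1 <= n)%N -> measurable_fun setT (fun w => V n w).
Proof. by move=> /V_adapted; exact: pastType_measurable_fun. Qed.

Lemma innovation_measurable n : (1 <= n)%N -> measurable_fun setT
  (fun p : pastType Xs n * S => dg p.2 (Z n p.1) : borel H).
Proof.
move=> /Z_adapted mZ.
have m1 : measurable_fun setT (fun p : pastType Xs n * S => Z n p.1 : borel H).
  exact: (measurableT_comp mZ measurable_fst).
exact: (measurableT_comp dg_meas (measurable_fun_pair measurable_snd m1)).
Qed.

Lemma past_fst_measurable n d' (T : measurableType d') (u : pastType Xs n -> T) :
  measurable_fun setT u ->
  measurable_fun setT (fun p : pastType Xs n * S => u p.1).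
Proof. by move=> mu; exact: (measurableT_comp mu measurable_fst). Qed.

(** [a] and [t] are free to serve twice: [a = Z n - m], [t = - g n] for the descent, and [a] the
    noise sum minus the gradient, [t = 1] for the martingale part. *)
Lemma second_moment h a t :
  (\int[P]_w (`|a + t *: dg (X w) h| ^+ 2)%:E
    <= (`|a| ^+ 2 + 2 * t * ip (gradG h) a
        + t ^+ 2 * (L * (1 + `|h - m| ^+ 2)))%:E)%E.
Proof.
have := quadratic_expectation Hnorm Hsep (gradG_E h) (dg2 h)
  (`|a| ^+ 2) (2 * t) a (sqr_ge0 t).
apply: le_trans; rewrite le_eqVlt; apply/orP; left; apply/eqP.
apply: eq_integral => w _; congr (_%:E).
by rewrite (sqr_normDZ Hnorm) (ipC ip a).
Qed.

Lemma V_next n w : (1 <= n)%N ->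
  V n.+1 w = `|(Z n w - m) + (- g n) *: dg (Xs n.+1 w) (Z n w)| ^+ 2.
Proof. by move=> n1; rewrite Z_rec// scaleNr addrAC. Qed.

Lemma V_inner n w : (\int[P]_v
    (`|(Z n w - m) + (- g n) *: dg (X v) (Z n w)| ^+ 2)%:E
  <= (V n w - 2 * g n * l * Num.min (V n w) 1
      + g n ^+ 2 * (L * (1 + V n w)))%:E)%E.
Proof.
apply: le_trans (second_moment _ _ _) _; rewrite lee_fin sqrrN lerD2r.
rewrite lerD2l mulrN !mulNr lerN2 -(mulrA _ l); apply: ler_wpM2l => //.
by rewrite mulr_ge0.
Qed.

Let psi_measurable n : (1 <= n)%N -> measurable_fun setT
  (fun p : pastType Xs n * S =>
    `|(Z n p.1 - m) + (- g n) *: dg p.2 (Z n p.1)| ^+ 2).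
Proof.
move=> n1; apply: measurable_funX; apply: (measurable_norm Hsep).
apply: (measurable_borelD Hsep).
  apply: (measurable_borelB Hsep) => //.
  by apply: (past_fst_measurable (u := Z n : _ -> borel H)); exact: Z_adapted.
by apply: (measurable_borelZ Hsep); exact: innovation_measurable.
Qed.

Lemma V_step n B : (1 <= n)%N -> natural_filtration Xs n B ->
  (\int[P]_(w in B) (V n.+1 w)%:E
   <= \int[P]_(w in B) (V n w - 2 * g n * l * Num.min (V n w) 1
      + g n ^+ 2 * (L * (1 + V n w)))%:E)%E.
Proof.
move=> n1 FB; under eq_integral do rewrite V_next//.
have mV := V_measurable n1.
apply: (conditional_bound Xs_indep Xs_law (psi := fun p : pastType Xs n * S =>
    `|(Z n p.1 - m) + (- g n) *: dg p.2 (Z n p.1)| ^+ 2)) => //.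
- exact: psi_measurable.
- apply: measurable_funD; last first.
    by do 2 apply: measurable_funM => //; exact: measurable_funD.
  by apply: measurable_funB => //; apply: measurable_funM => //; exact: measurable_minr.
- by move=> w _; exact: V_inner.
Qed.

(** Jensen for the concave map [min(., 1)], with the drift discarded: this makes the truncated error
    an almost-supermartingale. *)
Lemma minV_step n B : (1 <= n)%N -> natural_filtration Xs n B ->
  (\int[P]_(w in B) (Num.min (V n.+1 w) 1)%:E
   <= \int[P]_(w in B) (Num.min (V n w) 1
      + g n ^+ 2 * (L * (1 + V n w)))%:E)%E.
Proof.
move=> n1 FB; under eq_integral do rewrite V_next//.
have mV := V_measurable n1.
apply: (conditional_bound Xs_indep Xs_law (psi := fun p : pastType Xs n * S =>
    Num.min (`|(Z n p.1 - m) + (- g n) *: dg p.2 (Z n p.1)| ^+ 2) 1)) => //.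
- by apply: measurable_minr => //; exact: psi_measurable.
- apply: measurable_funD; first exact: measurable_minr.
  by do 2 apply: measurable_funM => //; exact: measurable_funD.
- move=> w _.
  have mX : measurable_fun setT (fun v => `|(Z n w - m) + (- g n) *: dg (X v) (Z n w)| ^+ 2).
    apply: measurable_funX; apply: (measurable_norm Hsep).
    apply: (measurable_borelD Hsep); first exact: measurable_cst.
    by apply: (measurable_borelZ Hsep); case: (gradG_E (Z n w)).
  rewrite addr_minl EFin_min le_min; apply/andP; split.
    apply: (@le_trans _ _ (\int[P]_v
      (`|(Z n w - m) + (- g n) *: dg (X v) (Z n w)| ^+ 2)%:E)%E).
      apply: ge0_le_integral => //.
      - by apply/measurable_EFinP; exact: measurable_minr.
      - exact/measurable_EFinP.
      - by move=> v _; rewrite lee_fin ge_min lexx.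
    apply: le_trans (V_inner _ _) _; rewrite lee_fin lerD2r gerBl.
    by rewrite !mulr_ge0 ?(ltW l0)// le_min sqr_ge0/=.
  apply: (@le_trans _ _ (\int[P]_v (cst (1%:E : \bar R) v))%E).
    apply: ge0_le_integral => //.
    - by apply/measurable_EFinP; exact: measurable_minr.
    - by move=> v _; rewrite lee_fin ge_min lexx orbT.
  rewrite integral_cst// [X in (_ * X <= _)%E]probability_setT mule1 lee_fin lerDl.
  by rewrite !mulr_ge0 ?sqr_ge0 ?(ltW L0)// addr_ge0// sqr_ge0.
Qed.

Lemma V_inner_ge0 n w : 0 <= V n w - 2 * g n * l * Num.min (V n w) 1
      + g n ^+ 2 * (L * (1 + V n w)).
Proof.
rewrite -lee_fin; apply: le_trans (V_inner n w).
by apply: integral_ge0 => v _; rewrite lee_fin sqr_ge0.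
Qed.

(** [V_step] over all of [Omega]. The drift is moved to the left so that expectations not yet known
    to be finite are never subtracted. *)
Lemma V_descent n : (1 <= n)%N ->
  (\int[P]_w (V n.+1 w)%:E + (2 * g n * l)%:E * \int[P]_w (Num.min (V n w) 1)%:E
   <= \int[P]_w (V n w)%:E + (g n ^+ 2 * L)%:E * \int[P]_w (1 + V n w)%:E)%E.
Proof.
move=> n1; have mV := V_measurable n1.
have mm : measurable_fun setT (fun w => Num.min (V n w) 1) by exact: measurable_minr.
have m1 : measurable_fun setT (fun w => 1 + V n w) by exact: measurable_funD.
have c0 : 0 <= 2 * g n * l by rewrite !mulr_ge0// ltW.
have c1 : 0 <= g n ^+ 2 * L by rewrite mulr_ge0 ?sqr_ge0// ltW.
have mV1 : measurable_fun setT (fun w => V n.+1 w) by exact: V_measurable.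
have m2 : measurable_fun setT (fun w => g n ^+ 2 * L * (1 + V n w)) by exact: measurable_funM.
have m3 : measurable_fun setT (fun w => 2 * g n * l * Num.min (V n w) 1) by exact: measurable_funM.
have V0 w : 0 <= V n w by exact: sqr_ge0.
have V10 w : 0 <= 1 + V n w by rewrite addr_ge0.
have mn0 w : 0 <= Num.min (V n w) 1 by rewrite le_min V0/=.
have p2 w : 0 <= g n ^+ 2 * L * (1 + V n w) by rewrite mulr_ge0.
have p3 w : 0 <= 2 * g n * l * Num.min (V n w) 1 by rewrite mulr_ge0.
rewrite -ge0_integralZ_real// -ge0_integralZ_real// -(ge0_integralD_real P (B := setT) (u := fun w => V n w))//.
have hs := @V_step n setT n1 (@measurableT _ (pastType Xs n)).
apply: (le_trans (leeD2r _ hs)); rewrite -ge0_integralD_real//; last 2 first.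
- apply: measurable_funD; last by do 2 apply: measurable_funM => //.
  exact: measurable_funB.
- exact: V_inner_ge0.
rewrite le_eqVlt; apply/orP; left; apply/eqP; apply: eq_integral => w _.
by congr (_%:E); ring.
Qed.

Context {r : nat -> R} {c : R}.
Hypothesis r0 : forall n, 0 <= r n.
Hypothesis r_cvg0 : r n @[n --> \oo] --> (0 : R).
Hypothesis g_sqr : forall n, (1 <= n)%N -> g n ^+ 2 <= r n - r n.+1.
Hypothesis c0 : 0 < c.
Hypothesis g_lb : forall n, (1 <= n)%N -> c / n%:R <= g n.
Hypothesis Z1_bounded : exists M : R, forall w, `|Z 1%N w| <= M.

(** Discrete Gronwall for [1 + V]: each step multiplies its mean by at most
    [1 + L g^2 <= exp (L (r n - r n.+1))], and these factors telescope. *)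
Lemma EV_bounded : exists2 M : R, 0 < M &
  forall n, (1 <= n)%N -> (\int[P]_w (1 + V n w)%:E <= M%:E)%E.
Proof.
have [M1 hM1] := Z1_bounded.
pose M0 := 1 + (M1 + `|m|) ^+ 2.
have M0p : 0 < M0 by rewrite ltr_wpDr// sqr_ge0.
suff hn n : (1 <= n)%N ->
    (\int[P]_w (1 + V n w)%:E <= (M0 * expR (L * (r 1%N - r n)))%:E)%E.
  exists (M0 * expR (L * r 1%N)); first by rewrite mulr_gt0 ?expR_gt0.
  move=> n n1; apply: le_trans (hn n n1) _; rewrite lee_fin ler_pM2l// ler_expR.
  by rewrite ler_pM2l// gerBl.
case: n => // n _; elim: n => [|n IH].
  rewrite subrr mulr0 expR0 mulr1.
  rewrite -(integral_cst_real P M0); apply: ge0_le_integral_real => //.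
  - by apply: measurable_funD => //; exact: V_measurable.
  - move=> w _; rewrite lerD2l ler_sqr ?nnegrE//.
      by rewrite (le_trans (ler_normB _ _))// lerD2r.
    by rewrite addr_ge0// (le_trans _ (hM1 w)).
have mV k : measurable_fun setT (fun w => V k.+1 w) by exact: V_measurable.
rewrite ge0_integral1D//.
have hd : (\int[P]_w (V n.+2 w)%:E <= \int[P]_w (V n.+1 w)%:E
    + (g n.+1 ^+ 2 * L)%:E * \int[P]_w (1 + V n.+1 w)%:E)%E.
  apply: le_trans (V_descent (ltn0Sn n)); rewrite leeDl// mule_ge0//.
    by rewrite lee_fin !mulr_ge0// ltW.
  by apply: integral_ge0 => w _; rewrite lee_fin le_min sqr_ge0/=.
apply: le_trans (leeD2l _ hd) _; rewrite addeA -ge0_integral1D//.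
set J := (\int[P]_w (1 + V n.+1 w)%:E)%E in IH *.
have J0 : (0 <= J)%E by apply: integral_ge0 => w _; rewrite lee_fin addr_ge0// sqr_ge0.
have -> : (J + (g n.+1 ^+ 2 * L)%:E * J = (1 + g n.+1 ^+ 2 * L)%:E * J)%E.
  by rewrite EFinD ge0_muleDl ?mul1e ?lee_fin// mulr_ge0 ?sqr_ge0// ltW.
have hE : 1 + g n.+1 ^+ 2 * L <= expR (L * (r n.+1 - r n.+2)).
  apply: le_trans (expR_ge1Dx _); rewrite lerD2l mulrC ler_pM2l//.
  exact: g_sqr.
apply: (@le_trans _ _ ((expR (L * (r n.+1 - r n.+2)))%:E * J)%E).
  by apply: lee_wpmul2r => //; rewrite lee_fin.
apply: (@le_trans _ _ ((expR (L * (r n.+1 - r n.+2)))%:E * (M0 * expR (L * (r 1%N - r n.+1)))%:E)%E).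
  by apply: lee_wpmul2l => //; rewrite lee_fin expR_ge0.
rewrite -EFinM mulrCA -expRD lee_fin.
by rewrite le_eqVlt; apply/orP; left; apply/eqP; congr (_ * expR _); ring.
Qed.

(** Otherwise every step from some time on would lose at least [2 l e g n] in mean; the total loss
    is bounded, whereas [g n >= c / n] makes it dominate the harmonic series. *)
Lemma minV_small e N : 0 < e -> exists2 n, (N <= n)%N &
  (\int[P]_w (Num.min (V n w) 1)%:E <= e%:E)%E.
Proof.
move=> e0; have [M M0 hM] := EV_bounded; apply: contrapT => hno.
have hbig n : (maxn N 1 <= n)%N -> (e%:E <= \int[P]_w (Num.min (V n w) 1)%:E)%E.
  rewrite geq_max => /andP[Nn n1]; rewrite leNgt; apply/negP => /ltW h.
  by apply: hno; exists n.
set N1 := maxn N 1 in hbig.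
have N11 : (1 <= N1)%N by rewrite leq_maxr.
(* An energy balance: the term [L M r] pays for the second-order errors [L M g^2], so the
   accumulated drift stays below the initial energy. *)
have hsum k : (\int[P]_w (V (N1 + k)%N w)%:E + (L * M * r (N1 + k)%N)%:E
    + (2 * l * e * \sum_(N1 <= i < N1 + k) g i)%:E
    <= (M + L * M * r N1)%:E)%E.
  elim: k => [|k IH].
    rewrite addn0 big_geq// mulr0 adde0 EFinD; apply: leeD2r.
    apply: le_trans (hM _ N11); rewrite ge0_integral1D ?leeDr//.
    exact: V_measurable.
  apply: le_trans IH.
  have n1 : (1 <= N1 + k)%N by rewrite (leq_trans N11)// leq_addr.
  have hd := V_descent n1.
  set n := (N1 + k)%N in hd n1 *; rewrite addnS -/n.
  rewrite big_nat_recr/= ?leq_addr//.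
  have hI := hM n n1.
  have hm := hbig n (leq_addr _ _).
  have h1 : (\int[P]_w (V n.+1 w)%:E + (2 * g n * l * e)%:E <=
     \int[P]_w (V n w)%:E + (L * M * (r n - r n.+1))%:E)%E.
    apply: (@le_trans _ _ (\int[P]_w (V n.+1 w)%:E +
      (2 * g n * l)%:E * \int[P]_w (Num.min (V n w) 1)%:E)%E).
      apply: leeD2l; rewrite EFinM; apply: lee_wpmul2l => //.
      by rewrite lee_fin !mulr_ge0// ltW.
    apply: le_trans hd _; apply: leeD2l.
    apply: (@le_trans _ _ ((g n ^+ 2 * L)%:E * M%:E)%E).
      by apply: lee_wpmul2l => //; rewrite lee_fin mulr_ge0 ?sqr_ge0// ltW.
    rewrite -EFinM lee_fin [leLHS](_ : _ = L * M * g n ^+ 2) ?ler_pM2l ?mulr_gt0//; last by ring.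
    exact: g_sqr.
  move: h1; set I1 := (\int[P]_w (V n.+1 w)%:E)%E; set I0 := (\int[P]_w (V n w)%:E)%E.
  move: I1 I0 => I1 I0 h1.
  have -> : (I1 + (L * M * r n.+1)%:E + (2 * l * e * (\sum_(N1 <= i < n) g i + g n))%:E
     = (I1 + (2 * g n * l * e)%:E) + (L * M * r n.+1 + 2 * l * e * \sum_(N1 <= i < n) g i)%:E)%E.
    by rewrite -!addeA -!EFinD; congr (_ + _%:E)%E; ring.
  apply: le_trans (leeD2r _ h1) _.
  rewrite -!addeA -!EFinD; apply: leeD2l; rewrite lee_fin.
  by rewrite le_eqVlt; apply/orP; left; apply/eqP; ring.
have hdiv : ~ cvgn (series (@harmonic R)) := @dvg_harmonic R.
apply: hdiv; apply: nondecreasing_is_cvgn.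
  by apply/nondecreasing_seqP => n; rewrite /series/= big_nat_recr//= lerDl.
pose K := (M + L * M * r N1) / (2 * l * e * c).
exists (\sum_(0 <= i < N1) harmonic i + K) => _ [n _ <-].
have hg : 2 * l * e * (\sum_(N1 <= i < N1 + n) g i) <= M + L * M * r N1.
  rewrite -lee_fin; apply: le_trans (hsum n); rewrite leeDr//.
  rewrite adde_ge0//; last by rewrite lee_fin !mulr_ge0// ltW.
  by apply: integral_ge0 => w _; rewrite lee_fin sqr_ge0.
have hh : \sum_(N1 <= i < N1 + n) harmonic i <= c^-1 * \sum_(N1 <= i < N1 + n) g i.
  rewrite mulr_sumr big_nat_cond [leRHS]big_nat_cond.
  apply: ler_sum => i /andP[/andP[iN _] _].
  have i1 : (1 <= i)%N by apply: leq_trans iN.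
  rewrite ler_pdivlMl//; apply: le_trans (g_lb i1).
  by rewrite /harmonic/= ler_pM2l// lef_pV2 ?posrE ?ltr0n// ler_nat.
apply: (@le_trans _ _ (\sum_(0 <= i < N1 + n) harmonic i)).
  rewrite /series/= [leRHS](big_cat_nat (n := n))//= ?leq_addl// lerDl.
  by apply: sumr_ge0 => i _; rewrite /harmonic/= invr_ge0.
rewrite [leLHS](big_cat_nat (n := N1))//= ?leq_addr// lerD2l.
apply: le_trans hh _; rewrite /K ler_pdivlMr ?mulr_gt0//.
apply: le_trans hg; rewrite le_eqVlt; apply/orP; left; apply/eqP.
by field; rewrite gt_eqF.
Qed.

Lemma V_ae_cvg0 : {ae P, forall w, V n w @[n --> \oo] --> (0 : R)}.
Proof.
have [M M0 hM] := EV_bounded.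
have hU : {ae P, forall w, Num.min (V n w) 1 @[n --> \oo] --> (0 : R)}.
  apply: (@supermartingale_ae_cvg0 _ _ _ P _ _ Xs (fun n w => Num.min (V n w) 1)
    (fun n => L * M * r n) 1).
  - by move=> n n1; apply: measurable_minr => //; exact: V_adapted.
  - by move=> n w; rewrite le_min sqr_ge0/=.
  - by move=> n; rewrite !mulr_ge0// ltW.
  - move=> n n1 B FB; have mB := past_measurable FB.
    have mV := V_measurable n1.
    apply: le_trans (minV_step n1 FB) _.
    rewrite (@ge0_integralD_real _ _ _ P B (fun w => Num.min (V n w) 1)
      (fun w => g n ^+ 2 * (L * (1 + V n w))))//.
    + apply: leeD2l.
      apply: (@le_trans _ _ (\int[P]_w (g n ^+ 2 * L * (1 + V n w))%:E)%E).
        under eq_integral do rewrite mulrA.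
        apply: ge0_subset_integral => //.
          by apply/measurable_EFinP; apply: measurable_funM => //; exact: measurable_funD.
        by move=> w _; rewrite lee_fin !mulr_ge0 ?sqr_ge0 ?(ltW L0)// addr_ge0// sqr_ge0.
      rewrite ge0_integralZ_real//.
      * apply: (@le_trans _ _ ((g n ^+ 2 * L)%:E * M%:E)%E).
          apply: lee_wpmul2l; last exact: hM.
          by rewrite lee_fin mulr_ge0 ?sqr_ge0// ltW.
        rewrite -EFinM lee_fin -mulrBr [leLHS](_ : _ = L * M * g n ^+ 2) ?ler_pM2l ?mulr_gt0//; last by ring.
        exact: g_sqr.
      * by rewrite mulr_ge0 ?sqr_ge0// ltW.
      * exact: measurable_funD.
    + exact: measurable_minr.
    + by do 2 apply: measurable_funM => //; exact: measurable_funD.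
    + by move=> w; rewrite !mulr_ge0 ?sqr_ge0 ?(ltW L0)// addr_ge0// sqr_ge0.
  (* A time is needed that is both late, to make the budget [L M r] small, and favourable, to make
     the mean small; [minV_small] gives one after any prescribed index. *)
  - move=> e e0.
    have LMr : L * M * r n @[n --> \oo] --> (0 : R).
      by rewrite -[X in _ --> X](mulr0 (L * M)); exact: cvgMr.
    have /cvgrPdist_lt/(_ (e / 2)) := LMr.
    rewrite divr_gt0// => /(_ isT)[N _ hN].
    have [n Nn hn] := minV_small (maxn N 1) (divr_gt0 e0 (@ltr0Sn R 1)).
    exists n; first by apply: leq_trans Nn; rewrite leq_maxr.
    rewrite [in leRHS](splitr e) EFinD; apply: leeD => //.
    rewrite lee_fin; apply: ltW; apply: le_lt_trans (hN n _).
      by rewrite sub0r normrN ler_norm.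
    by apply: leq_trans Nn; rewrite leq_maxl.
(* Truncation is harmless for convergence to 0: under the threshold [min(e, 1)] the truncated value
   is the value itself. *)
apply: filterS hU => w hw; apply/cvgrPdist_lt => e e0.
have /cvgrPdist_lt/(_ (Num.min e 1)) := hw.
rewrite lt_min e0 ltr01 => /(_ isT); apply: filterS => n.
have V0 : 0 <= V n w by exact: sqr_ge0.
rewrite !sub0r !normrN !ger0_norm// ?le_min ?V0//.
rewrite lt_min => /andP[]; rewrite !gt_min ltxx orbF => + h.
by rewrite [1 < e]ltNge; case/orP => // h1; apply: lt_trans h _; move: h1; rewrite -ltNge.
Qed.

Lemma innovation_adapted n : (1 <= n)%N -> measurable_fun setT
  (fun w : pastType Xs n.+1 => dg (Xs n.+1 w) (Z n w) : borel H).
Proof.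
move=> n1.
have mZ : measurable_fun setT (Z n : pastType Xs n.+1 -> borel H).
  exact: (pastType_widen (leqnSn n) (Z_adapted n1)).
have mX : measurable_fun setT (Xs n.+1 : pastType Xs n.+1 -> S).
  by move=> _ B mB; rewrite setTI; apply: past_variable => //; rewrite ltnSn.
exact: (measurableT_comp dg_meas (measurable_fun_pair mX mZ)).
Qed.

(** * Almost sure rate from exponential moments, for abstract bounds [u] and [K] *)

Section Rate.
Context {lam K u : nat -> R} {n1 : nat}.
Hypothesis n1_gt0 : (1 <= n1)%N.
Hypothesis lam0 : forall n, 0 <= lam n.
Hypothesis K0 : forall n, 0 <= K n.
Hypothesis u1 : forall n, (n1 <= n)%N -> u n <= 1.
Hypothesis lam_linear : forall n, (n1 <= n)%N ->
  2 * lam n.+1 * g n * K n * u n <= 2^-1.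
Hypothesis lam_square : forall n, (n1 <= n)%N ->
  lam n.+1 * g n ^+ 2 * K n ^+ 2 <= 2^-1.
Hypothesis lam_small : forall n, (n1 <= n)%N -> 16 * L * lam n.+1 * g n <= l.
Hypothesis lam_drift : forall n, (n1 <= n)%N ->
  lam n.+1 * (1 - l * g n) <= lam n * (1 - l / 2 * g n).
Hypothesis g_small : forall n, (n1 <= n)%N -> l / 2 * g n <= 1.

(** The gradient bounds stop at [k < n]: the gradient taken at time [k] involves [X_(k+1)], so the
    event is known at time [n]. *)
Let good n0 n : set Omega :=
  (\bigcap_(k in [set k | n0 <= k <= n]%N) [set w | `|Z k w - m| <= u k]) `&`
  (\bigcap_(k in [set k | n0 <= k < n]%N)
     [set w | `|dg (Xs k.+1 w) (Z k w)| <= K k]).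

Let good_past n0 n : (n1 <= n0)%N -> natural_filtration Xs n (good n0 n).
Proof.
move=> n10; apply: (@measurableI _ (pastType Xs n)).
  apply: (@bigcap_measurableType _ (pastType Xs n)) => k /= /andP[n0k kn].
  have k1 : (1 <= k)%N by rewrite (leq_trans n1_gt0)// (leq_trans n10).
  apply: (@measurable_le_set _ _ (pastType Xs n) (fun w => `|Z k w - m|) (cst (u k))) => //.
  apply: (measurable_norm Hsep); apply: (measurable_borelB Hsep) => //.
  exact: (pastType_widen kn (Z_adapted k1)).
apply: (@bigcap_measurableType _ (pastType Xs n)) => k /= /andP[n0k kn].
have k1 : (1 <= k)%N by rewrite (leq_trans n1_gt0)// (leq_trans n10).
apply: (@measurable_le_set _ _ (pastType Xs n)
  (fun w => `|dg (Xs k.+1 w) (Z k w)|) (cst (K k))) => //.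
apply: (measurable_norm Hsep).
exact: (pastType_widen kn (innovation_adapted k1)).
Qed.

Let good_measurable n0 n : (n1 <= n0)%N -> measurable (good n0 n).
Proof. by move=> /(@good_past n0 n); exact: past_measurable. Qed.

(* Convexity of exp turns the drift of the exponent into a contraction. *)
Lemma exponential_drift n (v i : R) : (n1 <= n)%N -> 0 <= v <= 1 -> l * v <= i ->
  expR (lam n.+1 * v) * (1 - 2 * lam n.+1 * g n * i
    + (8 * lam n.+1 ^+ 2 * g n ^+ 2 * v + 4 * lam n.+1 * g n ^+ 2) * (L * (1 + v)))
  <= (1 - l / 2 * g n) * expR (lam n * v) + l / 2 * g n * expR 1.
Proof.
move=> nn /andP[v0 v1] hi.
set lm := lam n.+1; set gn := g n; set b := l / 2.
have lm0 : 0 <= lm by exact: lam0.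
have gn0 : 0 <= gn by exact: g0.
have hs : 16 * L * lm * gn <= l by exact: lam_small.
have b0 : 0 <= b by rewrite divr_ge0// ltW.
have bg1 : b * gn <= 1 by exact: g_small.
have t0 : 0 <= b * gn by rewrite mulr_ge0.
have lg0 : 0 <= lm * gn by rewrite mulr_ge0.
(* As [v <= 1] and [16 L lam g <= l], the second-order part is at most [l (lam g v + g / 2)]: it
   consumes half of the drift [2 lam g l v] and leaves the constant [b g]. *)
have e1 : 1 - 2 * lm * gn * i + (8 * lm ^+ 2 * gn ^+ 2 * v + 4 * lm * gn ^+ 2)
    * (L * (1 + v)) <= 1 + (b * gn - lm * gn * l * v).
  have h1 : 2 * lm * gn * (l * v) <= 2 * lm * gn * i.
    by rewrite ler_wpM2l// -mulrA mulr_ge0.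
  have c0' : 0 <= 8 * lm ^+ 2 * gn ^+ 2 * v + 4 * lm * gn ^+ 2.
    by rewrite addr_ge0// !mulr_ge0// sqr_ge0.
  have h2 : (8 * lm ^+ 2 * gn ^+ 2 * v + 4 * lm * gn ^+ 2) * (L * (1 + v)) <=
      (8 * lm ^+ 2 * gn ^+ 2 * v + 4 * lm * gn ^+ 2) * (L * 2).
    by rewrite ler_wpM2l// ler_wpM2l ?(ltW L0)//; lra.
  have h3 : 16 * L * lm * gn * (lm * gn * v + gn / 2) <= l * (lm * gn * v + gn / 2).
    by rewrite ler_wpM2r// addr_ge0// ?mulr_ge0.
  have e3 : 16 * L * lm * gn * (lm * gn * v + gn / 2) =
     (8 * lm ^+ 2 * gn ^+ 2 * v + 4 * lm * gn ^+ 2) * (L * 2) by field.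
  have e4 : l * (lm * gn * v + gn / 2) = lm * gn * l * v + b * gn by rewrite /b; field.
  have e5 : 2 * lm * gn * (l * v) = 2 * (lm * gn * l * v) by ring.
  lra.
apply: le_trans (ler_wpM2l (expR_ge0 _) e1) _.
apply: le_trans (ler_wpM2l (expR_ge0 _) (expR_ge1Dx _)) _.
rewrite -expRD.
(* The exponent is at most a convex combination of [lam n * v] and 1 with weight [b g] on 1, whence
   the fixed value [expR 1] in the recursion. *)
have hd : lm * v + (b * gn - lm * gn * l * v) <=
    (1 - b * gn) * (lam n * v) + b * gn * 1.
  have := ler_wpM2r v0 (lam_drift nn); rewrite -/lm -/gn -/b => hd.
  have ea : lm * v + (b * gn - lm * gn * l * v) = lm * (1 - l * gn) * v + b * gn by ring.
  have eb : lam n * (1 - b * gn) * v = (1 - b * gn) * (lam n * v) by ring.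
  by rewrite ea -eb mulr1 lerD2r.
apply: (@le_trans _ _ (expR ((1 - b * gn) * (lam n * v) + b * gn * 1))).
  by rewrite ler_expR.
have := @convex_expR R (Itv01 t0 bg1) 1 (lam n * v).
by rewrite /conv/= /GRing.scale/= [X in expR X <= _]addrC [X in _ <= X]addrC.
Qed.

Let Y n w : R := expR (lam n * V n w).

Let Y_measurable n : (1 <= n)%N -> measurable_fun setT (Y n).
Proof.
move=> n1'; apply: measurableT_comp; first exact: measurable_expR.
by apply: measurable_funM => //; exact: V_measurable.
Qed.

(** On [good n0 n.+1] the last gradient is at most [K n], so [Y n.+1] equals the truncated [psi];
    the domain is then enlarged to [good n0 n], known at time [n], where the one-step bound
    applies. *)
Let Y_step n0 n : (n1 <= n0)%N -> (n0 <= n)%N ->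
  (\int[P]_(w in good n0 n.+1) (Y n.+1 w)%:E <=
   (1 - l / 2 * g n)%:E * \int[P]_(w in good n0 n) (Y n w)%:E
   + (l / 2 * g n * expR 1)%:E)%E.
Proof.
move=> n10 n0n; have nn : (n1 <= n)%N by exact: leq_trans n0n.
have n1' : (1 <= n)%N by exact: leq_trans nn.
have mg k := good_measurable k n10.
have bg0 : 0 <= l / 2 * g n by rewrite mulr_ge0// divr_ge0// ltW.
pose psi (p : pastType Xs n * S) := expR (lam n.+1 *
  `|(Z n p.1 - m) - g n *: dg p.2 (Z n p.1)| ^+ 2) * (`|dg p.2 (Z n p.1)| <= K n)%R%:R.
have psi0 p : 0 <= psi p by rewrite mulr_ge0 ?expR_ge0.
have mZ : measurable_fun setT (fun p : pastType Xs n * S => Z n p.1 : borel H).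
  by apply: (past_fst_measurable (u := Z n : _ -> borel H)); exact: Z_adapted.
have mD := innovation_measurable n1'.
have mpsi : measurable_fun setT psi.
  apply: measurable_funM.
    apply: measurableT_comp; first exact: measurable_expR.
    apply: measurable_funM => //; apply: measurable_funX.
    apply: (measurable_norm Hsep); apply: (measurable_borelB Hsep).
      exact: (measurable_borelB Hsep).
    exact: (measurable_borelZ Hsep).
  apply: measurable_bool_natr; apply: measurable_fun_ler => //.
  exact: (measurable_norm Hsep).
have mY := Y_measurable n1'.
have mpsi' : measurable_fun setT (fun w => psi (w, Xs n.+1 w)).
  apply: (@pastType_measurable_fun _ _ _ P _ _ Xs n.+1).
  have mX : measurable_fun setT (Xs n.+1 : pastType Xs n.+1 -> S).
    by move=> _ B mB; rewrite setTI; apply: past_variable => //; rewrite ltnSn.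
  have mid : measurable_fun setT (id : pastType Xs n.+1 -> pastType Xs n).
    by move=> _ A mA; rewrite setTI; exact: (past_subset (leqnSn n) mA).
  exact: (measurableT_comp mpsi (measurable_fun_pair mid mX)).
apply: (@le_trans _ _ (\int[P]_(w in good n0 n) (psi (w, Xs n.+1 w))%:E)%E).
  rewrite (eq_integral (fun w => (psi (w, Xs n.+1 w))%:E)); last first.
    move=> w /set_mem[_ hD]; rewrite /psi /Y /= V_next// scaleNr.
    have := hD n; rewrite /= n0n ltnSn => /(_ isT) ->.
    by rewrite mulr1.
  apply: ge0_subset_integral => //.
  - by apply/measurable_EFinP; exact: measurable_funTS.
  - by move=> w _; rewrite lee_fin psi0.
  - move=> w [h1 h2]; split=> k /= /andP[n0k kn].
      by apply: h1; rewrite /= n0k leqW.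
    by apply: h2; rewrite /= n0k ltnW.
have hcb : (\int[P]_(w in good n0 n) (psi (w, Xs n.+1 w))%:E <=
    \int[P]_(w in good n0 n) ((1 - l / 2 * g n) * Y n w + l / 2 * g n * expR 1)%:E)%E.
  apply: (conditional_bound Xs_indep Xs_law (good_past n10) mpsi psi0).
    by apply: measurable_funD => //; exact: measurable_funM.
  move=> w [h1 _].
  have hT : `|Z n w - m| <= u n by apply: h1; rewrite /= n0n leqnn.
  have V1 : 0 <= V n w <= 1.
    by rewrite sqr_ge0/= expr_le1// (le_trans hT)// u1.
  apply: (@le_trans _ _ _ _ _ (exponential_expectation Hnorm Hsep (gradG_E (Z n w))
    (dg2 (Z n w)) (lam0 n.+1) (g0 n) (K0 n) (T := Z n w - m) _ _)).
  - apply: le_trans (lam_linear nn); apply: ler_wpM2l => //.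
    by rewrite !mulr_ge0.
  - exact: lam_square.
  - rewrite lee_fin; apply: exponential_drift => //.
    have := coercive (Z n w); rewrite min_l//.
    by case/andP: V1.
apply: le_trans hcb _.
have Yge0 w : 0 <= Y n w by exact: expR_ge0.
have h1 : 0 <= 1 - l / 2 * g n by rewrite subr_ge0 g_small.
rewrite (@ge0_integralD_real _ _ _ P (good n0 n) (fun w => (1 - l / 2 * g n) * Y n w)
  (fun=> l / 2 * g n * expR 1))//.
- rewrite ge0_integralZ_real//; apply: leeD2l.
  rewrite -[leRHS](integral_cst_real P); apply: ge0_subset_integral => //.
  by move=> w _; rewrite lee_fin mulr_ge0 ?expR_ge0.
- exact: measurable_funM.
- by move=> w; rewrite mulr_ge0.
- by move=> w; rewrite mulr_ge0 ?expR_ge0.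
Qed.

(** The recursion averages the previous value with [expR 1], so the maximum of the two is preserved;
    at [n0] the error is at most 1, which gives [expR (lam n0)]. *)
Let Y_bounded n0 n : (n1 <= n0)%N -> (n0 <= n)%N ->
  (\int[P]_(w in good n0 n) (Y n w)%:E <=
   (Num.max (expR (lam n0)) (expR 1))%:E)%E.
Proof.
move=> n10 /subnKC <-; elim: (n - n0)%N => [|k IH].
  have n01 : (1 <= n0)%N by exact: leq_trans n10.
  rewrite addn0.
  apply: (@le_trans _ _ (\int[P]_(w in good n0 n0) (expR (lam n0))%:E)%E).
    apply: ge0_le_integral_real; [exact: good_measurable|exact: Y_measurable| |by []|].
      by move=> w; exact: expR_ge0.
    move=> w [h1 _]; rewrite ler_expR -[leRHS]mulr1 ler_wpM2l// expr_le1//.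
    by apply: le_trans (u1 n10); apply: h1; rewrite /= leqnn.
  apply: (@le_trans _ _ (expR (lam n0))%:E); last first.
    by rewrite lee_fin le_max lexx.
  rewrite -[leRHS](integral_cst_real P); apply: ge0_subset_integral => //.
  exact: good_measurable.
rewrite addnS; set n' := (n0 + k)%N in IH *.
have n0n : (n0 <= n')%N by exact: leq_addr.
have nn : (n1 <= n')%N by exact: leq_trans n0n.
set M := Num.max _ _ in IH *.
have h1 : 0 <= 1 - l / 2 * g n' by rewrite subr_ge0 g_small.
have bg0 : 0 <= l / 2 * g n' by rewrite mulr_ge0// divr_ge0// ltW.
apply: le_trans (Y_step n10 n0n) _.
apply: (@le_trans _ _ ((1 - l / 2 * g n')%:E * M%:E + (l / 2 * g n' * M)%:E)%E).
  apply: leeD; first by apply: lee_wpmul2l.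
  by rewrite lee_fin ler_wpM2l// le_max lexx orbT.
by rewrite -EFinM -EFinD lee_fin -mulrDl subrK mul1r.
Qed.

(** Exceeding [2 ln n] means [Y n >= n^2], so Markov gives the summable bound [M / n^2] and
    Borel-Cantelli applies on the good events. *)
Lemma ae_rate :
  {ae P, forall w, \forall n \near \oo, `|Z n w - m| <= u n} ->
  {ae P, forall w, \forall n \near \oo, `|dg (Xs n.+1 w) (Z n w)| <= K n} ->
  {ae P, forall w, \forall n \near \oo, lam n * V n w <= 2 * ln n%:R}.
Proof.
move=> hu hK.
have [C2 C20 hC2] := @powRN_telescope R 2 (ltr1n R 2).
have hbc n0 : {ae P, forall w, (n1 <= n0)%N -> \forall n \near \oo,
    ~ (good n0 n `&` [set w | 2 * ln n%:R <= lam n * V n w]) w}.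
  have [n10|n10] := leqP n1 n0; last by apply: aeW.
  set M := Num.max (expR (lam n0)) (expR 1).
  have M0 : 0 < M by rewrite lt_max expR_gt0.
  suff : {ae P, forall w, \forall n \near \oo,
      ~ (good n0 n `&` [set w | 2 * ln n%:R <= lam n * V n w]) w}.
    by apply: filterS => w h _.
  have mE n : (n0 <= n)%N -> measurable [set w | 2 * ln n%:R <= lam n * V n w].
    move=> n0n; apply: measurable_le_set => //; apply: measurable_funM => //.
    by apply: V_measurable; rewrite (leq_trans n1_gt0)// (leq_trans n10).
  apply: (@borel_cantelli_ae _ _ _ _ _ (fun n => M * (C2 * (n%:R `^ (- (2 - 1))))) n0).
  - move=> n n0n; apply: measurableI; [exact: good_measurable|exact: mE].
  - by move=> n; rewrite !mulr_ge0 ?powR_ge0// ltW.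
  move=> n n0n.
  have nz : (0 < n)%N by rewrite (leq_trans n1_gt0)// (leq_trans n10).
  have n2 : 0 < n%:R ^+ 2 :> R by rewrite exprn_gt0// ltr0n.
  set E := _ `&` _.
  have mE' : measurable E by apply: measurableI; [exact: good_measurable|exact: mE].
  apply: (@le_trans _ _ (M * n%:R `^ (- 2))%:E); last first.
    by rewrite lee_fin -mulrBr ler_pM2l//; exact: hC2.
  rewrite powRN powR_mulrn// EFinM lee_pdivlMr// muleC.
  apply: le_trans (Y_bounded n10 n0n).
  apply: (@le_trans _ _ (\int[P]_(w in E) (Y n w)%:E)%E); last first.
    apply: ge0_subset_integral => //.
    - exact: good_measurable.
    - by apply/measurable_EFinP; apply: measurable_funTS; exact: Y_measurable.
    - by move=> w _; rewrite lee_fin expR_ge0.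
    - by move=> w [].
  rewrite -integral_cst//; apply: ge0_le_integral_real => //.
  - exact: Y_measurable.
  - have -> : n%:R ^+ 2 = expR (2 * ln n%:R) :> R.
      by rewrite -[LHS]lnK ?posrE// lnXn ?ltr0n// mulr_natl.
    by move=> w [_ /= h]; rewrite /Y ler_expR.
have := ae_foralln hbc.
apply: filterS3 hu hK => w [N1 _ h1] [N2 _ h2] h3.
(* The starting time depends on [w]; [hbc] is therefore proved for all [n0] at once, a countable
   family of almost sure statements. *)
pose n0 := maxn n1 (maxn N1 N2).
have := h3 n0 (leq_maxl _ _).
apply: filter_app.
exists n0 => // n /= n0n hn.
rewrite leNgt; apply/negP => hlt; apply: hn; split; last exact: ltW.
have l1 : (N1 <= n0)%N by rewrite /n0 !leq_max leqnn orbT.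
have l2 : (N2 <= n0)%N by rewrite /n0 !leq_max leqnn !orbT.
split=> k /= /andP[n0k kn].
  by apply: h1 => /=; exact: leq_trans n0k.
by apply: h2 => /=; exact: leq_trans n0k.
Qed.

End Rate.

(** * Bootstrap of the rate for power step sizes *)

Section PowerSteps.
Context {alpha cg : R}.
Hypothesis cg0 : 0 < cg.
Hypothesis gE : forall n, g n = cg * n%:R `^ (- alpha).
Hypothesis alpha1 : alpha < 1.

(** [b] makes the powers of [n] in [lam_linear] cancel exactly; in [lam_square] and [lam_small] the
    total exponent is at most 0 because [th <= 2 s] and [2 s < alpha]. *)
Lemma ae_rate_power s th Ck : 0 < s -> 2 * s < alpha -> 0 <= th -> th <= 2 * s ->
  0 < Ck ->
  {ae P, forall w, \forall n \near \oo, `|Z n w - m| <= n%:R `^ (- (th / 2))} ->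
  {ae P, forall w, \forall n \near \oo,
    `|dg (Xs n.+1 w) (Z n w)| <= Ck * n%:R `^ s} ->
  exists2 k : R, 0 < k & {ae P, forall w, \forall n \near \oo,
    k * n%:R `^ (alpha - s + th / 2) * V n w <= 2 * ln n%:R}.
Proof.
move=> s0 sa th0 ths Ck0 hu hK.
set b := alpha - s + th / 2.
have b0 : 0 <= b by rewrite /b; lra.
have ba : b <= alpha by rewrite /b; lra.
have b1 : b <= 1 by exact: le_trans ba (ltW alpha1).
(* [k1], [k2], [k3] are the thresholds for [lam_linear], [lam_square] and [lam_small]; each includes
   a factor 2 for [(n + 1)^b <= 2 n^b]. *)
pose k1 := (8 * cg * Ck)^-1.
pose k2 := (4 * cg ^+ 2 * Ck ^+ 2)^-1.
pose k3 := l / (32 * L * cg).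
pose k := Num.min k1 (Num.min k2 k3).
have k10 : 0 < k1 by rewrite invr_gt0 !mulr_gt0.
have k20 : 0 < k2 by rewrite invr_gt0 !mulr_gt0 ?exprn_gt0.
have k30 : 0 < k3 by rewrite divr_gt0// !mulr_gt0.
have k0 : 0 < k by rewrite !lt_min k10 k20.
have kk1 : k <= k1 by rewrite ge_min lexx.
have kk2 : k <= k2 by rewrite !ge_min lexx orbT.
have kk3 : k <= k3 by rewrite !ge_min lexx !orbT.
(* Since [alpha < 1], [1 / n] is eventually below [l g / 2]: the growth of [lam] by at most
   [1 + 1 / n] costs less than half of the contraction, which is [lam_drift]. *)
have [n1 n10 hn1] : exists2 n1, (1 <= n1)%N &
    forall n, (n1 <= n)%N -> n%:R^-1 <= l / 2 * g n /\ l * g n <= 1.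
  have h1 : l * cg * n%:R `^ (- alpha) @[n --> \oo] --> (0 : R).
    rewrite -[X in _ --> X](mulr0 (l * cg)); apply: cvgMr.
    by apply: cvg_powRN; lra.
  have h2 : n%:R `^ (- (1 - alpha)) @[n --> \oo] --> (0 : R).
    by apply: cvg_powRN; rewrite subr_gt0.
  move/cvgrPdist_le : h1 => /(_ 1 ltr01)[N1 _ h1].
  have e0 : 0 < l * cg / 2 by rewrite divr_gt0// mulr_gt0.
  move/cvgrPdist_le : h2 => /(_ _ e0)[N2 _ h2].
  exists (maxn 1 (maxn N1 N2)); first by rewrite leq_maxl.
  move=> n; rewrite !geq_max => /and3P[n1 nN1 nN2].
  have n0 : 0 < n%:R :> R by rewrite ltr0n.
  split; last first.
    rewrite gE mulrA; apply: le_trans (h1 n nN1).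
    by rewrite sub0r normrN ler_norm.
  have := h2 n nN2; rewrite sub0r normrN ger0_norm ?powR_ge0// => h.
  have -> : n%:R^-1 = n%:R `^ (- (1 - alpha)) * n%:R `^ (- alpha) :> R.
    rewrite -powRD; last by apply/implyP => _; rewrite gt_eqF.
    by rewrite -[LHS]powR_inv1 ?(ltW n0)//; congr (_ `^ _); lra.
  rewrite gE (_ : l / 2 * _ = l * cg / 2 * n%:R `^ (- alpha)); last by field.
  by rewrite ler_wpM2r// powR_ge0.
have pw (n : nat) : (n1 <= n)%N -> 0 < n%:R :> R.
  by move=> nn; rewrite ltr0n (leq_trans n10).
have addP (n : nat) p q : (n1 <= n)%N -> n%:R `^ p * n%:R `^ q = n%:R `^ (p + q) :> R.
  by move=> nn; rewrite powRD//; apply/implyP => _; rewrite gt_eqF// pw.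
have le1P (n : nat) p : (n1 <= n)%N -> p <= 0 -> n%:R `^ p <= 1 :> R.
  move=> nn p0; have n1r : 1 <= n%:R :> R by rewrite ler1n (leq_trans n10).
  by have := ler_powR n1r p0; rewrite powRr0.
have ratio (n : nat) : (n1 <= n)%N ->
    n.+1%:R `^ b <= (1 + n%:R^-1) * n%:R `^ b :> R.
  move=> nn; have n0 := pw _ nn.
  have -> : n.+1%:R = (1 + n%:R^-1) * n%:R :> R.
    by rewrite mulrDl mul1r mulVf ?gt_eqF// natr1.
  have i0 : 0 <= n%:R^-1 :> R by rewrite invr_ge0 ltW.
  rewrite powRM ?addr_ge0 ?(ltW n0)//; apply: ler_wpM2r; first exact: powR_ge0.
  by apply: ler1_powR => //; rewrite lerDl.
have twice (n : nat) : (n1 <= n)%N -> n.+1%:R `^ b <= 2 * n%:R `^ b :> R.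
  move=> nn; apply: le_trans (ratio n nn) _.
  apply: ler_wpM2r; first exact: powR_ge0.
  rewrite -[2]/(1 + 1) lerD2l invf_le1 ?pw// ler1n.
  exact: leq_trans nn.
exists k => //.
apply: (@ae_rate (fun n => k * n%:R `^ b) (fun n => Ck * n%:R `^ s)
  (fun n => n%:R `^ (- (th / 2))) n1) => //.
- by move=> n; rewrite mulr_ge0 ?powR_ge0// ltW.
- by move=> n; rewrite mulr_ge0 ?powR_ge0// ltW.
- by move=> n nn; apply: le1P => //; lra.
- move=> n nn.
  apply: (@le_trans _ _ (2 * (k * (2 * n%:R `^ b)) * g n * (Ck * n%:R `^ s) * n%:R `^ (- (th / 2)))).
    do 3 (apply: ler_wpM2r; first by rewrite ?mulr_ge0 ?powR_ge0// ltW).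
    by apply: ler_wpM2l => //; apply: ler_wpM2l; [exact: ltW|exact: twice].
  rewrite gE (_ : _ * _ = 4 * k * cg * Ck * (n%:R `^ b * n%:R `^ (- alpha) * n%:R `^ s * n%:R `^ (- (th / 2)))); last by ring.
  rewrite !addP// (_ : b - alpha + s - th / 2 = 0) ?powRr0 ?mulr1; last by rewrite /b; lra.
  have : 8 * cg * Ck * k <= 8 * cg * Ck * k1 by rewrite ler_wpM2l// !mulr_ge0// ltW.
  rewrite mulfV ?gt_eqF ?mulr_gt0//; lra.
- move=> n nn.
  apply: (@le_trans _ _ (k * (2 * n%:R `^ b) * g n ^+ 2 * (Ck * n%:R `^ s) ^+ 2)).
    do 2 (apply: ler_wpM2r; first by rewrite sqr_ge0).
    by apply: ler_wpM2l; [exact: ltW|exact: twice].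
  rewrite gE (_ : _ * _ = 2 * k * cg ^+ 2 * Ck ^+ 2 * (n%:R `^ b * n%:R `^ (- alpha) * n%:R `^ (- alpha) * n%:R `^ s * n%:R `^ s)); last by ring.
  rewrite !addP//.
  apply: (@le_trans _ _ (2 * k * cg ^+ 2 * Ck ^+ 2 * 1)).
    apply: ler_wpM2l; first by rewrite !mulr_ge0 ?sqr_ge0// ltW.
    by apply: le1P => //; lra.
  have : 4 * cg ^+ 2 * Ck ^+ 2 * k <= 4 * cg ^+ 2 * Ck ^+ 2 * k2.
    by apply: ler_wpM2l => //; rewrite !mulr_ge0// ltW.
  rewrite mulfV ?gt_eqF ?mulr_gt0 ?exprn_gt0//; lra.
- move=> n nn.
  apply: (@le_trans _ _ (16 * L * (k * (2 * n%:R `^ b)) * g n)).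
    apply: ler_wpM2r => //; apply: ler_wpM2l; first by rewrite mulr_ge0// ltW.
    by apply: ler_wpM2l; [exact: ltW|exact: twice].
  rewrite gE (_ : _ * _ = 32 * L * cg * k * (n%:R `^ b * n%:R `^ (- alpha))); last by ring.
  rewrite addP//.
  apply: (@le_trans _ _ (32 * L * cg * k3 * 1)).
    apply: ler_pM => //; rewrite ?powR_ge0 ?mulr_ge0 ?(ltW L0) ?(ltW cg0) ?(ltW k0)//.
      by apply: ler_wpM2l => //; rewrite !mulr_ge0 ?(ltW L0) ?(ltW cg0).
    by apply: le1P => //; lra.
  by rewrite mulr1 /k3 mulrC divfK// gt_eqF// !mulr_gt0.
- move=> n nn; have [h1 h2] := hn1 n nn.
  apply: (@le_trans _ _ (k * ((1 + n%:R^-1) * n%:R `^ b) * (1 - l * g n))).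
    apply: ler_wpM2r; first by rewrite subr_ge0.
    by apply: ler_wpM2l; [exact: ltW|exact: ratio].
  rewrite (_ : k * _ * _ = k * n%:R `^ b * ((1 + n%:R^-1) * (1 - l * g n))); last by ring.
  apply: ler_wpM2l; first by rewrite mulr_ge0 ?powR_ge0// ltW.
  have i0 : 0 <= n%:R^-1 :> R by rewrite invr_ge0.
  have : 0 <= n%:R^-1 * (l * g n) by rewrite !mulr_ge0// ltW.
  lra.
- move=> n nn; have [h1 h2] := hn1 n nn.
  have : 0 <= l * g n by rewrite mulr_ge0// ltW.
  lra.
Qed.

(** Giving up any part of the exponent [b] absorbs the logarithm and the constant. *)
Lemma ae_rate_improve k b th : 0 < k -> th < b ->
  {ae P, forall w, \forall n \near \oo, k * n%:R `^ b * V n w <= 2 * ln n%:R} ->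
  {ae P, forall w, \forall n \near \oo, `|Z n w - m| <= n%:R `^ (- (th / 2))}.
Proof.
move=> k0 thb; apply: filterS => w hw.
have h : ln n%:R * n%:R `^ (- (b - th)) @[n --> \oo] --> (0 : R).
  by apply: cvg_ln_powRN; rewrite subr_gt0.
move/cvgrPdist_le : h => /(_ (k / 2)); rewrite divr_gt0// => /(_ isT) h.
near=> n.
have n0 : 0 < n%:R :> R by rewrite ltr0n; near: n; exact: nbhs_infty_gt.
have h1 : k * n%:R `^ b * V n w <= 2 * ln n%:R by near: n.
have h2 : `|0 - ln n%:R * n%:R `^ (- (b - th))| <= k / 2 by near: n.
have {h2} h2 : ln n%:R * n%:R `^ (- (b - th)) <= k / 2.
  by apply: le_trans h2; rewrite sub0r normrN ler_norm.
have b0 : 0 < n%:R `^ b :> R by rewrite powR_gt0.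
rewrite -(@ler_pXn2r _ 2) ?nnegrE ?powR_ge0//.
have -> : (n%:R `^ (- (th / 2))) ^+ 2 = n%:R `^ (- th) :> R.
  by rewrite -powR_mulrn ?powR_ge0// -powRrM; congr (_ `^ _); field.
rewrite -(ler_pM2l (mulr_gt0 k0 b0)); apply: le_trans h1 _.
rewrite -mulrA -powRD; last by apply/implyP => _; rewrite gt_eqF.
have e : n%:R `^ (- (b - th)) = (n%:R `^ (b - th))^-1 :> R by rewrite powRN.
move: h2; rewrite e ler_pdivrMr ?powR_gt0// => h2.
rewrite (_ : k * _ = 2 * (k / 2 * n%:R `^ (b - th))); last by field.
by rewrite ler_pM2l.
Unshelve. all: by end_near. Qed.

Lemma ae_rate_alpha s Ck : 0 < s -> 2 * s < alpha -> 0 < Ck ->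
  {ae P, forall w, V n w @[n --> \oo] --> (0 : R)} ->
  {ae P, forall w, \forall n \near \oo,
    `|dg (Xs n.+1 w) (Z n w)| <= Ck * n%:R `^ s} ->
  exists2 k : R, 0 < k & {ae P, forall w, \forall n \near \oo,
    k * n%:R `^ alpha * V n w <= 2 * ln n%:R}.
Proof.
move=> s0 sa Ck0 hV hK.
(* One round turns [th] into any exponent below [alpha - s + th/2], a gain of at least
   [alpha - 2 s = 2 rho] while [th <= 2 s]; moving by [rho] stays strictly inside, and finitely many
   moves reach [2 s]. *)
pose rho := alpha / 2 - s.
have rho0 : 0 < rho by rewrite /rho; lra.
pose th (j : nat) : R := Num.min (j%:R * rho) (2 * s).
have th0 j : 0 <= th j.
  by rewrite le_min !mulr_ge0// ltW.
have ths j : th j <= 2 * s by rewrite ge_min lexx orbT.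
have hth j : {ae P, forall w, \forall n \near \oo, `|Z n w - m| <= n%:R `^ (- (th j / 2))}.
  elim: j => [|j IH].
    apply: filterS hV => w /cvgrPdist_le/(_ 1 ltr01); apply: filterS => n.
    rewrite sub0r normrN ger0_norm ?sqr_ge0//.
    rewrite /th mul0r min_l ?mulr_ge0 ?(ltW s0)// mul0r oppr0 powRr0.
    by rewrite expr_le1.
  have [k k0 hk] := ae_rate_power s0 sa (th0 j) (ths j) Ck0 IH hK.
  apply: (ae_rate_improve k0 _ hk).
  have h1 : th j.+1 <= th j + rho.
    rewrite /th -natr1 mulrDl mul1r.
    case: (leP (j%:R * rho) (2 * s)) => h.
      by rewrite ge_min lexx.
    by rewrite ge_min; apply/orP; right; lra.
  apply: le_lt_trans h1 _.
  by have := ths j; rewrite /rho; lra.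
have [j hj] : exists j : nat, 2 * s <= j%:R * rho.
  exists (Num.truncn (2 * s / rho)).+1; rewrite -ler_pdivrMr//.
  by apply: ltW; exact: truncnS_gt.
have [k k0 hk] := ae_rate_power s0 sa (th0 j) (ths j) Ck0 (hth j) hK.
exists k => //; move: hk.
by rewrite /th min_r// (_ : alpha - s + 2 * s / 2 = alpha)//; field.
Qed.

End PowerSteps.

Lemma ae_law n (Q : S -> Prop) : (1 <= n)%N ->
  {ae distribution P X, forall x, Q x} -> {ae P, forall w, Q (Xs n w)}.
Proof.
move=> n1 [N [mN N0 hN]]; exists (Xs n @^-1` N); split.
- by rewrite -[X in measurable X]setTI; exact: measurable_funP.
- by apply: etrans N0; exact: (Xs_law n1 mN).
- by move=> w hw; apply: hN => hQ; exact: hw.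
Qed.

Lemma ae_innovation_bound (f : S -> H -> R) (C p s Lp : R) :
  measurable_fun [set: S * borel H] (fun p : S * borel H => f p.1 p.2) ->
  (forall x h, 0 <= f x h) -> 0 < C -> 0 < p -> 0 < s -> 1 < s * p -> 0 < Lp ->
  {ae distribution P X, forall x, forall h, `|dg x h| <= f x h + C * `|h - m|} ->
  (forall h, (\int[P]_w (f (X w) h `^ p)%:E <= Lp%:E)%E) ->
  {ae P, forall w, V n w @[n --> \oo] --> (0 : R)} ->
  {ae P, forall w, \forall n \near \oo,
    `|dg (Xs n.+1 w) (Z n w)| <= (1 + C) * n%:R `^ s}.
Proof.
move=> mf f0 C0 p0 s0 sp Lp0 hdg hf hV.
have [C2 C20 hC2] := powRN_telescope sp.
pose A n := [set w | n%:R `^ s <= f (Xs n.+1 w) (Z n w)].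
have mfn n : (1 <= n)%N -> measurable_fun setT (fun w => f (Xs n.+1 w) (Z n w)).
  move=> n1; apply: (measurableT_comp mf (measurable_fun_pair _ _)) => //.
  exact: (pastType_measurable_fun (Z_adapted n1)).
have mA n : (1 <= n)%N -> measurable (A n).
  by move=> n1; apply: measurable_le_set => //; exact: mfn.
have mpow : measurable_fun setT (fun x : R => x `^ p) by exact: measurable_powR.
have hA : {ae P, forall w, \forall n \near \oo, ~ A n w}.
  apply: (@borel_cantelli_ae _ _ _ _ _ (fun n => Lp * (C2 * n%:R `^ (- (s * p - 1)))) 1) => //.
    by move=> n; rewrite !mulr_ge0 ?powR_ge0// ltW.
  move=> n n1; have n0 : 0 < n%:R :> R by rewrite ltr0n.
  apply: (@le_trans _ _ (Lp * n%:R `^ (- (s * p)))%:E); last first.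
    by rewrite lee_fin -mulrBr ler_pM2l//; exact: hC2.
  rewrite powRN EFinM lee_pdivlMr ?powR_gt0// muleC.
  have hcb : (\int[P]_(w in setT) (f (Xs n.+1 w) (Z n w) `^ p)%:E
      <= \int[P]_(w in setT) Lp%:E)%E.
    apply: (conditional_bound Xs_indep Xs_law (n := n)
      (psi := fun q : pastType Xs n * S => f q.2 (Z n q.1) `^ p)) => //.
    - exact: (@measurableT _ (pastType Xs n)).
    - have mZ : measurable_fun setT (fun q : pastType Xs n * S => Z n q.1 : borel H).
        by apply: (past_fst_measurable (u := Z n : _ -> borel H)); exact: Z_adapted.
      exact: (measurableT_comp mpow (measurableT_comp mf (measurable_fun_pair measurable_snd mZ))).
    - by move=> q; exact: powR_ge0.
    - by move=> w _; exact: (hf (Z n w)).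
  rewrite integral_cst_real in hcb; apply: le_trans hcb.
  apply: (@le_trans _ _ (\int[P]_(w in A n) (f (Xs n.+1 w) (Z n w) `^ p)%:E)%E); last first.
    apply: ge0_subset_integral => //; first exact: mA.
    by apply/measurable_EFinP; exact: (measurableT_comp mpow (mfn n n1)).
    by move=> w _; rewrite lee_fin powR_ge0.
  rewrite -(integral_cst P (mA n n1)).
  apply: ge0_le_integral_real => //.
  - exact: mA.
  - exact: (measurableT_comp mpow (mfn n n1)).
  - move=> w /= hw; rewrite powRrM; apply: ge0_ler_powR => //.
    + exact: ltW.
    + by rewrite nnegrE powR_ge0.
    + by rewrite nnegrE.
(* The exceptional set of the growth bound is the same for all [h], so the random point [Z n w] may
   be substituted. *)
have hD : {ae P, forall w, forall n,
    `|dg (Xs n.+1 w) (Z n w)| <= f (Xs n.+1 w) (Z n w) + C * `|Z n w - m|}.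
  apply: ae_foralln => n.
  by have := ae_law (ltn0Sn n) hdg; apply: filterS => w /(_ (Z n w)).
apply: filterS3 hA hD hV => w hAw hDw hVw.
move/cvgrPdist_le : hVw => /(_ 1 ltr01) hVw.
near=> n.
have n1 : (1 <= n)%N by near: n; exact: nbhs_infty_ge.
have hw : ~ A n w by near: n.
have hT : `|Z n w - m| <= 1.
  have : `|0 - V n w| <= 1 by near: n.
  by rewrite sub0r normrN ger0_norm ?sqr_ge0// expr_le1.
apply: le_trans (hDw n) _; rewrite mulrDl mul1r; apply: lerD.
  by rewrite leNgt; apply/negP => /ltW.
apply: ler_wpM2l; first exact: ltW.
apply: le_trans hT _.
have n1r : 1 <= n%:R :> R by rewrite ler1n.
by have := ler_powR n1r (ltW s0); rewrite powRr0.
Unshelve. all: by end_near. Qed.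

(** * The martingale part of the summed gradients *)

Section Noise.
Hypothesis gradG_cont : continuous gradG.

(** The sum stops at [k = n - 1], whose gradient uses [X_n], so [noise n] is known at time [n]. *)
Definition noise n w := \sum_(1 <= k < n) (dg (Xs k.+1 w) (Z k w) - gradG (Z k w)).

Lemma noiseS n w : (1 <= n)%N ->
  noise n.+1 w = noise n w + (dg (Xs n.+1 w) (Z n w) - gradG (Z n w)).
Proof. by move=> n1; rewrite /noise big_nat_recr. Qed.

Lemma noise_adapted n : (1 <= n)%N ->
  measurable_fun setT (noise n : pastType Xs n -> borel H).
Proof.
case: n => // n _; elim: n => [|n IH].
  rewrite (_ : noise 1 = fun=> 0); first exact: measurable_cst.
  by apply/funext => w; rewrite /noise big_geq.
have -> : noise n.+2 = (fun w => noise n.+1 w +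
    (dg (Xs n.+2 w) (Z n.+1 w) - gradG (Z n.+1 w))).
  by apply/funext => w; exact: noiseS.
apply: (measurable_borelD Hsep); first exact: (pastType_widen (leqnSn _) IH).
apply: (measurable_borelB Hsep); first exact: innovation_adapted.
apply: (measurable_borel_continuous Hsep gradG_cont).
exact: (pastType_widen (leqnSn _) (Z_adapted (ltn0Sn n))).
Qed.

Lemma noise_measurable n : (1 <= n)%N ->
  measurable_fun setT (fun w => `|noise n w| ^+ 2).
Proof.
move=> n1; apply: measurable_funX; apply: (measurable_norm Hsep).
exact: (pastType_measurable_fun (noise_adapted n1)).
Qed.

Lemma noise_step n B : (1 <= n)%N -> natural_filtration Xs n B ->
  (\int[P]_(w in B) (`|noise n.+1 w| ^+ 2)%:E <=
   \int[P]_(w in B) (`|noise n w| ^+ 2 + L * (1 + V n w))%:E)%E.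
Proof.
move=> n1 FB; have mN := noise_measurable n1; have mV := V_measurable n1.
have -> : (fun w => (`|noise n.+1 w| ^+ 2)%:E) = (fun w =>
   (`|(noise n w - gradG (Z n w)) + 1 *: dg (Xs n.+1 w) (Z n w)| ^+ 2)%:E).
  by apply/funext => w; rewrite noiseS// scale1r addrAC addrA.
apply: (conditional_bound Xs_indep Xs_law (psi := fun p : pastType Xs n * S =>
  `|(noise n p.1 - gradG (Z n p.1)) + 1 *: dg p.2 (Z n p.1)| ^+ 2)) => //.
- apply: measurable_funX; apply: (measurable_norm Hsep).
  apply: (measurable_borelD Hsep); last first.
    by apply: (measurable_borelZ Hsep); exact: innovation_measurable.
  apply: (measurable_borelB Hsep).
    by apply: (past_fst_measurable (u := noise n : _ -> borel H)); exact: noise_adapted.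
  apply: (measurable_borel_continuous Hsep gradG_cont).
  by apply: (past_fst_measurable (u := Z n : _ -> borel H)); exact: Z_adapted.
- by apply: measurable_funD => //; apply: measurable_funM => //; exact: measurable_funD.
- move=> w _; apply: (le_trans (second_moment (Z n w) (noise n w - gradG (Z n w)) 1)).
  rewrite lee_fin expr1n mul1r lerD2r mulr1.
  have := sqr_normDZ Hnorm (-1) (noise n w) (gradG (Z n w)).
  rewrite scaleN1r => ->.
  rewrite (ipBr ip) -(Hnorm (gradG _)) (ipC ip (noise n w)).
  have := sqr_ge0 `|gradG (Z n w)|.
  have -> : (-1) ^+ 2 = 1 :> R by ring.
  lra.
Qed.

(** The mean of [|noise n|^2] is at most [L M n]. Weighted by the decreasing
    [a n = 1 / (n (ln n)^(1+delta))] it tends to 0, and the increments [L M a n.+1] telescope by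
    [ln_powRN_telescope]. Times start at 2 because [ln 1 = 0]. *)
Lemma noise_ae_rate (delta : R) : 0 < delta ->
  {ae P, forall w, (n%:R * ln n%:R `^ (1 + delta))^-1 * `|noise n w| ^+ 2
    @[n --> \oo] --> (0 : R)}.
Proof.
move=> d0; have [M M0 hM] := EV_bounded.
pose a (n : nat) : R := (n%:R * ln n%:R `^ (1 + delta))^-1.
have lnP n : (2 <= n)%N -> 0 < ln n%:R :> R by move=> n2; rewrite ln_gt0// ltr1n.
have a0 n : 0 <= a n by rewrite invr_ge0 mulr_ge0 ?powR_ge0.
have aP n : (2 <= n)%N -> 0 < n%:R * ln n%:R `^ (1 + delta) :> R.
  by move=> n2; apply: mulr_gt0; [rewrite ltr0n ltnW|apply: powR_gt0; exact: lnP].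
have ad n : (2 <= n)%N -> a n.+1 <= a n.
  move=> n2; rewrite lef_pV2 ?posrE ?aP//; last exact: leqW.
  apply: ler_pM; rewrite ?powR_ge0 ?ler_nat//.
  apply: ge0_ler_powR; rewrite ?nnegrE.
  - by rewrite addr_ge0// ltW.
  - exact: ltW (lnP _ n2).
  - exact: ltW (lnP _ (leqW n2)).
  by rewrite ler_ln ?posrE ?ltr0n ?ler_nat// ltnW.
have LM0 : 0 < L * M by rewrite mulr_gt0.
have EN n : (1 <= n)%N -> (\int[P]_w (`|noise n w| ^+ 2)%:E <= (L * M * n%:R)%:E)%E.
  case: n => // n _; elim: n => [|n IH].
    rewrite (eq_integral (fun=> 0%:E)); last first.
      by move=> w _; rewrite /noise big_geq// normr0 expr0n.
    by rewrite integral_cst_real lee_fin !mulr_ge0// ltW.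
  apply: le_trans (noise_step (ltn0Sn n) (@measurableT _ (pastType Xs n.+1))) _.
  have mV := V_measurable (ltn0Sn n).
  have mV1 : measurable_fun setT (fun w => 1 + V n.+1 w) by exact: measurable_funD.
  rewrite (@ge0_integralD_real _ _ _ P setT (fun w => `|noise n.+1 w| ^+ 2)
    (fun w => L * (1 + V n.+1 w)))//; last 3 first.
  - exact: noise_measurable.
  - exact: measurable_funM.
  - by move=> w; rewrite mulr_ge0 ?(ltW L0)// addr_ge0// sqr_ge0.
  rewrite ge0_integralZ_real ?(ltW L0)//.
  rewrite -[n.+2%:R]natr1 mulrDr mulr1 EFinD; apply: leeD => //.
  by rewrite EFinM; apply: lee_wpmul2l; [rewrite lee_fin ltW|exact: hM].
apply: (@supermartingale_ae_cvg0 _ _ _ P _ _ Xs (fun n w => a n * `|noise n w| ^+ 2)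
  (fun n => L * M * (delta^-1 * ln n%:R `^ (- delta))) 2).
- move=> n n2; apply: measurable_funM => //; apply: measurable_funX.
  by apply: (measurable_norm Hsep); apply: noise_adapted; exact: ltnW.
- by move=> n w; rewrite mulr_ge0// sqr_ge0.
- by move=> n; rewrite !mulr_ge0 ?powR_ge0 ?invr_ge0// ltW.
- move=> n n2 B FB; have mB := past_measurable FB; have n1 := ltnW n2.
  have mV1 : measurable_fun setT (fun w => 1 + V n w).
    by apply: measurable_funD => //; exact: V_measurable.
  rewrite ge0_integralZ_real//; last exact: noise_measurable.
  apply: (@le_trans _ _ ((a n.+1)%:E * \int[P]_(w in B) (`|noise n w| ^+ 2 + L * (1 + V n w))%:E)%E).
    by apply: lee_wpmul2l; [rewrite lee_fin|exact: noise_step].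
  rewrite (@ge0_integralD_real _ _ _ P B (fun w => `|noise n w| ^+ 2)
    (fun w => L * (1 + V n w)))//; last 3 first.
  - exact: noise_measurable.
  - exact: measurable_funM.
  - by move=> w; rewrite mulr_ge0 ?(ltW L0)// addr_ge0// sqr_ge0.
  rewrite ge0_muleDr; last 2 first.
  - by apply: integral_ge0 => w _; rewrite lee_fin sqr_ge0.
  - by apply: integral_ge0 => w _; rewrite lee_fin mulr_ge0 ?(ltW L0)// addr_ge0// sqr_ge0.
  apply: leeD.
    rewrite ge0_integralZ_real//; last exact: noise_measurable.
    apply: lee_wpmul2r; last by rewrite lee_fin ad.
    by apply: integral_ge0 => w _; rewrite lee_fin sqr_ge0.
  rewrite ge0_integralZ_real ?(ltW L0)//.
  apply: (@le_trans _ _ ((a n.+1)%:E * (L%:E * M%:E))%E).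
    apply: lee_wpmul2l; first by rewrite lee_fin.
    apply: lee_wpmul2l; first by rewrite lee_fin ltW.
    apply: le_trans (hM n n1); apply: ge0_subset_integral => //.
    + by apply/measurable_EFinP.
  rewrite -!EFinM lee_fin -mulrBr mulrC ler_pM2l//.
  apply: le_trans (ln_powRN_telescope d0 n2).
  by rewrite /a invfM powRN.
- move=> e e0.
  have c1 : L * M * (delta^-1 * ln n%:R `^ (- delta)) @[n --> \oo] --> (0 : R).
    rewrite -[X in _ --> X](mulr0 (L * M)); apply: cvgMr.
    rewrite -[X in _ --> X](mulr0 delta^-1); apply: cvgMr.
    exact: cvg_ln_pow0.
  have c2 : L * M * ln n%:R `^ (- (1 + delta)) @[n --> \oo] --> (0 : R).
    rewrite -[X in _ --> X](mulr0 (L * M)); apply: cvgMr.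
    by apply: cvg_ln_pow0; rewrite addr_gt0.
  have e2 : 0 < e / 2 by rewrite divr_gt0.
  move/cvgrPdist_le : c1 => /(_ _ e2)[N1 _ h1].
  move/cvgrPdist_le : c2 => /(_ _ e2)[N2 _ h2].
  pose n := maxn 2 (maxn N1 N2).
  have n2 : (2 <= n)%N by rewrite leq_maxl.
  exists n => //.
  rewrite (splitr e) EFinD; apply: leeD; last first.
    rewrite lee_fin; apply: le_trans (h1 n _).
      by rewrite sub0r normrN ler_norm.
    by rewrite /n /= !leq_max leqnn orbT.
  rewrite ge0_integralZ_real//; last by apply: noise_measurable; exact: ltnW.
  apply: (@le_trans _ _ ((a n)%:E * (L * M * n%:R)%:E)%E).
    by apply: lee_wpmul2l; [rewrite lee_fin|apply: EN; exact: ltnW].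
  have hn2 : L * M * ln n%:R `^ (- (1 + delta)) <= e / 2.
    apply: le_trans (h2 n _); first by rewrite sub0r normrN ler_norm.
    by rewrite /n /= !leq_max leqnn !orbT.
  rewrite -EFinM lee_fin; apply: le_trans hn2.
  have n0 : n%:R != 0 :> R by rewrite pnatr_eq0 -lt0n ltnW.
  have p0 : ln n%:R `^ (1 + delta) != 0 :> R by rewrite gt_eqF//; apply: powR_gt0; exact: lnP.
  rewrite le_eqVlt /a powRN; apply/orP; left; apply/eqP.
  move: (ln n%:R `^ (1 + delta)) (n%:R : R) n0 p0 => p q q0 p0.
  by field; rewrite q0 p0.
Qed.

End Noise.

End SGD.

(** * Deterministic estimates for the averaged sequence *)

Section Averaging.
Context {R : realType}.

(** With [t = n / (n + 1)] it reduces to [1 - sqrt t >= (1 - t) / 2], that is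
    [(1 - sqrt t)^2 >= 0]. *)
Lemma sqrt_increment (n : nat) :
  2^-1 * n.+1%:R `^ (- 2^-1) <= n.+1%:R `^ 2^-1 - n%:R `^ 2^-1 :> R.
Proof.
pose t : R := n%:R / n.+1%:R.
have n1 : 0 < n.+1%:R :> R by rewrite ltr0n.
have t0 : 0 <= t by rewrite divr_ge0.
have -> : n%:R `^ 2^-1 = n.+1%:R `^ 2^-1 * t `^ 2^-1 :> R.
  by rewrite -powRM// ?ler0n// mulrC divfK// gt_eqF.
have -> : n.+1%:R `^ (- 2^-1) = n.+1%:R `^ 2^-1 * n.+1%:R^-1 :> R.
  rewrite -(powR_inv1 (ltW n1)) -powRD; last by apply/implyP => _; rewrite gt_eqF.
  by congr (_ `^ _); field.
rewrite -[X in _ <= X - _]mulr1 -mulrBr mulrCA; apply: ler_wpM2l; first exact: powR_ge0.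
have tE : n.+1%:R^-1 = 1 - t.
  by rewrite /t -[X in X - _](@divff _ n.+1%:R) ?gt_eqF// -mulrBl -natr1 addrAC subrr add0r mul1r.
have : (t `^ 2^-1) ^+ 2 = t.
  by rewrite -powR_mulrn ?powR_ge0// -powRrM mulVf ?powRr1// pnatr_eq0.
have := sqr_ge0 (1 - t `^ 2^-1); rewrite tE.
set q := t `^ 2^-1 => h1 h2; rewrite -h2; move: h1; rewrite !expr2; lra.
Qed.

(** [K'] dominates [2 K], so each increment is covered by one of [K' sqrt n], and [a N], so the
    induction starts. *)
Lemma sqrt_growth (a : nat -> R) K N : (1 <= N)%N -> 0 <= K ->
  (forall n, (N <= n)%N -> a n.+1 <= a n + K * n.+1%:R `^ (- 2^-1)) ->
  exists2 K', 0 <= K' & forall n, (N <= n)%N -> a n <= K' * n%:R `^ 2^-1.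
Proof.
move=> N1 K0 ha; pose K' := Num.max (2 * K) (Num.max 0 (a N)).
have K'0 : 0 <= K' by rewrite !le_max lexx !orbT.
exists K' => // n /subnKC <-; elim: (n - N)%N => [|k IH].
  rewrite addn0; apply: (@le_trans _ _ (K' * 1)).
    by rewrite mulr1 !le_max lexx !orbT.
  apply: ler_wpM2l => //.
  have N1r : 1 <= N%:R :> R by rewrite ler1n.
  have h : 0 <= 2^-1 :> R by [].
  by have := ler_powR N1r h; rewrite powRr0.
rewrite addnS; apply: le_trans (ha _ (leq_addr _ _)) _.
have h1 := sqrt_increment (N + k).
have h2 : K * (N + k).+1%:R `^ (- 2^-1) <= K' * ((N + k).+1%:R `^ 2^-1 - (N + k)%:R `^ 2^-1).
  apply: (@le_trans _ _ (K' * (2^-1 * (N + k).+1%:R `^ (- 2^-1)))).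
    rewrite mulrA; apply: ler_wpM2r; first exact: powR_ge0.
    rewrite ler_pdivlMr//; rewrite mulrC; by rewrite le_max lexx.
  exact: ler_wpM2l.
move: h2; rewrite mulrBr; lra.
Qed.

(** After factoring out [(n + 1)^al], the upper bound is [t <= t^al] for [t = n / (n + 1)] and
    [al <= 1]. *)
Lemma powR_increment_le (n : nat) (al : R) : (1 <= n)%N -> 0 <= al -> al <= 1 ->
  (0 : R) <= n.+1%:R `^ al - n%:R `^ al <= n.+1%:R `^ (al - 1).
Proof.
move=> n1 al0 al1.
have n0 : 0 < n%:R :> R by rewrite ltr0n.
apply/andP; split.
  by rewrite subr_ge0; apply: ge0_ler_powR; rewrite ?nnegrE// ler_nat.
pose t : R := n%:R / n.+1%:R.
have t0 : 0 < t by rewrite divr_gt0.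
have t1 : t <= 1 by rewrite ler_pdivrMr// mul1r ler_nat.
have -> : n%:R `^ al = n.+1%:R `^ al * t `^ al :> R.
  by rewrite -powRM ?(ltW t0)// mulrC divfK// gt_eqF.
have -> : n.+1%:R `^ (al - 1) = n.+1%:R `^ al * n.+1%:R^-1 :> R.
  rewrite -(powR_inv1 (ler0n R n.+1)) -powRD//.
  by apply/implyP => _; rewrite pnatr_eq0.
rewrite -[X in X - _]mulr1 -mulrBr; apply: ler_wpM2l; first exact: powR_ge0.
have -> : n.+1%:R^-1 = 1 - t :> R.
  by rewrite /t -[X in X - _](@divff _ n.+1%:R) ?pnatr_eq0// -mulrBl -natr1 addrAC subrr add0r mul1r.
rewrite lerD2l lerN2; apply: ger1_powR => //.
by rewrite t0.
Qed.

(* Summation by parts: with c_n = 1 / gamma_n, the quantity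
   W_n = sum_(k < n) (D_k - gr_k) + A (sum_(k < n) T_k) + c_n T_n has increments
   (c_(n+1) - c_n) T_(n+1) - (gr_n - A T_n), which are O(n^(-1/2)). *)
Lemma summation_by_parts {H : completeNormedModType R} (A : {linear H -> H})
    (T D gr : nat -> H) (cg al l K1 K2 : R) (N : nat) :
  0 < cg -> 0 <= al -> al <= 1 -> 0 <= K1 -> 0 <= K2 -> (1 <= N)%N ->
  (forall n, (1 <= n)%N -> T n.+1 = T n - (cg * n%:R `^ (- al)) *: D n) ->
  (forall u, l * `|u| <= `|A u|) ->
  (forall n, (N <= n)%N -> `|T n| <= K1 * n%:R `^ (2^-1 - al)) ->
  (forall n, (N <= n)%N -> `|gr n - A (T n)| <= K2 * n.+1%:R `^ (- 2^-1)) ->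
  exists2 K, 0 <= K & forall n, (N <= n)%N ->
    l * `|\sum_(1 <= k < n) T k| <=
    K * n%:R `^ 2^-1 + `|\sum_(1 <= k < n) (D k - gr k)|.
Proof.
move=> cg0 al0 al1 K10 K20 N1 hT hA hT1 hgr.
pose c (n : nat) : R := cg^-1 * n%:R `^ al.
pose W n := \sum_(1 <= k < n) (D k - gr k) + A (\sum_(1 <= k < n) T k) + c n *: T n.
have cD n : (1 <= n)%N -> D n = c n *: (T n - T n.+1).
  move=> n1; rewrite hT// opprB addrC subrK scalerA.
  have n0 : 0 < n%:R :> R by rewrite ltr0n.
  rewrite (_ : c n * _ = 1) ?scale1r// /c powRN.
  have h1 : n%:R `^ al != 0 :> R by rewrite gt_eqF// powR_gt0.
  by field; rewrite h1 gt_eqF.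
have Winc n : (1 <= n)%N ->
    W n.+1 = W n + ((c n.+1 - c n) *: T n.+1 - (gr n - A (T n))).
  move=> n1; rewrite /W !big_nat_recr//= linearD/= [in LHS](cD n n1).
  rewrite scalerBr scalerBl opprB.
  by rewrite [LHS](AC (1*3*2*1) ((1*5*2)*((7*3)*(6*4)))).
have ct n : (N <= n)%N -> `|c n *: T n| <= cg^-1 * K1 * n%:R `^ 2^-1.
  move=> Nn; have n0 : 0 < n%:R :> R by rewrite ltr0n (leq_trans N1).
  have ci : 0 <= cg^-1 by rewrite invr_ge0 ltW.
  rewrite normrZ ger0_norm ?mulr_ge0 ?powR_ge0//.
  apply: (@le_trans _ _ (c n * (K1 * n%:R `^ (2^-1 - al)))).
    by apply: ler_wpM2l; [rewrite mulr_ge0 ?powR_ge0|exact: hT1].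
  rewrite /c mulrACA -powRD; last by apply/implyP => _; rewrite gt_eqF.
  by rewrite addrC subrK.
have ci0 : 0 <= cg^-1 by rewrite invr_ge0 ltW.
have Wn n : (N <= n)%N ->
    `|W n.+1| <= `|W n| + (cg^-1 * K1 + K2) * n.+1%:R `^ (- 2^-1).
  move=> Nn; have n1 : (1 <= n)%N by exact: leq_trans Nn.
  rewrite Winc//; apply: le_trans (ler_normD _ _) _; rewrite lerD2l.
  apply: le_trans (ler_normB _ _) _; rewrite mulrDl; apply: lerD; last exact: hgr.
  have /andP[h0 h1] := powR_increment_le n1 al0 al1.
  have n0 : 0 < n.+1%:R :> R by rewrite ltr0n.
  rewrite normrZ -mulrBr ger0_norm ?mulr_ge0// -!mulrA; apply: ler_wpM2l => //.
  (* The step of [c] is of order [n^(al - 1)] and the error of order [n^(1/2 - al)]; the exponents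
     add up to [-1/2]. *)
  apply: (@le_trans _ _ (n.+1%:R `^ (al - 1) * (K1 * n.+1%:R `^ (2^-1 - al)))).
    by apply: ler_pM => //; apply: hT1; exact: leqW.
  rewrite mulrCA -powRD; last by apply/implyP => _; rewrite gt_eqF.
  by rewrite (_ : al - 1 + (2^-1 - al) = - 2^-1)//; field.
have [K K0 hK] := @sqrt_growth (fun n => `|W n|) (cg^-1 * K1 + K2) N N1
  (addr_ge0 (mulr_ge0 ci0 K10) K20) Wn.
exists (K + cg^-1 * K1).
  by rewrite addr_ge0// mulr_ge0// invr_ge0 ltW.
move=> n Nn; apply: le_trans (hA _) _.
have -> : A (\sum_(1 <= k < n) T k) = W n - c n *: T n - \sum_(1 <= k < n) (D k - gr k).
  by rewrite /W addrK addrC addKr.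
apply: le_trans (ler_normB _ _) _; rewrite lerD2r.
apply: le_trans (ler_normB _ _) _; rewrite mulrDl.
by apply: lerD; [exact: hK|exact: ct].
Qed.

End Averaging.

Lemma average_eventually {R : realType} {H : completeNormedModType R}
    (T M : nat -> H) (l K K1 delta : R) (N : nat) : 0 < l -> 0 <= K -> 0 <= K1 ->
  0 < delta ->
  (forall n, (N <= n)%N ->
    l * `|\sum_(1 <= k < n) T k| <= K * n%:R `^ 2^-1 + `|M n|) ->
  (forall n, (N <= n)%N -> `|T n| <= K1 * n%:R `^ 2^-1) ->
  (n%:R * ln n%:R `^ (1 + delta))^-1 * `|M n| ^+ 2 @[n --> \oo] --> (0 : R) ->
  forall e : R, 0 < e -> \forall n \near \oo,
    `|n%:R^-1 *: \sum_(1 <= k < n.+1) T k| ^+ 2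
      <= e * (ln n%:R `^ (1 + delta) / n%:R).
Proof.
move=> l0 K0 K10 d0 hS hT hM e e0.
(* [hS] stops before [T n] whereas the average includes it; the extra [l K1] pays for that term. *)
pose K' := K + l * K1.
have K'0 : 0 <= K' by rewrite addr_ge0// mulr_ge0// ltW.
have l20 : 0 < l ^+ 2 by rewrite exprn_gt0.
have c1 : 2 * K' ^+ 2 * ln n%:R `^ (- (1 + delta)) @[n --> \oo] --> (0 : R).
  rewrite -[X in _ --> X](mulr0 (2 * K' ^+ 2)); apply: cvgMr.
  by apply: cvg_ln_pow0; rewrite addr_gt0.
(* From [(x + y)^2 <= 2 x^2 + 2 y^2], the deterministic part and the noise each use half of [e l^2];
   the noise enters doubled, hence the 4. *)
have e1 : 0 < e * l ^+ 2 / 2 by rewrite divr_gt0// mulr_gt0.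
have e2 : 0 < e * l ^+ 2 / 4 by rewrite divr_gt0// mulr_gt0.
move/cvgrPdist_le : c1 => /(_ _ e1) c1.
move/cvgrPdist_le : hM => /(_ _ e2) hM.
near=> n.
have nN : (N <= n)%N by near: n; exact: nbhs_infty_ge.
have n2 : (2 <= n)%N by near: n; exact: nbhs_infty_ge.
have n0 : 0 < n%:R :> R by rewrite ltr0n ltnW.
have lnn : 0 < ln (n%:R : R) by rewrite ln_gt0// ltr1n.
have nM : `|0 - (n%:R * ln n%:R `^ (1 + delta))^-1 * `|M n| ^+ 2| <= e * l ^+ 2 / 4.
  by near: n.
have nK : `|0 - 2 * K' ^+ 2 * ln n%:R `^ (- (1 + delta))| <= e * l ^+ 2 / 2 by near: n.
move: nM nK; rewrite powRN.
set p := ln n%:R `^ (1 + delta) => nM nK.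
have p0 : 0 < p by exact: powR_gt0.
have h1 : 2 * K' ^+ 2 <= e * l ^+ 2 / 2 * p.
  move: nK; rewrite sub0r normrN => /(le_trans (ler_norm _)).
  by rewrite ler_pdivrMr.
have h2 : `|M n| ^+ 2 <= e * l ^+ 2 / 4 * (n%:R * p).
  move: nM; rewrite sub0r normrN => /(le_trans (ler_norm _)).
  by rewrite mulrC ler_pdivrMr// mulr_gt0.
set S := \sum_(1 <= k < n.+1) T k.
have hS' : l * `|S| <= K' * n%:R `^ 2^-1 + `|M n|.
  rewrite /S big_nat_recr/=; last exact: ltnW.
  apply: (@le_trans _ _ (l * (`|\sum_(1 <= k < n) T k| + `|T n|))).
    by apply: ler_wpM2l; [exact: ltW|exact: ler_normD].
  have := hS n nN; have := ler_wpM2l (ltW l0) (hT n nN).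
  rewrite /K' mulrDr mulrDl mulrA; lra.
have hq : (n%:R `^ 2^-1) ^+ 2 = n%:R :> R.
  rewrite -powR_mulrn ?powR_ge0// -powRrM mulVf ?pnatr_eq0//.
  exact: powRr1 (ltW n0).
have hS2 : l ^+ 2 * `|S| ^+ 2 <= 2 * K' ^+ 2 * n%:R + 2 * `|M n| ^+ 2.
  have : (l * `|S|) ^+ 2 <= (K' * n%:R `^ 2^-1 + `|M n|) ^+ 2.
    by rewrite ler_sqr// nnegrE ?addr_ge0 ?mulr_ge0 ?powR_ge0// ltW.
  rewrite exprMn => /le_trans; apply; rewrite -{2}hq.
  have := sqr_ge0 (K' * n%:R `^ 2^-1 - `|M n|).
  set x := n%:R `^ 2^-1; set y := `|M n|; rewrite -subr_ge0 => hxy.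
  rewrite -subr_ge0 (_ : _ - _ = (K' * x - y) ^+ 2); last by ring.
  exact: sqr_ge0.
have hS3 : `|S| ^+ 2 <= e * (n%:R * p).
  rewrite -(ler_pM2l l20); apply: le_trans hS2 _.
  have := ler_wpM2r (ltW n0) h1.
  have -> : e * l ^+ 2 / 2 * p * n%:R = l ^+ 2 * (e * (n%:R * p)) / 2 by field.
  have e3 : e * l ^+ 2 / 4 * (n%:R * p) = l ^+ 2 * (e * (n%:R * p)) / 4 by field.
  rewrite e3 in h2; lra.
rewrite normrZ ger0_norm ?invr_ge0 ?(ltW n0)// exprMn.
rewrite exprVn mulrC ler_pdivrMr ?exprn_gt0//.
apply: le_trans hS3 _; rewrite le_eqVlt; apply/orP; left; apply/eqP.
by field; rewrite gt_eqF.
Unshelve. all: by end_near. Qed.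

(** Brings both alternatives of (vi) to one form: under the first,
    [(f + C b)^2 <= 2 f^2 + 2 C^2 b^2] with [b = |h - m|] gives [L = 2 L1 + 2 C^2]. *)
Lemma innovation_second_moment {R : realType} {H : completeNormedModType R}
    {d} {Omega : measurableType d} {P : probability Omega R}
    {dX} {S : measurableType dX} {X : {RV P >-> S}} (dg : S -> H -> H)
    (f : S -> H -> R) (m : H) (C L1 : R) :
  separable H ->
  measurable_fun [set: S * borel H] (fun p : S * borel H => (dg p.1 p.2 : borel H)) ->
  measurable_fun [set: S * borel H] (fun p : S * borel H => f p.1 p.2) ->
  (forall x h, 0 <= f x h) -> 0 < L1 ->
  {ae distribution P X, forall x, forall h, `|dg x h| <= f x h + C * `|h - m|} ->
  (forall h, ('E_P[fun w => (f (X w) h ^+ 2)%R] <= L1%:E)%E) \/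
  (forall h, ('E_P[fun w => (`|dg (X w) h| ^+ 2)%R] <=
              (L1 * (1 + `|h - m| ^+ 2))%:E)%E) ->
  exists2 L : R, 0 < L & forall h,
    (\int[P]_w (`|dg (X w) h| ^+ 2)%:E <= (L * (1 + `|h - m| ^+ 2))%:E)%E.
Proof.
move=> Hsep mdg mf f0 L10 [N [mN N0 hN]] [hf|hdg]; last first.
  by exists L1 => // h; have := hdg h; rewrite unlock.
exists (2 * L1 + 2 * C ^+ 2); first by rewrite ltr_wpDr ?mulr_gt0// mulr_ge0// sqr_ge0.
move=> h; have V0 : 0 <= `|h - m| ^+ 2 by exact: sqr_ge0.
have mX : measurable_fun setT (X : Omega -> S) by exact: measurable_funP.
have mfh : measurable_fun setT (fun w => f (X w) h ^+ 2).
  apply: measurable_funX.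
  exact: (measurableT_comp mf (measurable_fun_pair mX (measurable_cst _))).
have mdgh : measurable_fun setT (fun w => `|dg (X w) h| ^+ 2).
  apply: measurable_funX; apply: (measurable_norm Hsep).
  exact: (measurableT_comp mdg (measurable_fun_pair mX (measurable_cst _))).
have aeX : {ae P, forall w, setT w ->
    ((`|dg (X w) h| ^+ 2)%:E <= (2 * f (X w) h ^+ 2 + 2 * C ^+ 2 * `|h - m| ^+ 2)%:E)%E}.
  exists (X @^-1` N); split => //.
    by rewrite -[X in measurable X]setTI; exact: mX.
  move=> w /= hw; apply: hN => /= hQ; apply: hw => _; rewrite lee_fin.
  have := hQ h; set a := f _ _; set b := `|h - m| => hab.
  have a0 : 0 <= a by exact: f0.
  have : `|dg (X w) h| ^+ 2 <= (a + C * b) ^+ 2.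
    by rewrite ler_sqr// nnegrE// (le_trans _ hab).
  move/le_trans; apply; rewrite -subr_ge0.
  rewrite (_ : _ - _ = (a - C * b) ^+ 2); last by ring.
  exact: sqr_ge0.
have c0 : 0 <= 2 * C ^+ 2 * `|h - m| ^+ 2.
  by rewrite mulr_ge0// mulr_ge0// sqr_ge0.
apply: (@le_trans _ _ (\int[P]_w (2 * f (X w) h ^+ 2 + 2 * C ^+ 2 * `|h - m| ^+ 2)%:E)%E).
  apply: ae_ge0_le_integral => //.
  - exact/measurable_EFinP.
  - by move=> w _; rewrite lee_fin addr_ge0// mulr_ge0// sqr_ge0.
  - apply/measurable_EFinP; apply: measurable_funD => //.
    exact: measurable_funM.
rewrite (@ge0_integralD_real _ _ _ P setT (fun w => 2 * f (X w) h ^+ 2)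
  (fun=> 2 * C ^+ 2 * `|h - m| ^+ 2))//.
- rewrite integral_cst_real ge0_integralZ_real//.
  apply: (@le_trans _ _ (2%:E * L1%:E + (2 * C ^+ 2 * `|h - m| ^+ 2)%:E)%E).
    apply: leeD2r; apply: lee_wpmul2l => //.
    by have := hf h; rewrite unlock.
  rewrite -EFinM -EFinD lee_fin.
  have : 0 <= 2 * L1 * `|h - m| ^+ 2 by rewrite !mulr_ge0// ltW.
  have : 0 <= 2 * C ^+ 2 by rewrite mulr_ge0// sqr_ge0.
  rewrite mulrDl !mulrDr !mulr1; lra.
- by move=> w; exact: sqr_ge0.
- exact: measurable_funM.
- by move=> w; rewrite mulr_ge0// sqr_ge0.
Qed.

Theorem theorem4p2 (R : realType)
  (* the separable real Hilbert space H *)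
  (H : completeNormedModType R) (ip : {dot H for idfun})
  (Hnorm : norm_from_inner ip) (Hsep : separable H)
  (* the random variable X and its i.i.d. copies X_1, X_2, ... *)
  (d : measure_display) (Omega : measurableType d) (P : probability Omega R)
  (dX : measure_display) (S : measurableType dX)
  (X : {RV P >-> S}) (Xs : nat -> {RV P >-> S})
  (Xs_indep : independent_family [set n | (1 <= n)%N] Xs)
  (Xs_law : forall n, (1 <= n)%N -> same_law (Xs n) X)
  (* g and the convex function G(h) = E[g(X,h)] *)
  (g : S -> H -> R) (G : H -> R)
  (g_int : forall h, P.-integrable [set: Omega] (fun w => (g (X w) h)%:E))
  (G_def : forall h, ('E_P[fun w => g (X w) h] = (G h)%:E)%E)
  (G_convex : convex_function [set: convex_lmodType H] G)
  (* the gradients of g and G *)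
  (dg : S -> H -> H) (gradG : H -> H)
  (dg_meas : measurable_fun [set: S * borel H]
     (fun p : S * borel H => (dg p.1 p.2 : borel H)))
  (dg_grad : forall x h, differentiable (g x : H -> R^o) h ->
     is_gradient ip (g x) h (dg x h))
  (gradG_E : forall h, is_expectation P ip (fun w => dg (X w) h) (gradG h))
  (* the stochastic gradient algorithm *)
  (cgamma alpha : R) (cgamma_gt0 : 0 < cgamma)
  (alpha_gt : 2^-1 < alpha) (alpha_lt1 : alpha < 1)
  (Z : nat -> Omega -> H)
  (Z1_meas : measurable_wrt (natural_filtration Xs 1) (Z 1%N))
  (Z1_bounded : exists M : R, forall w, `|Z 1%N w| <= M)
  (Z_rec : forall n, (1 <= n)%N -> forall w,
     Z n.+1 w =
     Z n w - (cgamma * n%:R `^ (- alpha)) *: dg (Xs n.+1 w) (Z n w))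
  (* (i) *)
  (g_diff : forall h,
     {ae distribution P X, forall x, differentiable (g x : H -> R^o) h})
  (G_grad : forall h, is_gradient ip G h (gradG h))
  (m : H) (gradG_m : gradG m = 0)
  (* (ii) *)
  (Gamma : H -> {linear H -> H})
  (G_hess : forall h, is_hessian gradG h (Gamma h))
  (Gamma_cont : forall h,
     opnorm (fun u => Gamma h' u - Gamma h u) @[h' --> h] --> (0 : R))
  (Gamma_bounded : forall A : R, 0 < A -> exists2 CA : R, 0 < CA &
     forall h, `|h - m| <= A -> opnorm (Gamma h) <= CA)
  (* (iii) *)
  (strong_convexity :
     (exists2 eps : R, 0 < eps &
        [/\ forall h, `|h - m| <= eps -> has_eigenbasis ip (Gamma h),
            0 < inf (eigenvalues (Gamma m)) &
            forall h, `|h - m| <= eps ->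
              forall l, eigenvalues (Gamma h) l ->
                inf (eigenvalues (Gamma m)) / 2 <= l])
     \/
     [/\ has_eigenbasis ip (Gamma m),
         0 < inf (eigenvalues (Gamma m)) &
         exists c c' : R, [/\ 0 < c, 0 < c' &
           forall (A : R) (h : H), 0 < A -> `|h - m| <= A ->
             Num.min c (c' / A) * `|h - m| ^+ 2 <= ip (gradG h) (h - m)]])
  (* (iv) *)
  (gradG_taylor : exists eps' Ceps' : R, [/\ 0 < eps', 0 < Ceps' &
     forall h, `|h - m| <= eps' ->
       `|gradG h - Gamma m (h - m)| <= Ceps' * `|h - m| ^+ 2])
  (* (v) *)
  (f : S -> H -> R) (C : R)
  (f_meas : measurable_fun [set: S * borel H]
     (fun p : S * borel H => f p.1 p.2))
  (f_ge0 : forall x h, 0 <= f x h) (C_gt0 : 0 < C)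
  (dg_bound : {ae distribution P X, forall x, forall h,
     `|dg x h| <= f x h + C * `|h - m|})
  (* (vi) *)
  (moment2 : exists2 L1 : R, 0 < L1 &
     (forall h, ('E_P[fun w => (f (X w) h ^+ 2)%R] <= L1%:E)%E) \/
     (forall h, ('E_P[fun w => (`|dg (X w) h| ^+ 2)%R] <=
                 (L1 * (1 + `|h - m| ^+ 2))%:E)%E))
  (* (vii) *)
  (moment_eta : exists eta Leta : R, [/\ alpha^-1 - 1 < eta, 0 < Leta &
     forall h, ('E_P[fun w => (f (X w) h `^ (2 * (1 + eta)))%R] <= Leta%:E)%E]) :
  {ae P, forall w,
     (fun n : nat => `|Z n w - m| ^+ 2 : R^o) =O_\oo
     (fun n : nat => ln n%:R / n%:R `^ alpha : R^o)} /\
  (forall delta : R, 0 < delta ->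
   {ae P, forall w,
      (fun n : nat => `|averaged Z n w - m| ^+ 2 : R^o) =o_\oo
      (fun n : nat => ln n%:R `^ (1 + delta) / n%:R : R^o)}).
Proof.
have [l l0 [coercive Gm_below]] := strong_convexity_coercive Hnorm G_hess
  G_convex G_grad gradG_m strong_convexity.
have [L1 L10 hL1] := moment2.
have [L L0 dg2] := innovation_second_moment Hsep dg_meas f_meas f_ge0 L10 dg_bound hL1.
have [eta [Leta [eta_gt Leta0 hLeta]]] := moment_eta.
have [eps' [Ceps' [eps'0 Ceps'0 taylor]]] := gradG_taylor.
have alpha0 : 0 < alpha by apply: lt_trans alpha_gt.
pose gam n : R := cgamma * n%:R `^ (- alpha).
have g0 n : 0 <= gam n by rewrite mulr_ge0 ?powR_ge0// ltW.
have Z1_meas' : measurable_fun setT (Z 1%N : pastType Xs 1 -> borel H).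
  by move=> _ B mB; rewrite setTI; exact: Z1_meas.
(* This is what makes the squared steps summable: [r] bounds their tail in telescoping form. *)
have alpha2 : 1 < 2 * alpha by lra.
have [C2 C20 hC2] := powRN_telescope alpha2.
pose r n : R := cgamma ^+ 2 * (C2 * n%:R `^ (- (2 * alpha - 1))).
have r0 n : 0 <= r n by rewrite !mulr_ge0 ?powR_ge0 ?sqr_ge0// ltW.
have r_cvg0 : r n @[n --> \oo] --> (0 : R).
  rewrite -[X in _ --> X](mulr0 (cgamma ^+ 2)); apply: cvgMr.
  rewrite -[X in _ --> X](mulr0 C2); apply: cvgMr; apply: cvg_powRN; lra.
have g_sqr n : (1 <= n)%N -> gam n ^+ 2 <= r n - r n.+1.
  move=> n1; rewrite /r -mulrBr /gam exprMn; apply: ler_wpM2l; first exact: sqr_ge0.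
  apply: le_trans (hC2 n n1).
  by rewrite -powR_mulrn ?powR_ge0// -powRrM (_ : - alpha * 2%:R = - (2 * alpha))//; ring.
have g_lb n : (1 <= n)%N -> cgamma / n%:R <= gam n.
  move=> n1; rewrite /gam; apply: ler_wpM2l; first exact: ltW.
  rewrite powRN lef_pV2 ?posrE ?powR_gt0 ?ltr0n//.
  by apply: ler1_powR; [rewrite ler1n|exact: ltW].
have hV : {ae P, forall w, `|Z n w - m| ^+ 2 @[n --> \oo] --> (0 : R)}.
  exact: (V_ae_cvg0 Hnorm Hsep Xs_indep Xs_law dg_meas gradG_E g0 Z1_meas' Z_rec
    L0 l0 dg2 coercive r0 r_cvg0 g_sqr cgamma_gt0 g_lb Z1_bounded).
pose p := 2 * (1 + eta).
have hpa : 2 < p * alpha.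
  have : alpha^-1 < 1 + eta by lra.
  rewrite -(ltr_pM2r alpha0) mulVf ?gt_eqF// => h.
  by rewrite /p -mulrA; lra.
have p0 : 0 < p by rewrite -(pmulr_lgt0 _ alpha0); apply: lt_trans hpa.
(* The midpoint of the window []1/p, alpha/2[]: the lower end gives [s p > 1], the upper
   [2 s < alpha]. *)
pose s := (p^-1 + alpha / 2) / 2.
have pV0 : 0 < p^-1 by rewrite invr_gt0.
have pV : p^-1 < alpha / 2.
  by rewrite -[p^-1]mul1r ltr_pdivrMr//; lra.
have s0 : 0 < s by rewrite /s; lra.
have sa : 2 * s < alpha by rewrite /s; lra.
have sp : 1 < s * p.
  by rewrite -ltr_pdivrMr// mul1r /s; lra.
have hK : {ae P, forall w, \forall n \near \oo,
    `|dg (Xs n.+1 w) (Z n w)| <= (1 + C) * n%:R `^ s}.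
  apply: (ae_innovation_bound Hsep Xs_indep Xs_law dg_meas Z1_meas' Z_rec f_meas
    f_ge0 C_gt0 p0 s0 sp Leta0 dg_bound _ hV).
  by move=> h; have := hLeta h; rewrite unlock.
have C1 : 0 < 1 + C by rewrite addr_gt0.
have [k k0 hk] := ae_rate_alpha Hnorm Hsep Xs_indep Xs_law dg_meas gradG_E g0
  Z1_meas' Z_rec L0 l0 dg2 coercive cgamma_gt0 (fun=> erefl) alpha_lt1 s0 sa C1 hV hK.
split.
  apply: filterS hk => w hw; apply/eqO_exP; exists (2 / k); first by rewrite divr_gt0.
  near=> n.
  have n1 : (1 <= n)%N by near: n; exact: nbhs_infty_ge.
  have n0 : 0 < n%:R `^ alpha :> R by rewrite powR_gt0// ltr0n.
  have hn : k * n%:R `^ alpha * `|Z n w - m| ^+ 2 <= 2 * ln n%:R by near: n.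
  rewrite ger0_norm ?sqr_ge0// ger0_norm; last first.
    by rewrite divr_ge0 ?powR_ge0// ln_ge0// ler1n.
  rewrite -(ler_pM2l (mulr_gt0 k0 n0)); apply: le_trans hn _.
  rewrite le_eqVlt; apply/orP; left; apply/eqP.
  by field; rewrite !gt_eqF.
have gradG_cont : continuous gradG.
  by move=> h; apply: differentiable_continuous; case: (G_hess h).
move=> delta delta0.
have hN := noise_ae_rate Hnorm Hsep Xs_indep Xs_law dg_meas gradG_E g0 Z1_meas'
  Z_rec L0 l0 dg2 coercive r0 g_sqr Z1_bounded gradG_cont delta0.
apply: filterS3 hk hV hN => w hkw hVw hNw.
apply/eqoP => e e0.
(* The logarithm in the first rate is absorbed in two ways. [ln n <= n^(1 - alpha)] gives
   [|T n| = O(n^(1/2 - alpha))], and [ln n <= n^(alpha - 1/2)] gives [|T n|^2 = O(n^(-1/2))], the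
   size of the Taylor remainder required by [summation_by_parts]. *)
have cA : ln n%:R * n%:R `^ (- (1 - alpha)) @[n --> \oo] --> (0 : R).
  by apply: cvg_ln_powRN; rewrite subr_gt0.
have cB : ln n%:R * n%:R `^ (- (alpha - 2^-1)) @[n --> \oo] --> (0 : R).
  by apply: cvg_ln_powRN; rewrite subr_gt0.
move/cvgrPdist_le : cA => /(_ 1 ltr01) cA.
move/cvgrPdist_le : cB => /(_ 1 ltr01) cB.
move/cvgrPdist_le : hVw => /(_ _ (exprn_gt0 2 eps'0)) hVw.
pose T n := Z n w - m.
pose D n := dg (Xs n.+1 w) (Z n w).
pose K1 := Num.sqrt (2 / k).
have k20 : 0 <= 2 / k by rewrite divr_ge0// ltW.
have [N N1 hN'] : exists2 N, (1 <= N)%N & forall n, (N <= n)%N ->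
    `|T n| <= K1 * n%:R `^ (2^-1 - alpha) /\
    `|gradG (Z n w) - Gamma m (T n)| <= Ceps' * (2 / k) * 2 * n.+1%:R `^ (- 2^-1).
  move: hkw cA cB hVw => [N2 _ hkw] [N3 _ cA] [N4 _ cB] [N5 _ hVw].
  exists (maxn 1 (maxn N2 (maxn N3 (maxn N4 N5)))); first exact: leq_maxl.
  move=> n; rewrite !geq_max => /and5P[n1 nN2 nN3 nN4 nN5].
  have n0 : 0 < n%:R :> R by rewrite ltr0n.
  have powD x y : n%:R `^ (x + y) = n%:R `^ x * n%:R `^ y :> R.
    by rewrite powRD//; apply/implyP => _; rewrite gt_eqF.
  have hv := hkw n nN2.
  have ln_le x : `|0 - ln n%:R * n%:R `^ (- x)| <= 1 -> ln n%:R <= n%:R `^ x :> R.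
    rewrite sub0r normrN => /(le_trans (ler_norm _)).
    by rewrite powRN ler_pdivrMr ?powR_gt0// mul1r.
  have V_le x : `|0 - ln n%:R * n%:R `^ (- x)| <= 1 ->
      `|T n| ^+ 2 <= 2 / k * n%:R `^ (x - alpha).
    move=> /ln_le hx; have a0 : 0 < n%:R `^ alpha :> R by rewrite powR_gt0.
    rewrite -(ler_pM2l (mulr_gt0 k0 a0)); apply: le_trans hv _.
    rewrite powD powRN [leRHS](_ : _ = 2 * n%:R `^ x); last first.
      by field; rewrite !gt_eqF.
    by rewrite ler_pM2l.
  have hA := V_le _ (cA n nN3); have hB := V_le _ (cB n nN4).
  split.
    rewrite -ler_sqr ?nnegrE ?mulr_ge0 ?powR_ge0 ?sqrtr_ge0//.
    have sqE : (n%:R `^ (2^-1 - alpha)) ^+ 2 = n%:R `^ (1 - alpha - alpha) :> R.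
      by rewrite -powR_mulrn ?powR_ge0// -powRrM; congr (_ `^ _); field.
    by rewrite exprMn sqr_sqrtr// sqE.
  have hT : `|T n| <= eps'.
    rewrite -ler_sqr ?nnegrE ?(ltW eps'0)//.
    have := hVw n nN5; rewrite sub0r normrN; apply: le_trans.
    exact: ler_norm.
  apply: le_trans (taylor _ hT) _.
  rewrite -(mulrA _ 2) -mulrA; apply: ler_wpM2l; first exact: ltW.
  (* Passing from [n^(-1/2)] to [(n + 1)^(-1/2)] accounts for the factor 2 in the remainder
     constant. *)
  have h2 : n.+1%:R `^ 2^-1 <= 2 * n%:R `^ 2^-1 :> R.
    apply: (@le_trans _ _ ((2 * n%:R) `^ 2^-1)).
      apply: ge0_ler_powR; rewrite ?nnegrE ?mulr_ge0//.
      by rewrite -natrM ler_nat mul2n -addnn -addn1 leq_add2l.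
    rewrite powRM//; apply: ler_wpM2r; first exact: powR_ge0.
    by apply: ler1_powR; [rewrite ler1n|rewrite invf_le1// ler1n].
  apply: le_trans hB _.
  rewrite (_ : alpha - 2^-1 - alpha = - 2^-1); last by ring.
  apply: ler_wpM2l => //.
  rewrite !powRN ler_pdivlMr ?powR_gt0// mulrC ler_pdivrMr ?powR_gt0//.
have K10 : 0 <= K1 by exact: sqrtr_ge0.
have [K K0 hK'] := @summation_by_parts R H (Gamma m) T D (fun n => gradG (Z n w))
  cgamma alpha l K1 (Ceps' * (2 / k) * 2) N cgamma_gt0 (ltW alpha0) (ltW alpha_lt1) K10
  (mulr_ge0 (mulr_ge0 (ltW Ceps'0) k20) (ler0n R 2)) N1
  (fun n n1 => etrans (congr1 (fun z => z - m) (Z_rec n n1 w)) (addrAC _ _ _)) Gm_below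
  (fun n Nn => (hN' n Nn).1) (fun n Nn => (hN' n Nn).2).
have hT n : (N <= n)%N -> `|T n| <= K1 * n%:R `^ 2^-1.
  move=> Nn; apply: le_trans (hN' n Nn).1 _; apply: ler_wpM2l => //.
  apply: ler_powR; first by rewrite ler1n (leq_trans N1).
  by rewrite gerBl ltW.
have := average_eventually (M := fun n => noise n w) l0 K0 K10 delta0 hK' hT hNw e0.
apply: filter_app; near=> n => hn.
have n1 : (1 <= n)%N by near: n; exact: nbhs_infty_ge.
rewrite ger0_norm ?sqr_ge0// ger0_norm ?divr_ge0 ?powR_ge0//.
apply: le_trans hn; rewrite le_eqVlt; apply/orP; left; apply/eqP.
congr (`|_| ^+ 2); rewrite /averaged /T sumrB scalerBr; congr (_ - _).
rewrite sumr_const_nat subn1/= -[X in _ = _ *: X]scaler_nat scalerA mulVf ?scale1r//.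
by rewrite pnatr_eq0 -lt0n.
Unshelve. all: by end_near. Qed.
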